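(* Let $r,p^{-1},q\in L^1_{\mathrm{loc}}(\mathbb R)$ be real valued with $p>0$ almost everywhere, $r>0$ a.e. on $(0,\infty)$ and $r<0$ a.e. on $(-\infty,0)$. Assume that $p$ and $q$ are even and $r$ is odd, i.e. $p(x)=p(-x)$, $q(x)=q(-x)$, $r(x)=-r(-x)$ for a.e. $x\in\mathbb R$. Assume that the maximal operator $A$ associated with $\ell=\frac{1}{|r|}\left(-\frac{d}{dx}p\frac{d}{dx}+q\right)$ is selfadjoint in $L^2_{|r|}(\mathbb R)$, that $\min\sigma(A)>0$, and that $\min\sigma(A)<\min\sigma_{\mathrm{ess}}(A)$. Let $JA$ be the corresponding indefinite Sturm-Liouville operator, where $J$ is multiplication by $\operatorname{sgn} r$. Then for $0\le\alpha<\min\sigma(A)<\beta\le\min\sigma_{\mathrm{ess}}(A)$ one has $n_{JA}(\alpha,\beta)=n_{JA}(-\beta,-\alpha)$, and this number equals $\tfrac12 n_A(\alpha,\beta)$ if $n_A(\alpha,\beta)$ is even, and equals $\tfrac12(n_A(\alpha,\beta)+1)$ or $\tfrac12(n_A(\alpha,\beta)-1)$ if $n_A(\alpha,\beta)$ is odd; moreover, one of the quantities $n_A(\alpha,\beta)$, $n_{JA}(\alpha,\beta)$, $n_{JA}(-\beta,-\alpha)$ is infinite if and only if all three are infinite. In particular, the eigenvalues of $A$ below $\min\sigma_{\mathrm{ess}}(A)$ accumulate to $\min\sigma_{\mathrm{ess}}(A)$ if and only if the eigenvalues of $JA$ in the interval $(-\min\sigma_{\mathrm{ess}}(A),\min\sigma_{\mathrm{ess}}(A))$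 accumulate to $-\min\sigma_{\mathrm{ess}}(A)$ and to $\min\sigma_{\mathrm{ess}}(A)$.
   Context: $L^2_{|r|}(\mathbb R)$ is the Hilbert space of (classes of) measurable $f:\mathbb R\to\mathbb C$ with $|f|^2|r|\in L^1(\mathbb R)$ and scalar product $(f,g)=\int_{\mathbb R} f\,\overline{g}\,|r|\,dx$. The maximal operator $A$ is $Af=\ell f=\frac1{|r|}(-(pf')'+qf)$ with domain $\mathfrak D=\{f\in L^2_{|r|}(\mathbb R): f,\,pf' \text{ locally absolutely continuous},\ \ell f\in L^2_{|r|}(\mathbb R)\}$. The fundamental symmetry is $(Jf)(x)=\operatorname{sgn}(r(x))f(x)$, and $JAf=\frac1r(-(pf')'+qf)$ with $\operatorname{dom}JA=\mathfrak D$. The essential spectrum $\sigma_{\mathrm{ess}}(T)$ of a closed operator $T$ is the set of $\lambda\in\mathbb C$ such that $T-\lambda$ is not Fredholm; $\min\emptyset:=+\infty$. $n_T(a,b)$ denotes the number (possibly $\infty$) of eigenvalues of $T$ in the open interval $(a,b)$; $\alpha,\beta$ are real numbers. *)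

(* Defs.v *)
From HB Require Import structures.
From mathcomp Require Import all_boot all_order all_algebra lra.
From mathcomp Require Import generic_quotient ring_quotient complex.
From mathcomp Require Import all_classical all_reals all_analysis.
From mathcomp Require Import measurable_realfun.

Set Implicit Arguments.
Unset Strict Implicit.
Unset Printing Implicit Defensive.

Import Order.TTheory GRing.Theory Num.Theory.
Import numFieldNormedType.Exports.
Import ComplexField.Normc.

Local Open Scope classical_set_scope.
Local Open Scope ring_scope.
Local Open Scope complex_scope.

(** [H] is a complex vector space and [ip] its scalar product, linear in the
    first argument. An operator [T] is the set of pairs [(f, T f)] with [f] in
    the domain of [T]. *)

Section Operators.
Variables (R : realType) (H : lmodType R[i]) (ip : H -> H -> R[i]).
Implicit Types (S T : set (H * H)) (V : set H).

Definition hnorm (f : H) : R := Num.sqrt (complex.Re (ip f f)).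

Definition hdense V :=
  forall f (e : R), 0 < e -> exists2 g, V g & hnorm (f - g) < e.

Definition hclosed V := forall (v : nat -> H) (f : H),
  (forall n, V (v n)) -> hnorm (v n - f) @[n --> \oo] --> 0 -> V f.

Definition lincomb n (v : 'I_n -> H) (c : 'I_n -> R[i]) : H :=
  \sum_(i < n) c i *: v i.

Definition finite_dim V := exists n (v : 'I_n -> H),
  forall f, V f -> exists c, f = lincomb v c.

Definition finite_codim V := exists n (v : 'I_n -> H),
  forall f, exists g c, V g /\ f = g + lincomb v c.

Definition op_dom T : set H := [set f | exists g, T (f, g)].
Definition op_ran T : set H := [set g | exists f, T (f, g)].
Definition op_ker T : set H := [set f | T (f, 0)].

Definition op_comp S T : set (H * H) :=
  [set fh | exists g, T (fh.1, g) /\ S (g, fh.2)].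

Definition op_shift T (l : R[i]) : set (H * H) :=
  [set fh | exists g, T (fh.1, g) /\ fh.2 = g - l *: fh.1].

Definition adjoint T : set (H * H) :=
  [set gh | forall f k, T (f, k) -> ip k gh.1 = ip f gh.2].

Definition selfadjoint T := hdense (op_dom T) /\ T = adjoint T.

Definition resolvent_set T : set R[i] := [set l |
  (forall h, exists! f, op_shift T l (f, h)) /\
  exists C : R, forall f h, op_shift T l (f, h) -> hnorm f <= C * hnorm h].

Definition spectrum T : set R[i] := ~` resolvent_set T.

Definition fredholm T :=
  [/\ finite_dim (op_ker T), hclosed (op_ran T) & finite_codim (op_ran T)].

Definition ess_spectrum T : set R[i] := [set l | ~ fredholm (op_shift T l)].

Definition eigenvalue T : set R[i] :=
  [set l | exists f, f != 0 /\ T (f, l *: f)].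

Definition real_eigenvalue T : set R := [set x | eigenvalue T x%:C].

(** The number of eigenvalues, without multiplicities, in the open interval
    from [a] to [b]; it is [+oo] if there are infinitely many. *)
Definition n_eig T (a b : R) : \bar R :=
  counting [set x | real_eigenvalue T x /\ a < x < b].

End Operators.

Section RealSubsets.
Variable R : realType.

(** [m] is the minimum of the subset [S] of the complex plane, with
    min set0 = +oo. In the order of [R[i]], [x%:C <= z] says that [z] is real
    and not smaller than [x], so that only sets of real numbers have a
    minimum. *)
Definition is_min (S : set R[i]) (m : \bar R) : Prop :=
  match m with
  | x%:E => S x%:C /\ forall z, S z -> x%:C <= z
  | +oo%E => S = set0
  | -oo%E => False
  end.

Definition clusters_at (S : set R) (m : \bar R) : Prop :=
  limit_point (EFin @` S) m.

End RealSubsets.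

Section L2.
Variables (R : realType) (r : R -> R).
Local Notation mu := (@lebesgue_measure R).

Definition L2_fun_prop (f : R -> R[i]) : Prop :=
  [/\ measurable_fun [set: R] (fun x => complex.Re (f x)),
      measurable_fun [set: R] (fun x => complex.Im (f x)) &
      mu.-integrable [set: R] (fun x => (normc (f x) ^+ 2 * `|r x|)%:E)].

Definition L2_fun_pred : {pred R -> R[i]} := fun f => `[< L2_fun_prop f >].

Let normc2 (z : R[i]) :
  normc z ^+ 2 = complex.Re z ^+ 2 + complex.Im z ^+ 2.
Proof. by case: z => a b /=; rewrite sqr_sqrtr// addr_ge0// sqr_ge0. Qed.

Let ReD (z w : R[i]) : complex.Re (z + w) = complex.Re z + complex.Re w.
Proof. by case: z; case: w. Qed.

Let ImD (z w : R[i]) : complex.Im (z + w) = complex.Im z + complex.Im w.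
Proof. by case: z; case: w. Qed.

Let ReM (z w : R[i]) : complex.Re (z * w) =
  complex.Re z * complex.Re w - complex.Im z * complex.Im w.
Proof. by case: z; case: w. Qed.

Let ImM (z w : R[i]) : complex.Im (z * w) =
  complex.Re z * complex.Im w + complex.Im z * complex.Re w.
Proof. by case: z; case: w. Qed.

Let normc2D (z w : R[i]) :
  normc (z + w) ^+ 2 <= 2 * normc z ^+ 2 + 2 * normc w ^+ 2.
Proof.
rewrite !normc2 ReD ImD; case: z => a b; case: w => c d /=.
rewrite -subr_ge0.
rewrite [X in 0 <= X](_ : _ = (a - c) ^+ 2 + (b - d) ^+ 2).
  by rewrite addr_ge0// sqr_ge0.
by rewrite !sqrrD !sqrrN !mulrN !mulr2n; lra.
Qed.

Lemma measurable_normc2 (f : R -> R[i]) :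
  measurable_fun [set: R] (fun x => complex.Re (f x)) ->
  measurable_fun [set: R] (fun x => complex.Im (f x)) ->
  measurable_fun [set: R] (fun x => normc (f x) ^+ 2).
Proof.
move=> mR mI; under eq_fun do rewrite normc2.
by apply: measurable_funD; apply: measurable_funX.
Qed.

(* No measurability of [r] is needed: where f or g does not vanish, |r| is the
   quotient of |f|^2 |r| + |g|^2 |r| by |f|^2 + |g|^2. *)
Lemma L2_fun_propD (f g : R -> R[i]) :
  L2_fun_prop f -> L2_fun_prop g -> L2_fun_prop (f + g).
Proof.
move=> [mRf mIf If] [mRg mIg Ig].
have mRD : measurable_fun [set: R] (fun x => complex.Re ((f + g) x)).
  under eq_fun do rewrite ReD; exact: measurable_funD.
have mID : measurable_fun [set: R] (fun x => complex.Im ((f + g) x)).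
  under eq_fun do rewrite ImD; exact: measurable_funD.
split => //.
have mf := measurable_int mu If; have mg := measurable_int mu Ig.
have Ifg : mu.-integrable [set: R]
    (fun x => (2 * (normc (f x) ^+ 2 * `|r x|))%:E +
              (2 * (normc (g x) ^+ 2 * `|r x|))%:E)%E.
  by apply: integrableD => //; under eq_fun do rewrite EFinM;
    apply: integrableZl.
apply: (le_integrable measurableT _ _ Ifg); last first.
  move=> x _ /=; rewrite lee_fin.
  have h1 : 0 <= normc ((f + g) x) ^+ 2 * `|r x| by rewrite mulr_ge0 ?sqr_ge0.
  rewrite (ger0_norm h1) (le_trans _ (ler_norm _))//.
  rewrite (mulrA 2 (normc (f x) ^+ 2)) (mulrA 2 (normc (g x) ^+ 2)) -mulrDl.
  by apply: ler_wpM2r; [exact: normr_ge0 | exact: normc2D].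
apply/measurable_EFinP.
rewrite (_ : (fun x => _) = (fun x => normc ((f + g) x) ^+ 2 *
    ((normc (f x) ^+ 2 * `|r x| + normc (g x) ^+ 2 * `|r x|) *
     (normc (f x) ^+ 2 + normc (g x) ^+ 2) `^ (-1)))).
  apply: measurable_funM; first exact: measurable_normc2.
  apply: measurable_funM.
    by apply: measurable_funD; apply/measurable_EFinP.
  apply: (@measurableT_comp _ _ _ _ _ _ (@powR R ^~ (-1))) => //.

  by apply: measurable_funD; exact: measurable_normc2.
apply/funext => x; have [s0|s0] := eqVneq (normc (f x) ^+ 2 + normc (g x) ^+ 2) 0.
  suff -> : normc ((f + g) x) ^+ 2 = 0 by rewrite !mul0r.
  apply/eqP; rewrite eq_le sqr_ge0 andbT (le_trans (normc2D _ _))//.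
  by rewrite -mulrDr s0 mulr0.
by rewrite -mulrDl powR_inv1 ?addr_ge0 ?sqr_ge0// [X in _ = _ * X]mulrAC mulfV// mul1r.
Qed.

Lemma L2_fun_propZ (a : R[i]) (f : R -> R[i]) :
  L2_fun_prop f -> L2_fun_prop (a *: f).
Proof.
move=> [mR mI If]; split.
- under eq_fun do rewrite ReM.
  by apply: measurable_funB; apply: measurable_funM.
- under eq_fun do rewrite ImM.
  by apply: measurable_funD; apply: measurable_funM.
- under eq_fun do rewrite normcM exprMn -mulrA EFinM.
  exact: integrableZl.
Qed.

Lemma L2_fun_prop0 : L2_fun_prop (0 : R -> R[i]).
Proof.
split; [exact: measurable_cst | exact: measurable_cst |].
under eq_fun do rewrite normc0 expr0n mul0r.
exact: integrable0.
Qed.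

Fact L2_fun_submod_closed : submod_closed L2_fun_pred.
Proof.
split; first exact/asboolP/L2_fun_prop0.
by move=> a f g /asboolP Lf /asboolP Lg; apply/asboolP/L2_fun_propD => //;
  exact: L2_fun_propZ.
Qed.

HB.instance Definition _ := GRing.isSubmodClosed.Build R[i] (R -> R[i])
  L2_fun_pred L2_fun_submod_closed.

Record L2_fun := MkL2Fun {
  L2_fun_val :> R -> R[i];
  L2_fun_valP : L2_fun_val \in L2_fun_pred }.

HB.instance Definition _ := [isSub for L2_fun_val].
HB.instance Definition _ := [Choice of L2_fun by <:].
HB.instance Definition _ := [SubChoice_isSubLmodule of L2_fun by <:].

Definition ae_null : {pred L2_fun} :=
  fun f => `[< {ae mu, forall x, f x = 0} >].

Fact ae_null_submod_closed : submod_closed ae_null.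
Proof.
split; first by apply/asboolP; exact: aeW.
move=> a f g /asboolP f0 /asboolP g0; apply/asboolP.
have ? := ae_filter_ringOfSetsType mu.
by apply: filterS2 f0 g0 => x /= fx gx; rewrite !fctE fx gx scaler0 addr0.
Qed.

HB.instance Definition _ := GRing.isSubmodClosed.Build R[i] L2_fun
  ae_null ae_null_submod_closed.

Definition L2 := @Quotient.quot L2_fun ae_null.

HB.instance Definition _ := Choice.on L2.
HB.instance Definition _ := GRing.Zmodule.on L2.
HB.instance Definition _ := EqQuotient.on L2.

Local Open Scope quotient_scope.

Definition L2_scale (a : R[i]) (F : L2) : L2 := \pi_L2 (a *: repr F).

Lemma pi_L2_scale a (f : L2_fun) : \pi_L2 (a *: f) = L2_scale a (\pi_L2 f).
Proof.
apply/esym/eqP; rewrite -Quotient.idealrBE -scalerBr rpredZ//.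
by rewrite Quotient.idealrBE reprK.
Qed.

Lemma pi_L2_add (f g : L2_fun) : \pi_L2 (f + g) = \pi_L2 f + \pi_L2 g.
Proof. exact: Quotient.pi_add. Qed.

Fact L2_scaleA a b F : L2_scale a (L2_scale b F) = L2_scale (a * b) F.
Proof.
elim/quotW: F => f.
by rewrite -(pi_L2_scale b f) -pi_L2_scale -(pi_L2_scale (a * b) f) scalerA.
Qed.

Fact L2_scale1 : left_id 1 L2_scale.
Proof. by elim/quotW => f; rewrite -pi_L2_scale scale1r. Qed.

Fact L2_scaleDr : right_distributive L2_scale +%R.
Proof.
move=> a; elim/quotW => f; elim/quotW => g.
by rewrite -(pi_L2_scale a f) -(pi_L2_scale a g) -!pi_L2_add
  -(pi_L2_scale a (f + g)) scalerDr.
Qed.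

Fact L2_scaleDl F : {morph L2_scale^~ F : a b / a + b}.
Proof.
elim/quotW: F => f a b.
by rewrite -(pi_L2_scale a f) -(pi_L2_scale b f) -pi_L2_add
  -(pi_L2_scale (a + b) f) scalerDl.
Qed.

HB.instance Definition _ := GRing.Zmodule_isLmodule.Build R[i] L2
  L2_scaleA L2_scale1 L2_scaleDr L2_scaleDl.

Definition L2_repr (F : L2) : R -> R[i] := repr F.

Lemma L2_eqP (F G : L2) :
  F = G <-> {ae mu, forall x, L2_repr F x = L2_repr G x}.
Proof.
split=> [->|FG]; first exact: aeW.
have ? := ae_filter_ringOfSetsType mu.
rewrite -[F]reprK -[G]reprK; apply/eqP; rewrite -Quotient.idealrBE.
apply/asboolP; apply: filterS FG => x /= FGx.
by rewrite !fctE -/(L2_repr F x) -/(L2_repr G x) FGx subrr.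
Qed.

Definition cintegral (h : R -> R[i]) : R[i] :=
  (\int[mu]_x complex.Re (h x))%R +i* (\int[mu]_x complex.Im (h x))%R.

Definition L2_dot (F G : L2) : R[i] :=
  cintegral (fun x => L2_repr F x * (L2_repr G x)^* * `|r x|%:C).

End L2.
Arguments L2_dot {R} r F G.
Coercion L2_repr : L2 >-> Funclass.

Section AbsoluteContinuity.
Variable R : realType.

Definition abs_continuous_on (a b : R) (f : R -> R[i]) : Prop :=
  forall e : R, 0 < e -> exists2 d : R, 0 < d &
  forall s : seq (R * R),
    all (fun I => (a <= I.1) && (I.1 < I.2) && (I.2 <= b)) s ->
    pairwise (fun I J => (I.2 <= J.1) || (J.2 <= I.1)) s ->
    \sum_(I <- s) (I.2 - I.1) < d ->
    \sum_(I <- s) normc (f I.2 - f I.1) < e.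

Definition loc_abs_continuous (f : R -> R[i]) : Prop :=
  forall a b, abs_continuous_on a b f.

Definition cderive (f : R -> R[i]) (x : R) : R[i] :=
  derive1 (fun t => complex.Re (f t)) x +i*
  derive1 (fun t => complex.Im (f t)) x.

End AbsoluteContinuity.

Section SturmLiouville.
Variables (R : realType) (r p q : R -> R).
Local Notation mu := (@lebesgue_measure R).

(** In the definition of the maximal operator [f] is the locally absolutely
    continuous representative of the class [F.1], [u] is the one of [p f'],
    and [F.2] is the class of [l f]. *)
Definition maximal_op : set (L2 r * L2 r) := [set F : L2 r * L2 r |
  exists f u : R -> R[i],
  [/\ loc_abs_continuous f, loc_abs_continuous u,
      {ae mu, forall x, F.1 x = f x},
      {ae mu, forall x, u x = (p x)%:C * cderive f x} &
      {ae mu, forall x,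
        F.2 x = (`|r x|^-1)%:C * (- cderive u x + (q x)%:C * f x)}]].

Definition fund_symmetry : set (L2 r * L2 r) :=
  [set F : L2 r * L2 r | {ae mu, forall x, F.2 x = (Num.sg (r x))%:C * F.1 x}].

Definition indefinite_op : set (L2 r * L2 r) :=
  op_comp fund_symmetry maximal_op.

End SturmLiouville.
Arguments maximal_op {R} r p q _.
Arguments fund_symmetry {R} r _.
Arguments indefinite_op {R} r p q _.

(* Main.v *)
(** Let [K] be the restriction of [A^-1] to the even functions and [D] its
    restriction to the odd functions, carried over to the even functions by [J].
    The eigenvalues of [A^-1] are those of [K] together with those of [D]; and
    as [J] exchanges even and odd functions, [l] is an eigenvalue of [JA] if
    and only if [l^-2] is one of [K D]. In particular the eigenvalues of [JA]
    are symmetric about 0.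

    If the even function [f = A^-1 g] vanishes at 0, then it has zero Cauchy
    data there, since [p f'] is odd, and therefore [A (J f) = J g]. Hence [K]
    and [D] (the Neumann and the Dirichlet problem on the half-line) differ by
    a rank one operator [c (., h) h]. The operators [K^2], [K D], [D^2] thus
    have rank one differences as well; they are symmetric with respect to the
    forms [(., .)], [(K ., .)] or [(D ., .)], and comparing such pairs shows
    that between two eigenvalues of [D ^ 2] there is one of [K D], between two
    of [K D] one of [K ^ 2], and between two of [K ^ 2] one of [D ^ 2]. By ODE
    uniqueness [K] and [D] have no eigenvalue in common. So if [x], [z], [y]
    are the numbers of eigenvalues of [D ^ 2], [K D], [K ^ 2] in the given range
    and [c >= 0], then [x <= z <= y <= x + 1], while [A] has [x + y]
    eigenvalues there. *)

Require Import Defs.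
From HB Require Import structures.
From mathcomp Require Import all_boot all_order all_algebra.
From mathcomp Require Import generic_quotient ring_quotient complex.
From mathcomp Require Import finmap.
From mathcomp Require Import all_classical all_reals all_analysis.
From mathcomp Require Import measurable_realfun.
From mathcomp Require Import zify ring lra.

Set Implicit Arguments.
Unset Strict Implicit.
Unset Printing Implicit Defensive.

Import Order.TTheory GRing.Theory Num.Theory.
Import numFieldNormedType.Exports.
Import ComplexField.Normc.
Import HBSimple.

Local Open Scope classical_set_scope.
Local Open Scope ring_scope.
Local Open Scope complex_scope.

(** The comparison of eigenvalues has to do without a spectral theorem: the forms [(K ., .)] and
    [(D ., .)] are only semidefinite and give no complete space, and [K D] is in general not
    symmetric in the original scalar product. Its place is taken by a statement on spectral gaps: if
    [S - t] is boundedly invertible for all [t] in an interval with midpoint [t0] and radius [d],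
    then [|(S - t0) v| > d |v|] whenever [|v| > 0]. Invertibility is asked for in the complete norm
    and carried over to the form by Krein's argument for symmetrizable operators. Two eigenvectors
    of one operator of a pair have a combination on which the rank one term vanishes, and there the
    other operator violates the inequality. Where there is no eigenvalue, invertibility comes from
    the Fredholm alternative, hence the restriction to the range below [min sigma_ess(A)]; for [K D]
    it is derived by the Sherman-Morrison formula from that of [K^2] or [D^2], one of which is
    available because [K] and [D] share no eigenvalue. The sign of [c] remains undetermined, but
    exchanging [K] and [D] reverses it. *)

Section ComplexFacts.
Variable R : realType.
Implicit Types z w : R[i].

Lemma ReD z w : complex.Re (z + w) = complex.Re z + complex.Re w.
Proof. by case: z; case: w. Qed.
Lemma ImD z w : complex.Im (z + w) = complex.Im z + complex.Im w.
Proof. by case: z; case: w. Qed.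
Lemma ReN z : complex.Re (- z) = - complex.Re z.
Proof. by case: z. Qed.
Lemma ImN z : complex.Im (- z) = - complex.Im z.
Proof. by case: z. Qed.
Lemma ReB z w : complex.Re (z - w) = complex.Re z - complex.Re w.
Proof. by rewrite ReD ReN. Qed.
Lemma ImB z w : complex.Im (z - w) = complex.Im z - complex.Im w.
Proof. by rewrite ImD ImN. Qed.
Lemma ReM z w : complex.Re (z * w) =
  complex.Re z * complex.Re w - complex.Im z * complex.Im w.
Proof. by case: z; case: w. Qed.
Lemma ImM z w : complex.Im (z * w) =
  complex.Re z * complex.Im w + complex.Im z * complex.Re w.
Proof. by case: z; case: w. Qed.
Lemma ReZ (a : R) z : complex.Re (a%:C * z) = a * complex.Re z.
Proof. by rewrite ReM /= mul0r subr0. Qed.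
Lemma ImZ (a : R) z : complex.Im (a%:C * z) = a * complex.Im z.
Proof. by rewrite ImM /= mul0r addr0. Qed.
Lemma ReJ z : complex.Re (conjc z) = complex.Re z.
Proof. by case: z. Qed.
Lemma ImJ z : complex.Im (conjc z) = - complex.Im z.
Proof. by case: z. Qed.
Lemma complexE z w : complex.Re z = complex.Re w ->
  complex.Im z = complex.Im w -> z = w.
Proof. by case: z => a b; case: w => c d /= -> ->. Qed.
Lemma conjcR (a : R) : conjc a%:C = a%:C :> R[i].
Proof. by apply: complexE => //=; rewrite oppr0. Qed.
Lemma conjM z w : conjc (z * w) = conjc z * conjc w.
Proof. by case: z => a b; case: w => c d; apply: complexE => /=; ring. Qed.
Lemma conjD z w : conjc (z + w) = conjc z + conjc w.
Proof. by case: z => a b; case: w => c d; apply: complexE => /=; ring. Qed.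
Lemma realcD (a b : R) : (a + b)%:C = a%:C + b%:C :> R[i].
Proof. by apply: complexE => //=; rewrite addr0. Qed.
Lemma realcM (a b : R) : (a * b)%:C = a%:C * b%:C :> R[i].
Proof. by apply: complexE => /=; ring. Qed.
Lemma realcN (a : R) : (- a)%:C = - a%:C :> R[i].
Proof. by apply: complexE => //=; rewrite oppr0. Qed.
Lemma realc_eq0 (a : R) : (a%:C == 0 :> R[i]) = (a == 0).
Proof. by apply/eqP/eqP => [[]|->]. Qed.
End ComplexFacts.

(** * Spectral gaps of symmetric operators *)

Section Forms.
Variables (R : realType) (H : lmodType R[i]).
Implicit Types (g : H -> H -> R[i]) (S T : H -> H) (u v w : H).

(** Only semidefiniteness is asked for: the forms [(K ., .)] and [(D ., .)] to which this is applied
    vanish on the odd functions. *)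
Record hform g : Prop := Hform {
  hformD : forall u v w, g (u + v) w = g u w + g v w;
  hformZ : forall a u w, g (a *: u) w = a * g u w;
  hformC : forall u v, g v u = conjc (g u v);
  hform_ge0 : forall v, 0 <= complex.Re (g v v) }.

Definition qf g v : R := complex.Re (g v v).

Definition gsym g S := forall u v, g (S u) v = g u (S v).

Section Theory.
Variables (g : H -> H -> R[i]) (gH : hform g).

Lemma hformDr u v w : g u (v + w) = g u v + g u w.
Proof. by rewrite (hformC gH) (hformD gH) conjD -(hformC gH v) -(hformC gH w). Qed.
Lemma hformZr a u w : g u (a *: w) = conjc a * g u w.
Proof. by rewrite (hformC gH) (hformZ gH) conjM -(hformC gH w). Qed.
Lemma hform0l w : g 0 w = 0.
Proof. by rewrite -(scale0r 0) (hformZ gH) mul0r. Qed.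
Lemma hformN u w : g (- u) w = - g u w.
Proof. by rewrite -scaleN1r (hformZ gH) mulN1r. Qed.
Lemma hformNr u w : g u (- w) = - g u w.
Proof.
rewrite -scaleN1r hformZr (_ : conjc (-1) = -1) ?mulN1r//.
by apply: complexE => /=; rewrite ?oppr0.
 Qed.
Lemma qfE v : g v v = (qf g v)%:C.
Proof.
apply: complexE => //=; have := hformC gH v v.
case: (g v v) => a b [] /=; lra.
Qed.
Lemma qf_real u v : complex.Re (g v u) = complex.Re (g u v).
Proof. by rewrite (hformC gH) ReJ. Qed.
Lemma qfZ a v : qf g (a *: v) = (complex.Re a ^+ 2 + complex.Im a ^+ 2) * qf g v.
Proof.
rewrite /qf hformZ// hformZr// qfE; case: a => x y /=; ring.
Qed.
Lemma qfZr (t : R) v : qf g (t%:C *: v) = t ^+ 2 * qf g v.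
Proof. by rewrite qfZ /=; ring. Qed.
Lemma qfD u v : qf g (u + v) = qf g u + 2 * complex.Re (g u v) + qf g v.
Proof.
rewrite /qf (hformD gH) !hformDr !ReD (qf_real u v); lra.
Qed.
Lemma qfN v : qf g (- v) = qf g v.
Proof. by rewrite -scaleN1r qfZ /=; lra. Qed.
Lemma qfB u v : qf g (u - v) = qf g u - 2 * complex.Re (g u v) + qf g v.
Proof. by rewrite qfD qfN hformNr ReN; lra. Qed.
Lemma qf0 : qf g 0 = 0.
Proof. by rewrite /qf hform0l. Qed.

Lemma cauchy_schwarz u v : complex.Re (g u v) ^+ 2 <= qf g u * qf g v.
Proof.
set b := complex.Re _.
have E t : 0 <= qf g u + 2 * t * b + t ^+ 2 * qf g v.
  have := hform_ge0 gH (u + t%:C *: v); rewrite -/(qf _ _) qfD qfZr.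
  by rewrite hformZr conjcR ReZ -/b mulrA.
have qu := hform_ge0 gH u; rewrite -/(qf _ _) in qu.
have qv := hform_ge0 gH v; rewrite -/(qf _ _) in qv.
have [q0|q0] := eqVneq (qf g v) 0.
  have [->|b0] := eqVneq b 0; first by rewrite q0 mulr0 expr0n.
  have := E (- (qf g u + 1) / (2 * b)); rewrite q0 mulr0 addr0.
  rewrite (_ : 2 * _ * b = - (qf g u + 1)); last by field.
  lra.
have qp : 0 < qf g v by rewrite lt_neqAle eq_sym q0.
have := E (- b / qf g v).
rewrite (_ : _ + _ + _ = (qf g u * qf g v - b ^+ 2) / qf g v); last by field.
by rewrite pmulr_lge0 ?invr_gt0// subr_ge0.
Qed.

Lemma qf_eq0 u v : qf g u = 0 -> g u v = 0.
Proof.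
move=> u0; have Re0 w : complex.Re (g u w) = 0.
  apply/eqP; rewrite -sqrf_eq0 eq_le sqr_ge0 andbT.
  by have := cauchy_schwarz u w; rewrite u0 mul0r.
apply: complexE; first exact: Re0.
(* The imaginary part of [g u v] is the real part of [g u (i v)]. *)
have := Re0 ('i%C *: v); rewrite hformZr.
by case: (g u v) => a b /=; lra.
Qed.

Lemma qf_le2 u v : qf g (u + v) <= 2 * qf g u + 2 * qf g v.
Proof.
by have := hform_ge0 gH (u - v); rewrite -/(qf _ _) qfB qfD; lra.
Qed.

(* [n |-> qf g (S^n v)] is log-convex, so that it grows at least like
   [(qf g (S v) / qf g v) ^+ n], whereas [N (S^n v)] grows at most like
   [M ^+ n]. *)
Lemma krein S (N : H -> R) (B M : R) : 0 < M ->
  (forall v, qf g v <= B * N v) -> (forall v, 0 <= N v) ->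
  (forall v, N (S v) <= M * N v) -> gsym g S ->
  forall v, qf g (S v) <= M * qf g v.
Proof.
move=> M0 gN N0 SN gS v; rewrite leNgt; apply/negP => qSv.
pose a n := qf g (iter n S v).
have a_ge0 n : 0 <= a n by exact: hform_ge0.
have logc n : a n.+1 ^+ 2 <= a n * a n.+2.
  apply: le_trans (cauchy_schwarz _ _).
  by rewrite [iter n.+2 _ _]iterS -gS.
have qv : 0 < qf g v.
  rewrite lt_neqAle hform_ge0// andbT; apply/negP => /eqP q0.
  have := logc 0%N; rewrite /a /= -q0 mul0r => /le_trans /(_ (lexx _)).
  by rewrite -q0 mulr0 in qSv; rewrite leNgt exprn_gt0.
pose rho := qf g (S v) / qf g v.
have rhoM : M < rho by rewrite ltr_pdivlMr.
have rho0 : 0 < rho by exact: lt_trans rhoM.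
have step n : 0 < a n /\ rho * a n <= a n.+1.
  elim: n => [|n [an IH]]; first by split; rewrite /a//= /rho mulfVK ?gt_eqF.
  have an1 : 0 < a n.+1 by rewrite (lt_le_trans _ IH)// mulr_gt0.
  split=> //; rewrite -(ler_pM2l an) (le_trans _ (logc n))// expr2.
  by rewrite mulrA (mulrC _ rho) ler_pM2r.
have low n : rho ^+ n * qf g v <= a n.
  elim: n => [|n IH]; first by rewrite expr0 mul1r.
  by rewrite exprS -mulrA (le_trans _ (step n).2)// ler_pM2l.
have up n : a n <= B * M ^+ n * N v.
  apply: le_trans (gN _) _; have B0 : 0 <= B.
    rewrite leNgt; apply/negP => B0; have := lt_le_trans qv (gN v).
    by rewrite ltNge nmulr_rle0// N0.
  rewrite -mulrA; apply: ler_wpM2l => //.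
  elim: n => [|n IH]; first by rewrite expr0 mul1r.
  by rewrite exprS -mulrA (le_trans (SN _))// ler_pM2l.
(* By Bernoulli's inequality the powers of [rho / M > 1] exceed every bound, whereas [low] and [up]
   keep them below [b]. *)
pose x := rho / M - 1.
have x0 : 0 < x by rewrite subr_gt0 ltr_pdivlMr// mul1r.
have bern n : 1 + n%:R * x <= (rho / M) ^+ n.
  elim: n => [|n IH]; first by rewrite mul0r addr0 expr0.
  rewrite exprS (_ : rho / M = 1 + x); last by rewrite /x addrC subrK.
  rewrite (_ : rho / M = 1 + x) in IH; last by rewrite /x addrC subrK.
  apply: (@le_trans _ _ ((1 + x) * (1 + n%:R * x))).
    rewrite -natr1 -subr_ge0 [leRHS](_ : _ = x * (n%:R * x)); last by ring.
    by rewrite !mulr_ge0// ltW.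
  by rewrite ler_pM2l// ltr_pwDl ?ltW.
pose b := B * N v / qf g v.
have bound n : (rho / M) ^+ n <= b.
  rewrite /b expr_div_n ler_pdivlMr// mulrAC ler_pdivrMr ?exprn_gt0//.
  by rewrite (le_trans (low n))// mulrAC up.
have /(le_trans (bern _)) := bound (Num.truncn (b / x)).+1.
apply/negP; rewrite -ltNge.
have : b / x < (Num.truncn (b / x)).+1%:R.
  by apply: truncnS_gt.
by rewrite ltr_pdivrMr//; lra.
Qed.

End Theory.
End Forms.

Section Spectral.
Variables (R : realType) (H : lmodType R[i]).
Implicit Types (g : H -> H -> R[i]) (S T : H -> H) (u v w : H) (N : H -> R).

Lemma lin0 T : linear T -> T 0 = 0.
Proof. by move=> /(_ (-1) 0 0); rewrite scaler0 addr0 scaleN1r addNr. Qed.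
Lemma linZ T : linear T -> forall a u, T (a *: u) = a *: T u.
Proof. by move=> lT a u; rewrite -[a *: u]addr0 lT lin0// addr0. Qed.
Lemma linD T : linear T -> forall u v, T (u + v) = T u + T v.
Proof. by move=> lT u v; rewrite -[u in LHS]scale1r lT scale1r. Qed.
Lemma linB T : linear T -> forall u v, T (u - v) = T u - T v.
Proof. by move=> lT u v; rewrite -scaleN1r addrC lT scaleN1r addrC. Qed.

Definition shift S (t : R) v : H := S v - t%:C *: v.

(** [N] stands for a squared norm, so [M] bounds the square of the operator norm. *)
Definition bdd N S := exists2 M : R, 0 < M & forall v, N (S v) <= M * N v.

Definition binv N S :=
  exists W, [/\ forall v, W (S v) = v, forall v, S (W v) = v & bdd N W].

Lemma gsym_shift g S t : hform g -> gsym g S -> gsym g (shift S t).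
Proof.
move=> gH gS u v; rewrite /shift (hformD gH) (hformDr gH) -!scaleNr.
by rewrite (hformZ gH) (hformZr gH) gS -realcN conjcR.
Qed.

Lemma gsym_binv g S W : hform g -> gsym g S -> (forall v, S (W v) = v) ->
  gsym g W.
Proof. by move=> gH gS SW u v; rewrite -{2}(SW u) gS SW. Qed.

Section Lstar.
Variables (g : H -> H -> R[i]) (N : H -> R) (B : R).
Hypotheses (gH : hform g) (gN : forall v, qf g v <= B * N v).
Hypothesis N_ge0 : forall v, 0 <= N v.

(** The inverse of [S] is again [g]-symmetric, so [krein] turns its bound in [N] into one in [g]. *)
Lemma binv_qf_ge S : gsym g S -> binv N S ->
  exists2 M, 0 < M & forall v, qf g v <= M * qf g (S v).
Proof.
move=> gS [W [WS SW [M M0 NW]]]; exists M => // v; rewrite -{1}(WS v).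
exact: (krein gH M0 gN N_ge0 NW (gsym_binv gH gS SW)).
Qed.

(* [rho2] is the largest constant with [rho2 * qf g v <= qf g (T v)]; if
   [rho2 <= r ^+ 2], then [T ^2 - rho2] is a nonnegative symmetric operator
   that is bounded below, so that the constant could be improved. *)
Lemma qf_gap T (r : R) : linear T -> gsym g T -> bdd N T -> 0 <= r ->
  (forall t, - r <= t <= r -> binv N (shift T t)) ->
  forall v, 0 < qf g v -> r ^+ 2 * qf g v < qf g (T v).
Proof.
move=> linT gT [M M0 NT] r0 inv v0 qv0.
have q_ge0 v : 0 <= qf g v by exact: hform_ge0.
have TM v : qf g (T v) <= M * qf g v by exact: krein gN N_ge0 NT gT v.
pose E := [set x | exists2 v, 0 < qf g v & x = qf g (T v) / qf g v].
have infE : has_inf E.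
  split; first by exists (qf g (T v0) / qf g v0), v0.
  by exists 0 => _ [v qv ->]; rewrite divr_ge0// ltW.
have rho2_le v : inf E * qf g v <= qf g (T v).
  have [->|qv] := eqVneq (qf g v) 0; first by rewrite mulr0.
  have qv' : 0 < qf g v by rewrite lt_neqAle eq_sym qv q_ge0.
  rewrite -ler_pdivlMr//; apply: (inf_lbound infE.2); by exists v.
have [lt|ge] := ltP (r ^+ 2) (inf E).
  by rewrite (lt_le_trans _ (rho2_le _))// ltr_pM2r.
have rho2_ge0 : 0 <= inf E.
  by apply: lb_le_inf infE.1 _ => _ [v qv ->]; rewrite divr_ge0// ltW.
pose rho := Num.sqrt (inf E).
have rhoE : inf E = rho ^+ 2 by rewrite sqr_sqrtr.
have rho_ge0 : 0 <= rho by exact: sqrtr_ge0.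
have rho_le : rho <= r by rewrite -(ler_pXn2r (n:=2)) ?nnegrE// -rhoE.
(* Both [rho] and [- rho] lie in [[- r, r]], so the two factors [T - rho] and [T + rho] of
   [T^2 - rho^2] are bounded below in [g]. *)
have [M1 M10 q1] : exists2 M, 0 < M & forall v, qf g v <= M * qf g (shift T rho v).
  apply: binv_qf_ge; first exact: gsym_shift.
  apply: inv; rewrite rho_le andbT; lra.
have [M2 M20 q2] : exists2 M, 0 < M & forall v, qf g v <= M * qf g (shift T (- rho) v).
  apply: binv_qf_ge; first exact: gsym_shift.
  apply: inv; apply/andP; split; lra.
pose U v := T (T v) - (rho ^+ 2)%:C *: v.
have UE v : U v = shift T rho (shift T (- rho) v).
  rewrite /U /shift realcN scaleNr opprK (addrC (T v)) linT.
  rewrite scalerDr scalerA -realcM -expr2 opprD [RHS]addrC addrA subrK.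
  exact: addrC.
have gU : gsym g U.
  move=> u v; rewrite /U (hformD gH) (hformDr gH) -!scaleNr.
  by rewrite (hformZ gH) (hformZr gH) !gT -realcN conjcR.
have bE v : qf (fun u w => g (U u) w) v = qf g (T v) - inf E * qf g v.
  rewrite /qf /U (hformD gH) -scaleNr (hformZ gH) gT -realcN ReD ReZ rhoE.
  by rewrite mulNr.
have bH : hform (fun u w => g (U u) w).
  split.
  - move=> u v w; rewrite -(hformD gH); congr (g _ w).
    by rewrite /U !(linD linT) scalerDr opprD addrACA.
  - move=> a u w; rewrite -(hformZ gH); congr (g _ w).
    by rewrite /U !(linZ linT) scalerBr !scalerA mulrC.
  - by move=> u v; rewrite (hformC gH) gU.
  - by move=> v; have := rho2_le v; rewrite -subr_ge0 -bE.
(* Cauchy-Schwarz for the nonnegative form [b = g (U .) .] at [v] and [U v]: [g (U v) (U v) ^+ 2 <=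
   b v v * b (U v) (U v)], and the last factor is at most [M * qf g (U v)]. *)
have qU v : qf g (U v) <= M * qf (fun u w => g (U u) w) v.
  have := cauchy_schwarz bH v (U v); rewrite -/(qf g (U v)) (bE (U v)) => CS.
  have [->|qv] := eqVneq (qf g (U v)) 0.
    by rewrite mulr_ge0 ?(ltW M0)//; exact: hform_ge0.
  have qv' : 0 < qf g (U v) by rewrite lt_neqAle eq_sym qv q_ge0.
  rewrite -(ler_pM2r qv') -expr2 (le_trans CS)// mulrC.
  rewrite [leRHS](_ : _ = (M * qf g (U v)) * qf (fun u w => g (U u) w) v); last ring.
  apply: ler_wpM2r; first exact: hform_ge0.
  by rewrite lerBlDr (le_trans (TM _))// lerDl mulr_ge0.
(* The constant comes from the chain [qf g v <= M1 M2 qf g (U v) <= M1 M2 M (qf g (T v) - inf E * qf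
   g v)]. *)
pose d := (M1 * M2 * M)^-1.
have d0 : 0 < d by rewrite invr_gt0 !mulr_gt0.
have improve v : (inf E + d) * qf g v <= qf g (T v).
  have le2 : qf g v <= M1 * M2 * M * (qf g (T v) - inf E * qf g v).
    rewrite (le_trans (q2 v))// (mulrC M1) -!mulrA ler_pM2l//.
    by rewrite (le_trans (q1 _))// ler_pM2l// -UE -bE.
  by rewrite mulrDl addrC -lerBrDr /d mulrC ler_pdivrMr ?mulr_gt0// mulrC.
have : inf E + d <= inf E.
  apply: lb_le_inf infE.1 _ => _ [v qv ->]; by rewrite ler_pdivlMr.
by rewrite gerDl leNgt d0.
Qed.

End Lstar.
End Spectral.

(** * Interlacing of eigenvalues under a rank one perturbation *)

Section Interlacing.
Variables (R : realType) (H : lmodType R[i]).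
Implicit Types (g : H -> H -> R[i]) (S T : H -> H) (u v w : H) (N : H -> R).

Definition nsq (z : R[i]) : R := complex.Re z ^+ 2 + complex.Im z ^+ 2.

Lemma nsq_ge0 z : 0 <= nsq z. Proof. by rewrite addr_ge0// sqr_ge0. Qed.
Lemma nsq1 : nsq 1 = 1. Proof. by rewrite /nsq /= expr1n expr0n addr0. Qed.
Lemma nsqM (z y : R[i]) : nsq (z * y) = nsq z * nsq y.
Proof. by rewrite /nsq ReM ImM; ring. Qed.
Lemma nsqN z : nsq (- z) = nsq z.
Proof. by rewrite /nsq ReN ImN !sqrrN. Qed.
Lemma nsqR (a : R) : nsq a%:C = a ^+ 2.
Proof. by rewrite /nsq /= expr0n addr0. Qed.
Lemma nsq_eq0 z : (nsq z == 0) = (z == 0).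
Proof.
rewrite /nsq paddr_eq0 ?sqr_ge0// !sqrf_eq0; case: z => a b /=.
by apply/andP/eqP => [[/eqP-> /eqP->]//|[-> ->]]; rewrite eqxx.
Qed.
Lemma nsq_gt0 z : (0 < nsq z) = (z != 0).
Proof. by rewrite lt_def nsq_eq0 nsq_ge0 andbT. Qed.
Lemma nsqJ z : z * conjc z = (nsq z)%:C.
Proof. by case: z => a b; apply: complexE; rewrite /nsq /=; ring. Qed.
Lemma nsqV z : z != 0 -> nsq z^-1 = (nsq z)^-1.
Proof.
move=> z0; have /(congr1 (@nsq)) := mulVf z0; rewrite nsqM.
rewrite nsq1 => /(canRL (mulfK _)) ->; last by rewrite nsq_eq0.
by rewrite mul1r.
Qed.

Lemma qfZn g a v : hform g -> qf g (a *: v) = nsq a * qf g v.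
Proof. by move=> gH; rewrite qfZ. Qed.

Lemma cauchy_schwarzC g u v : hform g -> nsq (g u v) <= qf g u * qf g v.
Proof.
move=> gH; set z := g u v; have [->|z0] := eqVneq (nsq z) 0.
  by rewrite mulr_ge0//; exact: hform_ge0.
have zp : 0 < nsq z by rewrite lt_def z0 nsq_ge0.
have := cauchy_schwarz gH (conjc z *: u) v.
rewrite (hformZ gH) -/z mulrC nsqJ /= qfZn// (_ : nsq (conjc z) = nsq z); last first.
  by rewrite /nsq ReJ ImJ sqrrN.
by rewrite -mulrA expr2 ler_pM2l.
Qed.

Lemma qf_orth g u v : hform g -> g u v = 0 -> forall x y : R[i],
  qf g (x *: u + y *: v) = nsq x * qf g u + nsq y * qf g v.
Proof.
move=> gH o x y; rewrite qfD// !qfZn// (hformZ gH) (hformZr gH) o !mulr0.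
by rewrite addr0.
Qed.

Lemma bdd_shift g S t : hform g -> bdd (qf g) S -> bdd (qf g) (shift S t).
Proof.
move=> gH [M M0 SM]; exists (2 * M + 2 * t ^+ 2).
  by rewrite ltr_pwDl ?mulr_gt0// mulr_ge0// sqr_ge0.
move=> v; rewrite /shift (le_trans (qf_le2 gH _ _))// qfN// qfZr// (mulrDl (2 * M)).
apply: lerD; last by rewrite mulrA.
by rewrite -mulrA ler_pM2l.
Qed.

Lemma linear_shift S t : linear S -> linear (shift S t).
Proof.
move=> lS x u w; rewrite /shift lS scalerDr opprD addrACA scalerA.
by rewrite [_ * x]mulrC -scalerA -scalerBr.
Qed.

Lemma linear_binv S W : linear S -> (forall v, W (S v) = v) ->
  (forall v, S (W v) = v) -> linear W.
Proof. by move=> lS WS SW a u v; rewrite -{1}[u]SW -{1}[v]SW -lS WS. Qed.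

Lemma eigen_orth g S (a b : R) u v : hform g -> gsym g S -> a != b ->
  S u = a%:C *: u -> S v = b%:C *: v -> g u v = 0.
Proof.
move=> gH gS ab Su Sv; have := gS u v.
rewrite Su Sv (hformZ gH) (hformZr gH) conjcR => /eqP.
rewrite -subr_eq0 -mulrBl mulf_eq0 -realcN -realcD realc_eq0 subr_eq0.
by rewrite (negbTE ab) => /eqP.
Qed.

(** The Sherman-Morrison formula: the inverse maps [y] to
    [W y - phi (W y) / (1 + phi (W w)) *: W w]. If the denominator vanished, [S (W w)] would be 0,
    so [W w = 0] by injectivity, and the denominator would be 1. *)
Lemma rank1_binv g S0 S (phi : H -> R[i]) (w : H) (L : R) : hform g ->
  linear S0 -> linear S -> (forall a u v, phi (a *: u + v) = a * phi u + phi v) ->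
  0 <= L -> (forall v, nsq (phi v) <= L * qf g v) -> binv (qf g) S0 ->
  (forall v, S v = S0 v + phi v *: w) -> (forall v, S v = 0 -> v = 0) ->
  binv (qf g) S.
Proof.
move=> gH lS0 lS lphi L0 phiL [W [WS SW [M M0 NW]]] SE Sinj.
have phiZ a u : phi (a *: u) = a * phi u.
  have phi0 : phi 0 = 0 by have := lphi (-1) 0 0; rewrite scaler0 addr0 mulN1r addNr.
  by have := lphi a u 0; rewrite phi0 !addr0.
have k0 : 1 + phi (W w) != 0.
  apply/eqP => k0; have : S (W w) = 0.
    by rewrite SE SW -{1}[w]scale1r -scalerDl k0 scale0r.
  move=> /Sinj Ww; move: k0; rewrite Ww -(scale0r 0) phiZ mul0r addr0 => /eqP.
  by rewrite oner_eq0.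
pose t y := phi (W y) / (1 + phi (W w)).
pose V y := - t y *: W w + W y.
have SV y : S (V y) = y.
  rewrite SE /V lS0 !SW lphi addrAC -scalerDl -[RHS]add0r; congr (_ + _).
  rewrite (_ : _ + _ = 0) ?scale0r// /t; field.
  exact: k0.
exists V; split => //.
  move=> v; apply/eqP; rewrite -subr_eq0; apply/eqP/Sinj.
  by rewrite (linB lS) SV subrr.
pose C := L * M / nsq (1 + phi (W w)).
have C0 : 0 <= C by rewrite divr_ge0 ?nsq_ge0// mulr_ge0// ltW.
exists (2 * (C * qf g (W w)) + 2 * M).
  apply: ltr_wpDl; last by rewrite mulr_gt0.
  apply: mulr_ge0 => //; apply: mulr_ge0 => //; exact: hform_ge0.
move=> y; rewrite /V (le_trans (qf_le2 gH _ _))// qfZn// nsqN (mulrDl (2 * (C * _))).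
apply: lerD; last by rewrite -mulrA ler_pM2l.
rewrite [leRHS](_ : _ = 2 * (qf g (W w) * (C * qf g y))); last by ring.
rewrite ler_pM2l// [leLHS]mulrC; apply: ler_wpM2l; first exact: hform_ge0.
rewrite /t nsqM nsqV// ler_pdivrMr ?nsq_gt0// /C mulrAC mulfVK ?nsq_eq0//.
by rewrite (le_trans (phiL _))// -mulrA ler_wpM2l.
Qed.

Section RankOne.
Variables (g n : H -> H -> R[i]) (B : R).
Local Notation N := (qf n).
Hypotheses (gH : hform g) (nH : hform n).
Hypothesis gN : forall v, qf g v <= B * N v.
Variables (S1 S2 : H -> H) (h : H) (c : R).
Hypotheses (lS1 : linear S1) (lS2 : linear S2).
Hypotheses (gS1 : gsym g S1) (gS2 : gsym g S2) (bS2 : bdd N S2).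
Hypothesis S2E : forall v, S2 v = S1 v + (c%:C * g v h) *: h.

(** The Fredholm alternative for [S - k], with the inverse bounded in the norm of [n]. *)
Definition alt S (k : R) :=
  (forall v, S v = k%:C *: v -> v = 0) -> binv N (shift S k).

(** If [[a, b]] contained no eigenvalue, every [S2 - k] with [k] in it would be invertible, and
    [qf_gap] for [S2] shifted to the midpoint would give the opposite strict inequality. *)
Lemma gap_eigen (a b : R) v : a < b -> (forall k, a <= k <= b -> alt S2 k) ->
  0 < qf g v ->
  qf g (shift S2 ((a + b) / 2) v) <= ((b - a) / 2) ^+ 2 * qf g v ->
  exists2 k, a <= k <= b & exists2 v, v != 0 & S2 v = k%:C *: v.
Proof.
move=> ab altS qv; rewrite leNgt => /negP le; apply: contrapT => noeig; apply: le.
apply: (qf_gap gH gN (hform_ge0 nH)) => //.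
- exact: linear_shift.
- exact: gsym_shift.
- exact: bdd_shift.
- by rewrite divr_ge0// subr_ge0 ltW.
move=> t /andP[t1 t2].
have -> : shift (shift S2 ((a + b) / 2)) t = shift S2 ((a + b) / 2 + t).
  by apply/funext => u; rewrite /shift realcD scalerDl opprD addrA.
have k1 : a <= (a + b) / 2 + t <= b by lra.
apply: altS => // u Su; apply: contrapT => /eqP u0; apply: noeig.
by exists ((a + b) / 2 + t) => //; exists u.
Qed.

(* On the combination of [e1] and [e2] that is orthogonal to [h] the operators
   [S1] and [S2] agree, so that [S2] has no gap around [a, b]. *)
Lemma eigen_between (a b : R) e1 e2 : a < b ->
  S1 e1 = a%:C *: e1 -> S1 e2 = b%:C *: e2 -> 0 < qf g e1 -> 0 < qf g e2 ->
  g e1 h != 0 -> (forall k, a <= k <= b -> alt S2 k) ->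
  exists2 k, a <= k <= b & exists2 v, v != 0 & S2 v = k%:C *: v.
Proof.
move=> ab E1 E2 q1 q2 eh altS.
have o : g e1 e2 = 0 by apply: eigen_orth gS1 _ E1 E2; rewrite // lt_eqF.
pose v := g e2 h *: e1 + (- g e1 h) *: e2.
have vh : g v h = 0 by rewrite /v (hformD gH) !(hformZ gH) mulrC mulNr subrr.
apply: (@gap_eigen a b v) => //.
  rewrite /v qf_orth// ltr_wpDl// ?mulr_ge0 ?nsq_ge0 ?ltW//.
  by rewrite mulr_gt0// nsq_gt0 oppr_eq0.
pose r := (b - a) / 2.
(* Relative to the midpoint, [e1] and [e2] belong to the eigenvalues [- r] and [r] of [S1]; being
   orthogonal, they make the two sides of the gap inequality equal. *)
have -> : shift S2 ((a + b) / 2) v =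
    ((- r)%:C * g e2 h) *: e1 + (r%:C * - g e1 h) *: e2.
  rewrite /shift S2E vh mulr0 scale0r addr0 /v (linD lS1) !(linZ lS1) E1 E2.
  rewrite scalerDr opprD addrACA !scalerA -!scalerBl.
  by congr (_ *: _ + _ *: _); rewrite ![_ * _%:C]mulrC -mulrBl -realcN -realcD;
    congr (_%:C * _); rewrite /r; field.
rewrite /v !qf_orth// !nsqM !nsqR sqrrN -/r.
by rewrite [leRHS]mulrDr !mulrA lexx.
Qed.

(** For [c > 0] a single eigenvector is a sufficient test vector:
    [(S2 - (a + r)) e = c (e, h) h - r e] has norm at most [r |e|] as soon as [2 r >= c (h, h)], so
    [[a, a + 2 r]] cannot be a gap. *)
Lemma eigen_above (a : R) e : 0 < c -> S1 e = a%:C *: e -> 0 < qf g e ->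
  g e h != 0 -> (forall k, a <= k -> alt S2 k) ->
  exists2 k, a <= k & exists2 v, v != 0 & S2 v = k%:C *: v.
Proof.
move=> c0 E q0 eh altS.
have qh : 0 <= qf g h by exact: hform_ge0.
pose r := (c * qf g h + 1) / 2.
have r0 : 0 < r by rewrite divr_gt0// ltr_wpDl// mulr_ge0// ltW.
have [||||k /andP[ak _] ?] := @gap_eigen a (a + 2 * r) e; last by exists k.
- lra.
- by move=> k /andP[ak _]; exact: altS.
- by [].
have -> : shift S2 ((a + (a + 2 * r)) / 2) e =
    (c%:C * g e h) *: h - r%:C *: e.
  rewrite /shift S2E E (_ : (_ + _) / 2 = a + r); last lra.
  by rewrite realcD scalerDl opprD addrACA subrr add0r.
rewrite (_ : (a + 2 * r - a) / 2 = r); last lra.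
rewrite qfB// qfZr// qfZn// nsqM nsqR (hformZr gH) (hformZ gH) conjcR.
rewrite (hformC gH e h) -(mulrA c%:C) nsqJ !ReZ.
have := nsq_gt0 (g e h); rewrite eh; set k := nsq _ => k0.
have le0 : 0 <= c * k * (2 * r - c * qf g h).
  by rewrite mulr_ge0 ?mulr_ge0 ?ltW// /r; lra.
rewrite -subr_ge0 (le_trans le0)// le_eqVlt; apply/orP; left; apply/eqP => /=.
ring.
Qed.

End RankOne.
End Interlacing.

(** * Symmetric operators with a rank one difference *)

Section Pair.
Variables (R : realType) (H : lmodType R[i]).
Implicit Types (g n : H -> H -> R[i]) (S T K D : H -> H) (u v w h : H).

Definition ev T (k : R) := exists2 v, v != 0 & T v = k%:C *: v.

Lemma binv_comp g S T : binv (qf g) S -> binv (qf g) T ->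
  binv (qf g) (S \o T).
Proof.
move=> [V [VS SV [M M0 NV]]] [W [WT TW [L L0 NW]]].
exists (W \o V); split => [v|v|] /=; [by rewrite VS WT|by rewrite TW SV|].
exists (L * M); first by rewrite mulr_gt0.
by move=> v /=; rewrite (le_trans (NW _))// -mulrA ler_pM2l.
Qed.

Lemma bdd_comp g S T : bdd (qf g) S -> bdd (qf g) T -> bdd (qf g) (S \o T).
Proof.
move=> [M M0 NV] [L L0 NW]; exists (M * L); first by rewrite mulr_gt0.
by move=> v /=; rewrite (le_trans (NV _))// -mulrA ler_pM2l.
Qed.

Lemma linear_comp S T : linear S -> linear T -> linear (S \o T).
Proof. by move=> lS lT a u v /=; rewrite lT lS. Qed.

Lemma shift_sqr T (k : R) : linear T ->
  shift (T \o T) (k ^+ 2) = shift T k \o shift T (- k).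
Proof.
move=> lT; apply/funext => v; rewrite /shift /= realcN scaleNr opprK.
rewrite (linD lT) (linZ lT) scalerDr scalerA -realcM -expr2 opprD addrA addrK.
by [].
Qed.

Definition pform n K u v := n (K u) v.

Lemma pform_hform n K : hform n -> linear K -> gsym n K ->
  (forall v, 0 <= complex.Re (n (K v) v)) -> hform (pform n K).
Proof.
move=> nH lK nK K0; split.
- by move=> u v w; rewrite /pform (linD lK) (hformD nH).
- by move=> a u v; rewrite /pform (linZ lK) (hformZ nH).
- by move=> u v; rewrite /pform (hformC nH) nK.
- exact: K0.
Qed.

(** Expand [0 <= qf n (K v - v)]. The result is the domination of the form by the norm from which
    [krein] starts. *)
Lemma pform_bound n K : hform n -> bdd (qf n) K ->
  exists B, forall v, qf (pform n K) v <= B * qf n v.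
Proof.
move=> nH [M M0 NK]; exists (M + 1) => v.
have h1 : 0 <= qf n (K v - v) by exact: hform_ge0.
have h2 : 0 <= qf n (K v) by exact: hform_ge0.
have h3 : 0 <= qf n v by exact: hform_ge0.
move: h1 (NK v); rewrite qfB// {1}[qf (pform _ _) _]/qf /pform mulrDl mul1r; lra.
Qed.

(* Two symmetric operators [K] and [D] differing by a rank one operator; the
   eigenvalues of [K \o D] are squares of the numbers in [evs]. *)
Record rank1_pair n K D h (c k0 : R) : Prop := Rank1Pair {
  pn : hform n;
  pdef : forall v, qf n v = 0 -> v = 0;
  plK : linear K;
  plD : linear D;
  psK : gsym n K;
  psD : gsym n D;
  pbK : bdd (qf n) K;
  pbD : bdd (qf n) D;
  pK0 : forall v, 0 <= complex.Re (n (K v) v);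
  pD0 : forall v, 0 <= complex.Re (n (D v) v);
  pKD : forall v, K v = D v + (c%:C * n v h) *: h;
  pk0 : 0 <= k0;
  paK : forall k, k0 < k -> ~ ev K k -> binv (qf n) (shift K k);
  paD : forall k, k0 < k -> ~ ev D k -> binv (qf n) (shift D k);
  pnK : forall k, 0 < k -> binv (qf n) (shift K (- k));
  pnD : forall k, 0 < k -> binv (qf n) (shift D (- k));
  pnocom : forall k e, k0 < k -> K e = k%:C *: e -> D e = k%:C *: e -> e = 0 }.

Definition evs K D (k : R) := ev (K \o D) (k ^+ 2).

(** [D] maps an eigenvector of [K D] to one of [D K]; it cannot annihilate it because [k] is
    positive. *)
Lemma evsC n K D h c k0 : rank1_pair n K D h c k0 ->
  forall k, k0 < k -> evs K D k -> evs D K k.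
Proof.
move=> p k kk [v v0 /= KDv]; have k_gt0 := le_lt_trans (pk0 p) kk.
exists (D v); last by rewrite /= KDv (linZ (plD p)).
apply: contraNneq v0 => Dv0; move: KDv; rewrite Dv0 (lin0 (plK p)) => /esym/eqP.
by rewrite scaler_eq0 realc_eq0 expf_eq0 gt_eqF.
Qed.

(** Exchanging the operators reverses the sign of [c]. Each statement on [K] thus yields one on [D],
    and the final count may assume [0 <= c]. *)
Lemma rank1_pairC n K D h c k0 : rank1_pair n K D h c k0 ->
  rank1_pair n D K h (- c) k0.
Proof.
move=> p; split; try (by case: p); last first.
  by move=> k e kk De Ke; apply: (pnocom p kk).
move=> v; rewrite (pKD p) realcN mulNr scaleNr addrK//.
Qed.

Section Theory.
Variables (n : H -> H -> R[i]) (K D : H -> H) (h : H) (c k0 : R).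
Hypothesis p : rank1_pair n K D h c k0.
Let nH := pn p.

(** [K^2 - k^2 = (K + k) (K - k)], and [K + k] is injective for [k > 0]. *)
Lemma sqr_eigen (k : R) v : 0 < k -> K (K v) = (k ^+ 2)%:C *: v ->
  K v = k%:C *: v.
Proof.
move=> kp KKv; have [W [WS _ _]] := pnK p kp.
have E : shift K (- k) (shift K k v) = 0.
  rewrite /shift (linB (plK p)) (linZ (plK p)) KKv realcN scaleNr opprK.
  by rewrite scalerBr scalerA -realcM -expr2 addrA subrK subrr.
have s0 : shift K (- k) 0 = 0 by rewrite /shift (lin0 (plK p)) scaler0 subr0.
apply/eqP; rewrite -subr_eq0 -/(shift K k v) -[shift K k v]WS E.
by rewrite -{1}s0 WS.
Qed.

(** Where the rank one term vanishes, [K v = D v], and [v] would be a common eigenvector. *)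
Lemma eigen_nh (k : R) v : k0 < k -> v != 0 -> K v = k%:C *: v ->
  c%:C * n v h != 0.
Proof.
move=> kk v0 Kv; apply: contraNneq v0 => nh.
by apply/eqP/(pnocom p kk) => //; rewrite -Kv (pKD p) nh scale0r addr0.
Qed.

Lemma ev_qf (k : R) v : 0 < k -> v != 0 -> K v = k%:C *: v ->
  0 < qf (pform n K) v.
Proof.
move=> kp v0 Kv; rewrite /qf /pform Kv (hformZ nH) ReZ mulr_gt0//.
rewrite lt_neqAle hform_ge0// andbT eq_sym.
by apply: contraNneq v0 => /(pdef p) ->.
Qed.

(** Computing [(S2 f, e)] in two ways, with [k] on either side, leaves [c (f, h) (h, e) = 0]. *)
Lemma comm_eigen g S1 S2 (k : R) e f : hform g -> gsym g S1 ->
  (forall v, S2 v = S1 v + (c%:C * g v h) *: h) ->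
  S1 e = k%:C *: e -> S2 f = k%:C *: f ->
  c%:C * g e h = 0 \/ c%:C * g f h = 0.
Proof.
move=> gH gS1 S2E S1e S2f.
have : g (S2 f) e = g f (S1 e) by rewrite S1e S2f (hformZ gH) (hformZr gH) conjcR.
rewrite S2E (hformD gH) (hformZ gH) gS1 => /eqP.
rewrite -subr_eq0 addrAC subrr add0r mulf_eq0 => /orP[/eqP->|/eqP he]; [by right|left].
by rewrite (hformC gH h) he (conjcR (0 : R)) mulr0.
Qed.

(** [pnocom] excludes a common eigenvector only. If the eigenvectors differ, [comm_eigen] makes the
    rank one term vanish on one of them, which is then common after all. *)
Lemma ev_disj (k : R) : k0 < k -> ev K k -> ~ ev D k.
Proof.
move=> kk [f f0 Kf] [e e0 De].
have [eh|fh] := comm_eigen nH (psD p) (pKD p) De Kf.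
  by move/eqP: e0; apply; apply: (pnocom p kk); rewrite ?De// (pKD p) eh scale0r addr0.
by have := eigen_nh kk f0 Kf; rewrite fh eqxx.
Qed.

Lemma alt_KK (k : R) : k0 < k -> ~ ev K k ->
  binv (qf n) (shift (K \o K) (k ^+ 2)).
Proof.
move=> kk nev; rewrite (shift_sqr _ (plK p)); apply: binv_comp.
  exact: (paK p).
by apply: (pnK p); exact: le_lt_trans (pk0 p) kk.
Qed.

(** Otherwise [K (K v) = D (K v) = k^2 v], so [K v = k v] by [sqr_eigen], and the rank one term
    vanishes on an eigenvector of [K], against [eigen_nh]. *)
Lemma evs_sub_nh (k : R) v : k0 < k -> v != 0 -> D (K v) = (k ^+ 2)%:C *: v ->
  c%:C * pform n K v h != 0.
Proof.
move=> kk v0 DKv; apply/negP => /eqP nh.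
have kp := le_lt_trans (pk0 p) kk.
have : K (K v) = (k ^+ 2)%:C *: v by rewrite -DKv [LHS](pKD p) nh scale0r addr0.
move=> /(sqr_eigen kp) Kv; have := eigen_nh kk v0 Kv.
move: nh; rewrite /pform Kv (hformZ nH) mulrCA => /eqP; rewrite mulf_eq0.
by rewrite realc_eq0 gt_eqF//= => ->.
Qed.

(** If [(K v, v) = 0], Cauchy-Schwarz for the semidefinite form [(K ., .)] gives [K v = 0], and then
    [k^2 v = D (K v) = 0]. *)
Lemma evs_qf (k : R) v : k0 < k -> v != 0 -> D (K v) = (k ^+ 2)%:C *: v ->
  0 < qf (pform n K) v.
Proof.
move=> kk v0 DKv; have kp := le_lt_trans (pk0 p) kk.
have pH := pform_hform nH (plK p) (psK p) (pK0 p).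
rewrite lt_neqAle (hform_ge0 pH) andbT; apply: contraNneq v0 => /esym q0.
have Kv : K v = 0.
  by apply: (pdef p); have := qf_eq0 pH (K v) q0; rewrite /qf /pform => ->.
move: DKv; rewrite Kv (lin0 (plD p)) => /esym/eqP.
by rewrite scaler_eq0 realc_eq0 expf_eq0 gt_eqF.
Qed.

(** The argument of [ev_disj] for [D K] and [K K], whose difference is of rank one with respect to
    the form [(K ., .)]. *)
Lemma evs_disj (k : R) : k0 < k -> ev K k -> ~ evs K D k.
Proof.
move=> kk [f f0 Kf] /(evsC p kk)[e e0 /= DKe].
have pH := pform_hform nH (plK p) (psK p) (pK0 p).
have kp := le_lt_trans (pk0 p) kk.
have sDK : gsym (pform n K) (D \o K).
  by move=> u v; rewrite /pform /= (psK p) (psD p).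
have KK v : (K \o K) v = (D \o K) v + (c%:C * pform n K v h) *: h.
  by rewrite /= [LHS](pKD p).
have KKf : (K \o K) f = (k ^+ 2)%:C *: f.
  by rewrite /= Kf (linZ (plK p)) Kf scalerA -realcM.
have [eh|fh] := comm_eigen pH sDK KK DKe KKf.
  by have := evs_sub_nh kk e0 DKe; rewrite eh eqxx.
have := eigen_nh kk f0 Kf; move: fh; rewrite /pform Kf (hformZ nH) mulrCA => /eqP.
by rewrite mulf_eq0 realc_eq0 gt_eqF//= => ->.
Qed.

End Theory.

Section Interlace.
Variables (n : H -> H -> R[i]) (K D : H -> H) (h : H) (c k0 : R).
Hypothesis p : rank1_pair n K D h c k0.
Let nH := pn p.
Let q := rank1_pairC p.

Lemma sqr_itv (a b x : R) : 0 <= a -> 0 <= b -> a ^+ 2 <= x <= b ^+ 2 ->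
  exists2 y, a <= y <= b & x = y ^+ 2.
Proof.
move=> a0 b0 /andP[ax xb]; have x0 := le_trans (sqr_ge0 a) ax.
have sx := sqrtr_ge0 x.
exists (Num.sqrt x); last by rewrite sqr_sqrtr.
by rewrite -(ler_pXn2r (n:=2))// ?nnegrE// -[X in _ && X](ler_pXn2r (n:=2))//
  ?nnegrE// sqr_sqrtr// ax xb.
Qed.

Lemma evs_evD_disj (k : R) : k0 < k -> ev D k -> ~ evs K D k.
Proof.
by move=> kk Dk /(evsC p kk) zk; apply: (evs_disj q kk Dk zk).
Qed.

(** [K D] differs from [K K] as well as from [D D] by a rank one operator. Since [k] is not an
    eigenvalue of both [K] and [D], one of [K K - k^2] and [D D - k^2] is invertible, and
    [rank1_binv] passes from it to [K D - k^2]. *)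
Lemma alt_KD (k : R) : k0 < k -> ~ evs K D k ->
  binv (qf n) (shift (K \o D) (k ^+ 2)).
Proof.
move=> kk nev; have kp := le_lt_trans (pk0 p) kk.
have lS : linear (shift (K \o D) (k ^+ 2)).
  by apply: linear_shift; apply: linear_comp; [exact: plK p|exact: plD p].
have Sinj v : shift (K \o D) (k ^+ 2) v = 0 -> v = 0.
  move=> /eqP; rewrite subr_eq0 => /eqP KDv; apply: contrapT => /eqP v0.
  by apply: nev; exists v.
have [Dk|Dk] := pselect (ev D k).
  have nK : ~ ev K k by move=> Kk; exact: (ev_disj p kk Kk).
  apply: (@rank1_binv _ _ n (shift (K \o K) (k ^+ 2)) _
    (fun v => - (c%:C * n v h)) (K h) (c ^+ 2 * qf n h)) => //.
  - by apply: linear_shift; apply: linear_comp; exact: plK p.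
  - by move=> a u v; rewrite (hformD nH) (hformZ nH); ring.
  - by rewrite mulr_ge0 ?sqr_ge0//; exact: hform_ge0.
  - move=> v; rewrite nsqN nsqM nsqR -mulrA ler_wpM2l ?sqr_ge0// mulrC.
    exact: cauchy_schwarzC.
  - exact: (alt_KK p kk nK).
  - move=> v; rewrite /shift /= (pKD q) realcN mulNr (linD (plK p)) (linZ (plK p)).
    by rewrite addrAC.
apply: (@rank1_binv _ _ n (shift (D \o D) (k ^+ 2)) _
    (fun v => c%:C * n (D v) h) h (c ^+ 2 * (qf n (D h)))) => //.
- by apply: linear_shift; apply: linear_comp; exact: plD p.
- by move=> a u v; rewrite (plD p) (hformD nH) (hformZ nH); ring.
- by rewrite mulr_ge0 ?sqr_ge0//; exact: hform_ge0.
- move=> v; rewrite nsqM nsqR -mulrA ler_wpM2l ?sqr_ge0// mulrC (psD p).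
  exact: cauchy_schwarzC.
- exact: (alt_KK q kk Dk).
- by move=> v; rewrite /shift /= (pKD p) addrAC.
Qed.

Let DH := pform_hform nH (plD p) (psD p) (pD0 p).
Let KH := pform_hform nH (plK p) (psK p) (pK0 p).

Let altE S (x : R) : (~ ev S x -> binv (qf n) (shift S x)) -> alt n S x.
Proof.
move=> a nS; apply: a => -[v v0 /nS v00].
by rewrite v00 eqxx in v0.
Qed.

Let symKD : gsym (pform n D) (K \o D).
Proof. by move=> u v; rewrite /pform /= (psD p) (psK p). Qed.
Let symDD : gsym (pform n D) (D \o D).
Proof. by move=> u v; rewrite /pform /= (psD p) (psD p). Qed.
Let symDK : gsym (pform n K) (D \o K).
Proof. by move=> u v; rewrite /pform /= (psK p) (psD p). Qed.
Let symKK : gsym (pform n K) (K \o K).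
Proof. by move=> u v; rewrite /pform /= (psK p) (psK p). Qed.

Lemma sqr_eigenE T (x : R) v : linear T -> T v = x%:C *: v ->
  (T \o T) v = (x ^+ 2)%:C *: v.
Proof.
by move=> lT Tv; rewrite /= Tv (linZ lT) Tv scalerA -realcM.
Qed.

Lemma neq_itv (P : R -> Prop) (a b k : R) : a <= k <= b -> P k -> ~ P a -> ~ P b ->
  a < k < b.
Proof.
move=> /andP[ak kb] Pk Pa Pb; rewrite !lt_neqAle ak kb !andbT.
by apply/andP; split; apply/eqP => E; [apply: Pa; rewrite E|apply: Pb; rewrite -E].
Qed.

(** [eigen_between] for [D D] and [K D] in the form [(D ., .)], with respect to which the rank one
    term [c (D v, h) h] has the required shape. The end points drop out because [D] and [K D] share
    no eigenvalue. *)
Lemma evs_between (a b : R) : k0 < a -> a < b -> ev D a -> ev D b ->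
  exists2 k, a < k < b & evs K D k.
Proof.
move=> ka ab Da Db; have kb := lt_trans ka ab.
case: (Da) => e1 e10 De1; case: (Db) => e2 e20 De2.
have a0 := le_lt_trans (pk0 p) ka; have b0 := lt_trans a0 ab.
have [B DB] := pform_bound nH (pbD p).
have [|||x xab [v v0 KDv]] := eigen_between DH nH DB
  (linear_comp (plD p) (plD p)) (linear_comp (plK p) (plD p)) symDD symKD
  (bdd_comp (pbK p) (pbD p)) (fun v => pKD p (D v)) _
  (sqr_eigenE (plD p) De1) (sqr_eigenE (plD p) De2)
  (ev_qf q a0 e10 De1) (ev_qf q b0 e20 De2).
- by rewrite ltr_pXn2r ?nnegrE ?ltW.
- rewrite /pform De1 (hformZ nH) mulf_eq0 realc_eq0 (gt_eqF a0) /=.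
  by have := eigen_nh q ka e10 De1; rewrite mulf_eq0 negb_or => /andP[].
- move=> x /(sqr_itv (ltW a0) (ltW b0))[k /andP[ak kb'] ->].
  by apply: altE => nz; apply: alt_KD nz; exact: lt_le_trans ak.
have [k kab xk] := sqr_itv (ltW a0) (ltW b0) xab.
have zk : evs K D k by exists v => //; rewrite KDv xk.
by exists k => //; apply: (@neq_itv (evs K D) _ _ _ kab zk); exact: evs_evD_disj.
Qed.

(** The same for [D K] and [K K] in the form [(K ., .)]; [evsC] provides eigenvectors of [D K] in
    place of those of [K D]. *)
Lemma ev_between_evs (a b : R) : k0 < a -> a < b -> evs K D a -> evs K D b ->
  exists2 k, a < k < b & ev K k.
Proof.
move=> ka ab Za Zb; have kb := lt_trans ka ab.
have [e1 e10 De1] := evsC p ka Za; have [e2 e20 De2] := evsC p kb Zb.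
have a0 := le_lt_trans (pk0 p) ka; have b0 := lt_trans a0 ab.
have [B KB] := pform_bound nH (pbK p).
have [|||x xab [v v0 KKv]] := eigen_between KH nH KB
  (linear_comp (plD p) (plK p)) (linear_comp (plK p) (plK p)) symDK symKK
  (bdd_comp (pbK p) (pbK p)) (fun v => pKD p (K v)) _ De1 De2
  (evs_qf p ka e10 De1) (evs_qf p kb e20 De2).
- by rewrite ltr_pXn2r ?nnegrE ?ltW.
- have := evs_sub_nh p ka e10 De1; by rewrite mulf_eq0 negb_or => /andP[].
- move=> x /(sqr_itv (ltW a0) (ltW b0))[k /andP[ak kb'] ->].
  have kk := lt_le_trans ka ak.
  apply: altE => nz; apply: (alt_KK p) => // -[u u0 Ku]; apply: nz.
  by exists u => //; exact: sqr_eigenE (plK p) Ku.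
have [k kab xk] := sqr_itv (ltW a0) (ltW b0) xab.
have yk : ev K k.
  exists v => //; apply: (sqr_eigen p); last by rewrite -xk.
  by rewrite (lt_le_trans a0)//; case/andP: kab.
by exists k => //; apply: (@neq_itv (ev K) _ _ _ kab yk) => E; [exact: (evs_disj p ka E Za)|exact: (evs_disj p kb E Zb)].
Qed.

(** Here [K] and [D] themselves are compared, in the original scalar product. *)
Lemma ev_between (a b : R) : k0 < a -> a < b -> ev K a -> ev K b ->
  exists2 k, a < k < b & ev D k.
Proof.
move=> ka ab Ka Kb; have kb := lt_trans ka ab.
case: (Ka) => e1 e10 Ke1; case: (Kb) => e2 e20 Ke2.
have nq v : v != 0 -> 0 < qf n v.
  move=> v0; rewrite lt_neqAle (hform_ge0 nH) andbT eq_sym.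
  by apply: contraNneq v0 => /(pdef p) ->.
have nB v : qf n v <= 1 * qf n v by rewrite mul1r.
have [||k kab Dk] := eigen_between nH nH nB (plK p) (plD p)
  (psK p) (psD p) (pbD p) (pKD q) ab Ke1 Ke2 (nq _ e10) (nq _ e20).
- have := eigen_nh p ka e10 Ke1; by rewrite mulf_eq0 negb_or => /andP[].
- move=> k /andP[ak _]; apply: altE; apply: (paD p); exact: lt_le_trans ak.
exists k => //; apply: (@neq_itv (ev D) _ _ _ kab Dk) => Da;
  [exact: (ev_disj p ka Ka Da)|exact: (ev_disj p kb Kb Da)].
Qed.

Lemma sqr_ge (a x : R) : 0 <= a -> a ^+ 2 <= x ->
  exists2 y, a <= y & x = y ^+ 2.
Proof.
move=> a0 ax; have x0 := le_trans (sqr_ge0 a) ax.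
exists (Num.sqrt x); last by rewrite sqr_sqrtr.
by rewrite -(ler_pXn2r (n:=2))// ?nnegrE ?sqrtr_ge0// sqr_sqrtr.
Qed.

(** [c = 0] is impossible here, since [K = D] would make an eigenvector of [D] a common one. So
    [c > 0], and [eigen_above] applies to [D D] and [K D]. *)
Lemma evs_above (a : R) : 0 <= c -> k0 < a -> ev D a ->
  exists2 k, a < k & evs K D k.
Proof.
move=> c_ge0 ka Da; case: (Da) => e e0 De.
have c0 : 0 < c.
  rewrite lt_neqAle c_ge0 andbT eq_sym; have := eigen_nh q ka e0 De.
  by rewrite mulf_eq0 negb_or realc_eq0 oppr_eq0 => /andP[].
have a0 := le_lt_trans (pk0 p) ka.
have [B DB] := pform_bound nH (pbD p).
have [||x xa [v v0 KDv]] := eigen_above DH nH DB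
  (linear_comp (plK p) (plD p)) symKD
  (bdd_comp (pbK p) (pbD p)) (fun v => pKD p (D v)) c0
  (sqr_eigenE (plD p) De) (ev_qf q a0 e0 De).
- rewrite /pform De (hformZ nH) mulf_eq0 realc_eq0 (gt_eqF a0) /=.
  have := eigen_nh q ka e0 De; by rewrite mulf_eq0 negb_or => /andP[].
- move=> x /(sqr_ge (ltW a0))[k ak ->].
  by apply: altE => nz; apply: alt_KD nz; exact: lt_le_trans ak.
have [k ak xk] := sqr_ge (ltW a0) xa.
have zk : evs K D k by exists v => //; rewrite KDv xk.
exists k => //; rewrite lt_neqAle ak andbT; apply/eqP => E.
by move: zk; rewrite -E; exact: evs_evD_disj.
Qed.

Lemma ev_above_evs (a : R) : 0 <= c -> k0 < a -> evs K D a ->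
  exists2 k, a < k & ev K k.
Proof.
move=> c_ge0 ka Za; have [e e0 De] := evsC p ka Za.
have c0 : 0 < c.
  rewrite lt_neqAle c_ge0 andbT eq_sym; have := evs_sub_nh p ka e0 De.
  by rewrite mulf_eq0 negb_or realc_eq0 => /andP[].
have a0 := le_lt_trans (pk0 p) ka.
have [B KB] := pform_bound nH (pbK p).
have [||x xa [v v0 KKv]] := eigen_above KH nH KB
  (linear_comp (plK p) (plK p)) symKK
  (bdd_comp (pbK p) (pbK p)) (fun v => pKD p (K v)) c0 De (evs_qf p ka e0 De).
- have := evs_sub_nh p ka e0 De; by rewrite mulf_eq0 negb_or => /andP[].
- move=> x /(sqr_ge (ltW a0))[k ak ->].
  have kk := lt_le_trans ka ak.
  apply: altE => nz; apply: (alt_KK p) => // -[u u0 Ku]; apply: nz.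
  by exists u => //; exact: sqr_eigenE (plK p) Ku.
have [k ak xk] := sqr_ge (ltW a0) xa.
have yk : ev K k.
  exists v => //; apply: (sqr_eigen p); last by rewrite -xk.
  exact: lt_le_trans ak.
exists k => //; rewrite lt_neqAle ak andbT; apply/eqP => E.
by move: yk; rewrite -E => /(evs_disj p ka); apply.
Qed.

End Interlace.
End Pair.

(** * Complete spaces: the Hellinger-Toeplitz theorem and orthogonal complements *)

Section Hilbert.
Variables (R : realType) (H : lmodType R[i]) (n : H -> H -> R[i]).
Hypotheses (nH : hform n) (ndef : forall v, qf n v = 0 -> v = 0).
Implicit Types (S W : H -> H) (u v w : H) (V : set H).
Local Notation nm := (hnorm n).

(** Completeness, tested on sequences with geometrically decreasing steps; every Cauchy sequence has
    such a subsequence. *)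
Definition fast_complete := forall v : nat -> H,
  (forall k, nm (v k.+1 - v k) <= 2^-1 ^+ k) ->
  exists f, nm (v k - f) @[k --> \oo] --> 0.

Lemma hnorm_ge0 v : 0 <= nm v. Proof. exact: sqrtr_ge0. Qed.
Lemma sqr_hnorm v : nm v ^+ 2 = qf n v.
Proof. by rewrite sqr_sqrtr//; exact: hform_ge0. Qed.
Lemma hnormZr (t : R) v : nm (t%:C *: v) = `|t| * nm v.
Proof.
by rewrite /hnorm -/(qf n _) -/(qf n v) qfZr// sqrtrM ?sqr_ge0// sqrtr_sqr.
Qed.
Lemma hnormN v : nm (- v) = nm v.
Proof. by rewrite /hnorm -/(qf n _) -/(qf n v) qfN. Qed.
Lemma hnormB v w : nm (v - w) = nm (w - v).
Proof. by rewrite -hnormN opprB. Qed.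
Lemma hnorm_cs u v : `|complex.Re (n u v)| <= nm u * nm v.
Proof.
rewrite -(ler_pXn2r (n := 2))// ?nnegrE ?mulr_ge0 ?hnorm_ge0//.
by rewrite exprMn !sqr_hnorm -normrX ger0_norm ?sqr_ge0// cauchy_schwarz.
Qed.
Lemma hnormD u v : nm (u + v) <= nm u + nm v.
Proof.
rewrite -(ler_pXn2r (n := 2))// ?nnegrE ?addr_ge0 ?hnorm_ge0//.
rewrite sqr_hnorm qfD// sqrrD !sqr_hnorm lerD2r lerD2l -mulr_natr.
have := hnorm_cs u v; have := ler_norm (complex.Re (n u v)); lra.
Qed.
Lemma hnormD3 u v w : nm (u - w) <= nm (u - v) + nm (v - w).
Proof. by apply: le_trans (hnormD _ _); rewrite addrA subrK. Qed.
Lemma hnorm0_eq0 v : nm v = 0 -> v = 0.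
Proof. by move=> v0; apply: ndef; rewrite -sqr_hnorm v0 expr0n. Qed.

Lemma cvg0P (a : nat -> R) : (forall k, 0 <= a k) -> a k @[k --> \oo] --> 0 ->
  forall e, 0 < e -> exists m, forall k, (m <= k)%N -> a k < e.
Proof.
move=> a0 /cvgrPdist_lt ac e e0; have [m _ mP] := ac e e0.
by exists m => k mk; have := mP k mk; rewrite /= sub0r normrN ger0_norm.
Qed.

(** A gliding hump. For an unbounded [W] there are [u k] in the unit ball with [|W (u k)| >= 4^k]. A
    sum of moves of length [3^-k] along [a k = W (u k)] converges to some [f] on which
    [F k = Re (., a k)] is at least [(4/3)^k / 2] in modulus; but by symmetry
    [F k f = Re (W f, u k)] is bounded by [|W f|]. *)
Lemma hellinger_toeplitz W : fast_complete -> linear W -> gsym n W -> bdd (qf n) W.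
Proof.
move=> cmpl lW nW; apply: contrapT => nb.
have ex k : exists u, nm u <= 1 /\ 4 ^+ k <= nm (W u).
  apply: contrapT => nex; apply: nb; exists ((4 ^+ k) ^+ 2).
    by rewrite !exprn_gt0.
  move=> v; have [v0|v0] := eqVneq (nm v) 0.
    by rewrite (hnorm0_eq0 v0) (lin0 lW) qf0// mulr0.
  have vp : 0 < nm v by rewrite lt_neqAle eq_sym v0 hnorm_ge0.
  rewrite -!sqr_hnorm -exprMn ler_pXn2r ?nnegrE ?mulr_ge0 ?hnorm_ge0 ?exprn_ge0//.
  rewrite leNgt; apply/negP => lt; apply: nex; exists ((nm v)^-1%:C *: v).
  rewrite (linZ lW) !hnormZr ger0_norm ?invr_ge0 ?hnorm_ge0// mulVf//; split=> //.
  by rewrite mulrC ler_pdivlMr// ltW.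
pose u k := sval (cid (ex k)).
have u1 k : nm (u k) <= 1 by case: (svalP (cid (ex k))).
have u4 k : 4 ^+ k <= nm (W (u k)) by case: (svalP (cid (ex k))).
pose a k := W (u k); pose F k x := complex.Re (n x (a k)).
have na k : 0 < nm (a k) by rewrite (lt_le_trans _ (u4 k))// exprn_gt0.
pose t k : R := 3^-1 ^+ k / nm (a k).
have tp k : 0 < t k by rewrite divr_gt0// exprn_gt0// invr_gt0.
(* The sign with which the move along [a k] does not cancel against the value of [F k] already
   reached. *)
pose s k x : R := if 0 <= F k x then t k else - t k.
have sE k x : `|s k x| = t k.
  by rewrite /s; case: ifP => _; rewrite ?normrN gtr0_norm.
pose x := fix x k := if k is k'.+1 then x k' + (s k' (x k'))%:C *: a k' else 0.
have step k : nm (x k.+1 - x k) = 3^-1 ^+ k.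
  rewrite /= addrAC subrr add0r hnormZr sE /t mulfVK//.
  by rewrite gt_eqF.
have [f xf] : exists f, nm (x k - f) @[k --> \oo] --> 0.
  apply: cmpl => k; rewrite step; apply: lerXn2r; rewrite ?nnegrE ?invr_ge0//.
  by rewrite lef_pV2 ?posrE// ler_nat.
have tail k m : nm (x (k + m)%N - x k) <= 2^-1 * 3 * (3^-1 ^+ k - 3^-1 ^+ (k + m)).
  elim: m => [|m IH]; first by rewrite addn0 !subrr mulr0 /hnorm -/(qf n _) qf0// sqrtr0.
  rewrite addnS (le_trans (hnormD3 _ (x (k + m)%N) _))// step.
  apply: le_trans (lerD (lexx _) IH) _; rewrite exprS; lra.
have lim k : nm (f - x k) <= 2^-1 * 3 * 3^-1 ^+ k.
  apply/ler_addgt0Pr => e e0.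
  have [m mP] := cvg0P (fun k => hnorm_ge0 _) xf e0.
  have := mP (k + m)%N (leq_addl _ _); have := tail k m.
  have := hnormD3 f (x (k + m)%N) (x k); rewrite (hnormB f (x (k + m)%N)).
  have : 0 < 3^-1 ^+ (k + m) :> R by rewrite exprn_gt0// invr_gt0.
  lra.
have Fx k : 3^-1 ^+ k * nm (a k) <= `|F k (x k.+1)|.
  rewrite /F /= (hformD nH) (hformZ nH) ReD ReZ -/(F k (x k)) -/(qf n (a k)).
  rewrite -sqr_hnorm (_ : _ * nm (a k) = t k * nm (a k) ^+ 2); last first.
    by rewrite /t; field; rewrite gt_eqF.
  have q0 : 0 <= t k * nm (a k) ^+ 2 by rewrite mulr_ge0 ?sqr_ge0// ltW.
  rewrite /s; case: ifPn => [F0|]; first by rewrite ger0_norm ?addr_ge0 ?lerDr.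
  rewrite -ltNge => F0; rewrite mulNr ltr0_norm; lra.
(* After move [k] the modulus of [F k] is at least [3^-k |a k|], and all later moves together take
   away at most half of this. *)
have low k : 2^-1 * (4 / 3) ^+ k <= nm (W f).
  have FW : `|F k f| <= nm (W f).
    rewrite /F /a -(nW f) (le_trans (hnorm_cs _ _))//.
    by rewrite ler_piMr ?hnorm_ge0.
  have d : `|F k (x k.+1) - F k f| <= nm (f - x k.+1) * nm (a k).
    by rewrite hnormB /F -ReB -(hformN nH) -(hformD nH) hnorm_cs.
  have d2 : nm (f - x k.+1) * nm (a k) <= 2^-1 * (3^-1 ^+ k * nm (a k)).
    rewrite mulrA ler_pM2r// (le_trans (lim _))// exprS; lra.
  have := ler_normB (F k (x k.+1)) (F k f); have := ler_norm (F k f).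
  have := Fx k; have : 3^-1 ^+ k * 4 ^+ k <= 3^-1 ^+ k * nm (a k).
    by rewrite ler_pM2l// exprn_gt0// invr_gt0.
  rewrite -exprMn (mulrC 3^-1).
  have := lerB_dist (F k (x k.+1)) (F k f).
  lra.
have bern k : 1 + k%:R / 3 <= (4 / 3) ^+ k :> R.
  elim: k => [|k IH]; first by rewrite mul0r addr0 expr0.
  rewrite exprS; have : 0 <= k%:R :> R by []. rewrite -natr1; lra.
have := low (Num.truncn (6 * nm (W f))).+1.
have := bern (Num.truncn (6 * nm (W f))).+1.
have := truncnS_gt (6 * nm (W f)).
lra.
Qed.

(** The inverse of a symmetric bijection is symmetric and defined everywhere, hence bounded by
    [hellinger_toeplitz]. *)
Lemma sym_bij_binv S : fast_complete -> linear S -> gsym n S ->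
  (forall v, S v = 0 -> v = 0) -> (forall w, exists v, S v = w) ->
  binv (qf n) S.
Proof.
move=> cmpl lS nS inj surj.
pose W w := sval (cid (surj w)).
have SW w : S (W w) = w by exact: (svalP (cid (surj w))).
have WS v : W (S v) = v.
  by apply/eqP; rewrite -subr_eq0; apply/eqP/inj; rewrite (linB lS) SW subrr.
exists W; split=> //; apply: hellinger_toeplitz => //.
  exact: linear_binv lS WS SW.
exact: gsym_binv nH nS SW.
Qed.

(** Let [f] be the point of [V] nearest to [w]. Then [w - f] is orthogonal to [V], so by hypothesis
    to [w], and therefore to itself. *)
Lemma closed_perp V w : fast_complete -> hclosed n V -> V 0 ->
  (forall a u v, V u -> V v -> V (a *: u + v)) ->
  (forall u, (forall v, V v -> n u v = 0) -> n u w = 0) -> V w.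
Proof.
move=> cmpl clV V0 linV perp.
pose E := [set x | exists2 v, V v & x = qf n (w - v)].
have infE : has_inf E.
  split; first by exists (qf n (w - 0)), 0.
  by exists 0 => _ [v _ ->]; exact: hform_ge0.
pose d := inf E.
have dle v : V v -> d <= qf n (w - v).
  by move=> Vv; apply: (inf_lbound infE.2); exists v.
(* With this accuracy the parallelogram law bounds the squared steps by
   [2 * 4^-(k+1) + 2 * 4^-(k+2) <= 4^-k], as [fast_complete] demands. *)
have ex k : exists v, V v /\ qf n (w - v) < d + 4^-1 ^+ k.+1.
  have e0 : 0 < 4^-1 ^+ k.+1 :> R by rewrite exprn_gt0// invr_gt0.
  by have [_ [v Vv ->] lt] := inf_adherent e0 infE; exists v.
pose v k := sval (cid (ex k)).
have Vv k : V (v k) by case: (svalP (cid (ex k))).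
have vd k : qf n (w - v k) < d + 4^-1 ^+ k.+1 by case: (svalP (cid (ex k))).
have VZ a u : V u -> V (a *: u) by move=> Vu; rewrite -[_ *: _]addr0; exact: linV.
have VD a b : V a -> V b -> V (a + b).
  by move=> Va Vb; rewrite -[a]scale1r; exact: linV.
have par a b : V a -> V b ->
    qf n (a - b) <= 2 * (qf n (w - a) - d) + 2 * (qf n (w - b) - d).
  move=> Va Vb; have /dle := VZ (2^-1)%:C _ (VD _ _ Va Vb).
  have -> : w - (2^-1)%:C *: (a + b) = (2^-1)%:C *: ((w - a) + (w - b)).
    rewrite addrACA -opprD scalerBr; congr (_ - _).
    rewrite scalerDr -scalerDl -realcD (_ : 2^-1 + 2^-1 = 1) ?scale1r//.
    by lra.
  have -> : a - b = (w - b) - (w - a) by rewrite opprB [RHS]addrC addrA subrK.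
  rewrite qfZr// (qfD nH (w - a) (w - b)) (qfB nH (w - b) (w - a)) (qf_real nH (w - a)) expr2; lra.
have [f vf] : exists f, nm (v k - f) @[k --> \oo] --> 0.
  apply: cmpl => k; rewrite -(ler_pXn2r (n := 2))// ?nnegrE ?hnorm_ge0 ?exprn_ge0//.
  rewrite sqr_hnorm (le_trans (par _ _ (Vv _) (Vv _)))//.
  rewrite -exprM mulnC exprM (_ : 2^-1 ^+ 2 = 4^-1); last by field.
  have := vd k; have := vd k.+1; rewrite (exprS _ k.+1) !exprS;
  have : 0 < 4^-1 ^+ k :> R by rewrite exprn_gt0// invr_gt0.
  lra.
have Vf : V f by exact: clV Vv vf.
have orth x : V x -> n (w - f) x = 0.
  move=> Vx; have bound e : 0 < e -> nsq (n (w - f) x) <= (2 * e + 2 * e ^+ 2) * qf n x.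
    move=> e0.
    have [m1 m1P] := cvg0P (fun k => hnorm_ge0 _) vf e0.
    have [m2 m2P] : exists m, forall k, (m <= k)%N -> 4^-1 ^+ k.+1 < e.
      have c4 : (4^-1 : R) ^+ k.+1 @[k --> \oo] --> 0.
        rewrite (_ : (fun k => _) = (fun k => (geometric 4^-1 4^-1) k)); last first.
          by apply/funext => k; rewrite /geometric /= exprS.
        apply: cvg_geometric; rewrite ger0_norm ?invr_ge0//; lra.
      by apply: cvg0P c4 _ e0 => k; rewrite exprn_ge0// invr_ge0.
    pose k := maxn m1 m2.
    have h1 := m1P k (leq_maxl _ _); have h2 := m2P k (leq_maxr _ _).
    have near : nsq (n (w - v k) x) <= e * qf n x.
      set z := n _ x; have [qx|qx] := eqVneq (qf n x) 0.
        rewrite qx mulr0 (le_trans (cauchy_schwarzC _ _ nH))// qx mulr0//.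
      have qp : 0 < qf n x by rewrite lt_neqAle eq_sym qx (hform_ge0 nH).
      (* Correcting [v k] by [(z / qf n x) x] lowers the squared distance to [w] by
         [nsq z / qf n x]; as [v k] is nearly optimal, this is at most [4^-(k+1)]. *)
      have /dle := VD _ _ (Vv k) (VZ ((qf n x)^-1%:C * z) _ Vx).
      rewrite opprD addrA qfB// qfZn// nsqM nsqR (hformZr nH) -/z.
      rewrite conjM conjcR -mulrA (mulrC (conjc z)) nsqJ ReZ /=.
      have := vd k; set N := nsq z => vk le.
      have : N / qf n x <= e.
        have -> : N / qf n x = 2 * ((qf n x)^-1 * N) - (qf n x)^-1 ^+ 2 * N * qf n x.
          by field.
        lra.
      by rewrite ler_pdivrMr.
    have far : nsq (n (v k - f) x) <= e ^+ 2 * qf n x.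
      rewrite (le_trans (cauchy_schwarzC _ _ nH))// -sqr_hnorm ler_wpM2r ?(hform_ge0 nH)//.
      by rewrite ler_pXn2r ?nnegrE ?hnorm_ge0 ?ltW.
    have -> : w - f = (w - v k) + (v k - f) by rewrite addrA subrK.
    rewrite (hformD nH); move: near far.
    case: (n _ x) => a b; case: (n _ x) => a' b'; rewrite /nsq /=.
    have := sqr_ge0 (a - a'); have := sqr_ge0 (b - b'); rewrite !sqrrD !sqrrN; lra.
  apply/eqP; rewrite -nsq_eq0 eq_le nsq_ge0 andbT; apply/ler_addgt0Pr => e e0.
  rewrite add0r; have qx : 0 <= qf n x by exact: (hform_ge0 nH).
  (* The bound 1 ensures [t^2 <= t], so that [(2 t + 2 t^2) qf n x <= 4 t qf n x <= e]. *)
  pose t := Num.min 1 (e / (4 * (qf n x + 1))).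
  have t0 : 0 < t by rewrite lt_min ltr01 divr_gt0// mulr_gt0//; lra.
  have t1 : t <= 1 by rewrite ge_min lexx.
  have t2 : t * (4 * (qf n x + 1)) <= e.
    by rewrite -ler_pdivlMr ?mulr_gt0 ?ltr_wpDl// ge_min lexx orbT.
  apply: le_trans (bound t t0) _; apply: le_trans t2.
  have tt : 0 <= (t - t ^+ 2) * qf n x.
    by rewrite mulr_ge0// subr_ge0 expr2 ler_piMl// ltW.
  move: tt; rewrite !mulrDl !mulNr; lra.
have := perp (w - f) orth.
have nf := orth f Vf; move=> nw.
have : n (w - f) (w - f) = 0 by rewrite hformDr// hformNr// nw nf subrr.
move=> q0; have /eqP : w - f = 0 by apply: ndef; rewrite /qf q0.
by rewrite subr_eq0 => /eqP ->.
Qed.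

End Hilbert.

(** * Absolutely continuous functions *)

Section RealAC.
Variable R : realType.
Local Notation mu := (@lebesgue_measure R).
Implicit Types (F f g : R -> R) (a b x y : R) (s : seq (R * R)).

Definition nonoverlap (I J : R * R) := (I.2 <= J.1) || (J.2 <= I.1).
Definition subitv a b (I : R * R) := (a <= I.1) && (I.1 < I.2) && (I.2 <= b).

(** The real-valued counterpart of [abs_continuous_on], meant for real and imaginary parts. *)
Definition rac a b F := forall e : R, 0 < e -> exists2 d : R, 0 < d &
  forall s, all (subitv a b) s -> pairwise nonoverlap s ->
    \sum_(I <- s) (I.2 - I.1) < d -> \sum_(I <- s) `|F I.2 - F I.1| < e.

(** * Monotone absolutely continuous functions and their Stieltjes measures *)

Section Monotone.
Variables (a b : R) (F : R -> R).
Hypotheses (ab : a < b) (Fac : rac a b F) (Fnd : {homo F : x y / x <= y}).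
Hypotheses (Fa : forall x, x <= a -> F x = F a).
Hypotheses (Fb : forall x, b <= x -> F x = F b).

Lemma rac_mono_small e : 0 < e -> exists2 d, 0 < d &
  forall x y, x <= y -> y - x < d -> F y - F x < e.
Proof.
move=> e0; have [d d0 dP] := Fac e0; exists d => // x y xy yxd.
pose x' := Num.max a x; pose y' := Num.min b y.
have [xy'|yx'] := ltP x' y'.
  have := dP [:: (x', y')]; rewrite !big_seq1 /= /subitv /= !andbT.
  rewrite le_max lexx xy' ge_min lexx /= => /(_ isT isT).
  have Ey : F y' = F y by rewrite /y'; case: leP => // /Fb ->.
  have Ex : F x' = F x by rewrite /x'; case: leP => // /ltW/Fa ->.
  rewrite Ex Ey ger0_norm ?subr_ge0 ?Fnd//; apply.
  apply: le_lt_trans yxd; apply: lerB; first by rewrite ge_min lexx orbT.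
  by rewrite le_max lexx orbT.
suff -> : F y = F x by rewrite subrr.
move: yx'; rewrite /x' /y'.
case: (leP b y) => [hby|hyb]; case: (leP a x) => [hax|hxa].
- by move=> bx; rewrite (Fb hby) (Fb bx).
- by move=> ba; move: ab; rewrite ltNge ba.
- by move=> yx; congr F; apply/eqP; rewrite eq_le yx.
- by move=> ya; rewrite (Fa ya) (Fa (ltW hxa)).
Qed.

Lemma rac_mono_rc : right_continuous F.
Proof.
move=> x; apply/cvgrPdist_lt => e e0; have [d d0 dP] := rac_mono_small e0.
near=> y; have xy : x <= y by near: y; exact: nbhs_right_ge.
rewrite distrC ger0_norm ?subr_ge0 ?Fnd//; apply: dP => //.
rewrite ltrBlDl; near: y; apply: nbhs_right_lt; by rewrite ltrDl.
Unshelve. all: by end_near. Qed.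

Let G : cumulative R R :=
  HB.pack_for (cumulative R R) F (isCumulative.Build R _ R F Fnd rac_mono_rc).
Let nu : {measure set (measurableTypeR R) -> \bar R} :=
  lebesgue_stieltjes_measure G.

Let nu_itv x y : x <= y -> nu `]x, y]%classic = (F y - F x)%:E.
Proof.
move=> xy; rewrite -[LHS]/(lebesgue_stieltjes_measure G _) /lebesgue_stieltjes_measure /measure_extension measurable_mu_extE/=; last first.
  exact: is_ocitv.
by rewrite wlength_itv_bnd.
Qed.

Let le_mu (m : {measure set (measurableTypeR R) -> \bar R}) (A B : set R) :
  measurable A -> measurable B -> A `<=` B -> (m A <= m B)%E.
Proof. by move=> mA mB AB; apply: le_measure; rewrite ?inE. Qed.

Let open_itvP (I : set R) : open I -> is_interval I -> I `<=` `]a, b[ ->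
  I !=set0 -> [/\ a <= inf I, inf I < sup I, sup I <= b,
    I `<=` `]inf I, sup I[ & `]inf I, sup I[ `<=` I].
Proof.
move=> oI iI Iab [z Iz].
have lbI : has_lbound I by exists a => t /Iab; rewrite /= in_itv /= => /andP[/ltW].
have ubI : has_ubound I by exists b => t /Iab; rewrite /= in_itv /= => /andP[_ /ltW].
have sI t : I t -> inf I < t < sup I.
  move=> It; have : nbhs t I by exact: open_nbhs_nbhs.
  rewrite -nbhs_ballE => -[e /= e0 eI].
  have I1 : I (t - e / 2).
    by apply: eI; rewrite /ball /= opprB addrCA subrr addr0 ger0_norm; lra.
  have I2 : I (t + e / 2).
    by apply: eI; rewrite /ball /= opprD addrA subrr add0r normrN ger0_norm; lra.
  have := inf_lbound lbI I1; have := sup_ubound ubI I2; lra.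
split.
- by apply: lb_le_inf; [by exists z|move=> t /Iab; rewrite /= in_itv /= => /andP[/ltW]].
- by have /andP[] := sI z Iz; exact: lt_trans.
- by apply: sup_le_ub; [by exists z|move=> t /Iab; rewrite /= in_itv /= => /andP[_ /ltW]].
- by move=> t /sI; rewrite /= in_itv.
- move=> t; rewrite /= in_itv /= => /andP[it ts].
  have [u Iu ut] : exists2 u, I u & u < t.
    have := inf_adherent (eps := t - inf I); rewrite subr_gt0 => /(_ I it) [].
      by split=> //; exists z.
    by move=> u Iu; rewrite addrC subrK => ut; exists u.
  have [v Iv tv] : exists2 v, I v & t < v.
    have := sup_adherent (eps := sup I - t); rewrite subr_gt0 => /(_ I ts) [].
      by split=> //; exists z.
    by move=> v Iv; rewrite opprB addrC subrK => tv; exists v.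
  by apply: (iI u v) => //; rewrite (ltW ut) (ltW tv).
Qed.

(** Cover the null set by an open set of Lebesgue measure below [d] and split that set, within []a,
    b[], into its components. Finitely many components form a family as in [rac], so their
    [nu]-measures add up to at most [e]. *)
Lemma rac_mono_null (N : set R) : measurable N -> mu N = 0%E ->
  nu (N `&` `]a, b[) = 0%E.
Proof.
move=> mN N0; apply/eqP; rewrite eq_le measure_ge0 andbT.
apply/lee_addgt0Pr => e e0; rewrite add0e.
have [d d0 dP] := Fac e0.
pose N' := N `&` `]a, b[.
have mN' : measurable N' by exact: measurableI.
have N'0 : mu N' = 0%E.
  by apply/eqP; rewrite eq_le measure_ge0 andbT -N0 le_measure ?inE//; exact: subIsetl.
have [U [oU NU Ud]] : exists U : set R, [/\ open U, N' `<=` U & (mu (U `\` N') < d%:E)%E].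
  have N'oo : (mu N' < +oo)%E by rewrite N'0 ltry.
  exact: lebesgue_regularity_outer.
have mU : measurable U by exact: open_measurable.
have mUd : (mu U < d%:E)%E.
  have : (mu (N' `|` (U `\` N')) <= mu N' + mu (U `\` N'))%E.
    by apply: measureU2 => //; exact: measurableD.
  by rewrite setDUK// N'0 add0e => /le_lt_trans; apply.
pose W := U `&` `]a, b[.
have oW : open W by apply: openI => //; exact: itv_open.
pose I := open_disjoint_itv oW.
have WI : W = \bigcup_k I k by exact: open_disjoint_itv_bigcup.
have mI k : measurable (I k) by apply: open_measurable; exact: open_disjoint_itv_open.
have tI : trivIset setT I by exact: open_disjoint_itv_trivIset.
have IW k : I k `<=` W by rewrite WI; exact: bigcup_sup.
have Iab k : I k `<=` `]a, b[ by move=> t /IW[].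
have oI k : open (I k) by exact: open_disjoint_itv_open.
have iI k : is_interval (I k) by exact: open_disjoint_itv_is_interval.
have IP k := open_itvP (oI k) (iI k) (@Iab k).
have NW : N' `<=` W by move=> t Nt; split; [exact: NU|case: Nt].
apply: (@le_trans _ _ (nu W)).
  by apply: le_measure => //; rewrite inE//; exact: open_measurable.
have nuW : nu W = (\sum_(0 <= k <oo) nu (I k))%E.
  rewrite WI; apply: measure_semi_bigcup => //.
  by rewrite -WI; exact: open_measurable.
rewrite nuW.
apply: lime_le; first by apply: is_cvg_nneseries => k _ _; exact: measure_ge0.
near=> n.
(* Empty components are dropped: for them [inf] and [sup] are default values, which bound no proper
   interval. *)
pose r := [seq k <- iota 0 n | `[< I k !=set0 >]].
pose s := [seq (inf (I k), sup (I k)) | k <- r].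
have s1 : all (subitv a b) s.
  rewrite /s all_map; apply/allP => k; rewrite mem_filter => /andP[/asboolP Ik0 _] /=.
  by have [h1 h2 h3 _ _] := IP k Ik0; rewrite /subitv /= h1 h2 h3.
have s2 : pairwise nonoverlap s.
  rewrite /s pairwise_map.
  have : pairwise [rel x y | x != y] r by rewrite -uniq_pairwise filter_uniq ?iota_uniq.
  apply: (@sub_in_pairwise _ [in r]); last by apply/allP.
  move=> j k; rewrite !mem_filter => /andP[/asboolP Ij0 _] /andP[/asboolP Ik0 _] /= jk.
  rewrite /nonoverlap /=; apply/negPn; rewrite negb_or -!ltNge; apply/negP => /andP[h1 h2].
  have [_ j2 _ _ j5] := IP j Ij0; have [_ k2 _ _ k5] := IP k Ik0.
  have [t [jt kt]] : exists t, (inf (I j) < t < sup (I j)) /\ (inf (I k) < t < sup (I k)).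
    exists ((Num.max (inf (I j)) (inf (I k)) + Num.min (sup (I j)) (sup (I k))) / 2).
    case: (leP (inf (I j)) (inf (I k))) => ?; case: (leP (sup (I j)) (sup (I k))) => ?;
      split; apply/andP; split; lra.
  have E : j = k.
    apply: (tI j k) => //.
    by exists t; split; [apply: j5|apply: k5]; rewrite /= in_itv.
  by move: jk; rewrite E eqxx.
have big_filter_I (h : nat -> \bar R) : (forall k, I k = set0 -> h k = 0%E) ->
    (\sum_(0 <= k < n) h k = \sum_(k <- r) h k)%E.
  move=> h0; rewrite /r big_filter [LHS]big_mkcond/= [RHS]big_mkcond/=.
  rewrite /index_iota subn0; apply: eq_bigr => k _.
  have [Ik|Ik] := pselect (I k !=set0); first by rewrite asboolT.
  by rewrite asboolF// h0//; apply: contrapT => /eqP/set0P.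
have s3 : \sum_(J <- s) (J.2 - J.1) < d.
  rewrite -lte_fin; apply: le_lt_trans mUd.
  apply: (@le_trans _ _ (\sum_(0 <= k < n) mu (I k)))%E.
    rewrite big_filter_I; last by move=> k ->; rewrite measure0.
    rewrite /s big_map -sumEFin big_seq [leRHS]big_seq; apply: lee_sum => k.
    rewrite mem_filter => /andP[/asboolP Ik0 _].
    have [_ h2 _ _ h5] := IP k Ik0.
    have -> : (sup (I k) - inf (I k))%:E = mu `]inf (I k), sup (I k)[.
      by rewrite lebesgue_measure_itv /= lte_fin h2.
    by apply: le_mu => //; exact: measurable_itv.
  rewrite big_mkord -(@measure_bigsetU _ _ _ mu I)//.
  apply: le_mu => //; first exact: bigsetU_measurable.
  by move=> t; rewrite -bigcup_mkord => -[k _ Ikt]; have [] := IW k t Ikt.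
have := dP s s1 s2 s3; rewrite -lte_fin => /ltW; apply: le_trans.
rewrite big_filter_I; last by move=> k ->; rewrite measure0.
rewrite /s big_map -sumEFin big_seq [leRHS]big_seq; apply: lee_sum => k.
rewrite mem_filter => /andP[/asboolP Ik0 _] /=.
have [_ h2 _ h4 _] := IP k Ik0.
rewrite ger0_norm; last by rewrite subr_ge0 Fnd// ltW.
rewrite -nu_itv; last exact: ltW.
apply: le_mu; [exact: mI|exact: measurable_itv|].
by move=> t /h4; rewrite /= !in_itv /= => /andP[-> /ltW ->].
Unshelve. all: by end_near. Qed.

(* The Lebesgue-Stieltjes measure of [F] is absolutely continuous; the density
   is its Radon-Nikodym derivative. *)
Lemma rac_mono_density : exists g, mu.-integrable setT (EFin \o g) /\
  forall x, a <= x -> x < b -> F x - F a = \int[mu]_(t in `[a, x]) g t.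
Proof.
have nu_fin : (nu `]a, b[%classic < +oo)%E.
  apply: (@le_lt_trans _ _ (nu `]a, b]%classic)); last by rewrite nu_itv ?ltry// ltW.
  by apply: le_mu => //; try exact: measurable_itv; apply: subset_itvW.
have mD : measurable (`]a, b[%classic : set (measurableTypeR R)) by exact: measurable_itv.
(* The measure is restricted to the open interval, where it is finite and [rac_mono_null] applies;
   the density formula is then read off for [x < b]. *)
pose nu' : {finite_measure set (measurableTypeR R) -> \bar R} :=
  @mfrestr _ (measurableTypeR R) R `]a, b[%classic nu mD nu_fin.
have numu : nu' `<< mu.
  apply/null_content_dominatesP => A mA A0.
exact: rac_mono_null.
have [g [g0 gfin intg gE]] := radon_nikodym_sigma_finite numu.
exists (fine \o g).
have gEq : EFin \o (fine \o g) = g by apply/funext => t /=; rewrite fineK.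
split; first by rewrite gEq.
move=> x ax xb; rewrite /Rintegral.
rewrite (_ : (fun t => _) = g); last by rewrite -[RHS]gEq.
rewrite -(@integral_itv_obnd_cbnd _ _ _ _)//; last first.
  by apply: (measurable_funS measurableT) => //; exact: measurable_int intg.
rewrite -gE//= /nu' /mfrestr /mrestr.
rewrite (_ : `]a, x] `&` `]a, b[ = `]a, x]%classic) ?nu_itv//.
apply/seteqP; split=> t /=; first by case.
by rewrite !in_itv /= => /andP[-> tx]; rewrite tx (le_lt_trans tx).
Qed.

End Monotone.
End RealAC.

(** * Total variation and the Jordan decomposition *)

Section TV.
Variable R : realType.
Local Notation mu := (@lebesgue_measure R).
Implicit Types (F f g : R -> R) (a b x y : R) (s : seq (R * R)).
Local Notation TV := total_variation.

Definition cells x (t : seq R) : seq (R * R) := zip (x :: t) t.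

Lemma cellsP x y (t : seq R) : path <%O x t -> last x t = y ->
  [/\ all (subitv x y) (cells x t), pairwise (@nonoverlap R) (cells x t) &
      \sum_(J <- cells x t) (J.2 - J.1) = y - x].
Proof.
elim: t x => [|z t IH] x /=; first by move=> _ ->; rewrite big_nil subrr.
move=> /andP[xz pt] lt; have [h1 h2 h3] := IH z pt lt.
have zy : z <= y.
  have : itv_partition z y t by split=> //; exact/eqP.
  exact: itv_partition_le.
have lez J : J \in cells z t -> z <= J.1 by move=> /(allP h1) /andP[/andP[]].
split.
- rewrite /subitv /= lexx xz zy /=; apply/allP => J Jt.
  have := allP h1 J Jt; rewrite /subitv => /andP[/andP[zJ ->] ->].
  by rewrite (le_trans (ltW xz) zJ).
- rewrite h2 andbT; apply/allP => J /lez zJ; by rewrite /nonoverlap /= zJ.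
- by rewrite big_cons h3 /=; ring.
Qed.

Lemma variation_cells x y f (t : seq R) : itv_partition x y t ->
  variation x y f t = \sum_(J <- cells x t) `|f J.2 - f J.1|.
Proof.
move=> p; rewrite variation_zip// {p}; elim: t x => [|z t IH] x; first by rewrite !big_nil.
by rewrite /= !big_cons IH.
Qed.

Section Decomposition.
Variables (a b : R) (f : R -> R).
Hypotheses (ab : a < b) (fac : rac a b f).

Lemma subitv_sub x y I J : subitv x y I -> subitv I.1 I.2 J -> subitv x y J.
Proof.
rewrite /subitv => /andP[/andP[xI II] Iy] /andP[/andP[IJ ->] JI].
by rewrite (le_trans xI IJ) (le_trans JI Iy).
Qed.

Lemma nonoverlap_sub (I J K : R * R) : nonoverlap I K -> subitv I.1 I.2 J ->
  nonoverlap J K.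
Proof.
rewrite /nonoverlap => /orP[h|h] /andP[/andP[h1 h2] h3]; apply/orP; [left|right].
  exact: le_trans h3 h.
exact: le_trans h h1.
Qed.

Lemma nonoverlapC (I J : R * R) : nonoverlap I J = nonoverlap J I.
Proof. by rewrite /nonoverlap orbC. Qed.

(** Replacing an interval by a partition of it changes neither the total length nor the
    disjointness, so [rac] bounds the variations along any choice of partitions. The suprema are
    taken one interval at a time: in [P] the list [s0] holds the intervals already subdivided. *)
Lemma tv_small (e : R) : 0 < e -> exists2 d : R, 0 < d & forall s,
  all (subitv a b) s -> pairwise (@nonoverlap R) s ->
  \sum_(I <- s) (I.2 - I.1) < d ->
  (\sum_(I <- s) TV I.1 I.2 f <= e%:E)%E.
Proof.
move=> e0; have [d d0 dP] := fac e0; exists d => // s.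
suff P s0 : all (subitv a b) (s0 ++ s) -> pairwise (@nonoverlap R) (s0 ++ s) ->
    \sum_(I <- s0 ++ s) (I.2 - I.1) < d ->
    ((\sum_(I <- s0) `|f I.2 - f I.1|)%:E + \sum_(I <- s) TV I.1 I.2 f <= e%:E)%E.
  by move=> h1 h2 h3; have := P [::] h1 h2 h3; rewrite big_nil add0e.
elim: s s0 => [|I s IH] s0 h1 h2 h3.
  by rewrite cats0 in h1 h2 h3; rewrite big_nil adde0 lee_fin ltW// dP.
have II : I.1 <= I.2.
  by move: h1; rewrite all_cat /= => /and3P[_ /andP[/andP[_ /ltW]]].
pose c : R := \sum_(I <- s0) `|f I.2 - f I.1|.
have step (t : seq R) : itv_partition I.1 I.2 t ->
    ((c + variation I.1 I.2 f t)%:E + \sum_(J <- s) TV J.1 J.2 f <= e%:E)%E.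
  move=> pt; have [p1 /eqP p2] := pt; have [q1 q2 q3] := cellsP p1 p2.
  have -> : c + variation I.1 I.2 f t =
      \sum_(J <- s0 ++ cells I.1 t) `|f J.2 - f J.1|.
    by rewrite big_cat -(variation_cells _ pt).
  apply: IH.
  - move: h1; rewrite !all_cat /= => /and3P[-> hI ->]; rewrite andbT /=.
    by apply/allP => J /(allP q1); exact: subitv_sub.
  - move: h2; rewrite -catA !pairwise_cat /= allrel_consr.
    move=> /and3P[/andP[a1 a2] -> /andP[a3 a4]].
    rewrite allrel_catr a2 q2 a4 !andbT /=; apply/andP; split.
      apply/allrelP => J K Js Kt; rewrite nonoverlapC.
      apply: nonoverlap_sub (allP q1 K Kt); rewrite nonoverlapC.
      exact: (allP a1).
    apply/allrelP => J K Jt Ks.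
    by apply: nonoverlap_sub (allP q1 J Jt); exact: (allP a3).
  - move: h3; rewrite !big_cat big_cons /= q3; lra.
rewrite big_cons.
have tv0 : (0 <= \sum_(J <- s) TV J.1 J.2 f)%E.
  rewrite big_seq; apply: sume_ge0 => J Js; apply: total_variation_ge0.
  move: h1; rewrite all_cat /= => /and3P[_ _ /allP/(_ J Js)].
  by move=> /andP[/andP[_ /ltW]].
move: h1; rewrite all_cat /= => /and3P[_ /andP[/andP[_ I12] _] _].
have fin : \sum_(J <- s) TV J.1 J.2 f \is a fin_num.
  rewrite ge0_fin_numE//; have := step _ (itv_partition1 I12).
  have := variation_ge0 I.1 I.2 f [:: I.2].
  set v := variation _ _ _ _ => v0.
  have c0 : 0 <= c by rewrite sumr_ge0.
  move=> h; apply: (@le_lt_trans _ _ e%:E); last exact: ltry.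
  by apply: le_trans h; rewrite leeDr// lee_fin addr_ge0.
rewrite -(fineK fin) in step tv0 *.
set r := fine _ in step tv0 *.
have : (TV I.1 I.2 f <= (e - c - r)%:E)%E.
  apply: ge_ereal_sup => _ [_ [t pt <-] <-].
  have := step t pt; rewrite -EFinD !lee_fin; lra.
move=> /(leeD2r (c + r)%:E); rewrite -EFinD (_ : e - c - r + (c + r) = e); last by ring.
by apply: le_trans; rewrite EFinD addeCA.
Qed.

Lemma tv_small1 : exists2 d : R, 0 < d & forall x y, a <= x -> x <= y -> y <= b ->
  y - x < d -> (TV x y f <= 1%:E)%E.
Proof.
have [d d0 dP] := tv_small ltr01; exists d => // x y ax xy yb yx.
move: xy; rewrite le_eqVlt => /predU1P[<-|xy].
  by rewrite total_variationxx.
have := dP [:: (x, y)]; rewrite !big_seq1 /=; apply => //.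
by rewrite /subitv /= ax xy yb.
Qed.

(** The variation is at most 1 on intervals shorter than the [d] of [tv_small1], and finitely many
    steps of length [d / 2] exhaust [[x, y]]. *)
Lemma tv_fin x y : a <= x -> x <= y -> y <= b -> TV x y f \is a fin_num.
Proof.
move=> ax xy yb; rewrite ge0_fin_numE ?total_variation_ge0//.
have [d d0 dP] := tv_small1.
have [n xn] : exists n : nat, y - x < n%:R * (d / 2).
  exists (Num.truncn ((y - x) / (d / 2))).+1.
  by rewrite -ltr_pdivrMr ?divr_gt0// truncnS_gt.
elim: n x ax xy xn => [|n IH] x ax xy xn.
  by exfalso; move: xn; rewrite mul0r; lra.
have [lt|ge] := ltP (y - x) d.
  exact: le_lt_trans (dP x y ax xy yb lt) (ltry _).
rewrite (@total_variationD _ x y (x + d / 2)); [|lra|lra].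
apply: lte_add_pinfty.
  apply: le_lt_trans (ltry 1); apply: dP; lra.
by apply: IH; [lra|lra|move: xn; rewrite -natr1 mulrDl; lra].
Qed.

(** Clamping to [[a, b]] makes the functions [V] and [W] constant outside this interval, as the
    monotone case requires. *)
Let cl x := Num.max a (Num.min b x).
Let clP x : a <= cl x <= b.
Proof. by rewrite /cl le_max lexx ge_max (ltW ab) ge_min lexx. Qed.
Let cl_id x : a <= x -> x <= b -> cl x = x.
Proof. by move=> ax xb; rewrite /cl min_r// max_r. Qed.
Let cl_homo x y : x <= y -> cl x <= cl y.
Proof.
move=> xy; rewrite /cl ge_max !le_max lexx /= le_min !ge_min lexx /= xy.
by rewrite !orbT.
Qed.
Let cl_a x : x <= a -> cl x = cl a.
Proof.
move=> xa; rewrite (cl_id (lexx a) (ltW ab)) /cl min_r ?max_l//.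
by rewrite (le_trans xa)// ltW.
Qed.
Let cl_b x : b <= x -> cl x = cl b.
Proof. by move=> bx; rewrite /cl minxx min_l. Qed.

Let V x := fine (TV a (cl x) f).
Let W x := V x - f (cl x).

Let VB x y : x <= y -> V y - V x = fine (TV (cl x) (cl y) f).
Proof.
move=> xy; have /andP[ax xb] := clP x; have /andP[ay yb] := clP y.
have cxy := cl_homo xy.
rewrite /V (total_variationD f ax cxy) fineD ?tv_fin//.
by rewrite addrC addKr.
Qed.

Let V_le x y : x <= y -> `|f (cl y) - f (cl x)| <= V y - V x.
Proof.
move=> xy; have /andP[ax xb] := clP x; have /andP[ay yb] := clP y.
have cxy := cl_homo xy.
rewrite VB// -lee_fin fineK ?tv_fin//; exact: total_variation_ge.
Qed.

(** A function whose increments are dominated by those of [V] inherits absolute continuity from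
    [tv_small]. *)
Let rac_le (G : R -> R) (M : R) : 0 < M ->
  (forall x y, x <= y -> `|G y - G x| <= M * (V y - V x)) -> rac a b G.
Proof.
move=> M0 GV e e0; have e1 : 0 < e / (2 * M) by rewrite divr_gt0// mulr_gt0.
have [d d0 dP] := tv_small e1; exists d => // s s1 s2 s3.
have := dP s s1 s2 s3.
have -> : (\sum_(I <- s) TV I.1 I.2 f = (\sum_(I <- s) (V I.2 - V I.1))%:E)%E.
  rewrite -sumEFin big_seq [RHS]big_seq; apply: eq_bigr => I /(allP s1).
  move=> /andP[/andP[aI II] Ib].
  have c1 : cl I.1 = I.1 by apply: cl_id => //; lra.
  have c2 : cl I.2 = I.2 by apply: cl_id => //; lra.
  by rewrite VB ?(ltW II)// c1 c2 fineK// tv_fin// ltW.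
rewrite lee_fin => le.
apply: (@le_lt_trans _ _ (\sum_(I <- s) M * (V I.2 - V I.1))).
  rewrite big_seq [leRHS]big_seq; apply: ler_sum => I /(allP s1).
  by move=> /andP[/andP[aI II] Ib]; apply: GV; exact: ltW.
rewrite -mulr_sumr (@le_lt_trans _ _ (M * (e / (2 * M))))//.
  by rewrite ler_pM2l.
rewrite (_ : M * _ = e / 2); last by field; rewrite gt_eqF.
lra.
Qed.

(** The Jordan decomposition [f = V - W] on [[a, b]]: both parts are nondecreasing and absolutely
    continuous, so the monotone case provides a density for each. *)
Lemma rac_density : exists g, mu.-integrable setT (EFin \o g) /\
  forall x, a <= x -> x < b -> f x - f a = \int[mu]_(t in `[a, x]) g t.
Proof.
have Vnd : {homo V : x y / x <= y}.
  by move=> x y /V_le; rewrite -subr_ge0; apply: le_trans.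
have Wnd : {homo W : x y / x <= y}.
  move=> x y xy; rewrite /W; have := V_le xy.
  have := ler_norm (f (cl y) - f (cl x)); lra.
have rV : rac a b V.
  apply: (@rac_le _ 1) => // x y xy; rewrite mul1r ger0_norm ?subr_ge0//.
  exact: Vnd.
have rW : rac a b W.
  apply: (@rac_le _ 2) => // x y xy; rewrite ger0_norm ?subr_ge0 ?Wnd// /W.
  have := V_le xy; rewrite ler_norml => /andP[]; lra.
have [g1 [i1 e1]] := @rac_mono_density R a b V ab rV Vnd
  (fun x h => congr1 (fun z => fine (TV a z f)) (cl_a h))
  (fun x h => congr1 (fun z => fine (TV a z f)) (cl_b h)).
have WE x y : cl x = cl y -> W x = W y by rewrite /W /V => ->.
have [g2 [i2 e2]] := @rac_mono_density R a b W ab rW Wnd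
  (fun x h => WE _ _ (cl_a h)) (fun x h => WE _ _ (cl_b h)).
exists (fun x => g1 x - g2 x); split.
  rewrite (_ : _ \o _ = (EFin \o g1) \- (EFin \o g2))%E//.
  exact: integrableB.
move=> x ax xb.
rewrite RintegralB//; try by apply: (integrableS measurableT).
rewrite -e1// -e2// /W (cl_id ax (ltW xb)) (cl_id (lexx a) (ltW ab)); lra.
Qed.

End Decomposition.
End TV.

(** * Absolutely continuous functions as primitives *)

Section Density.
Variable R : realType.
Local Notation mu := (@lebesgue_measure R).
Implicit Types (F f g h : R -> R) (a b x y : R) (s : seq (R * R)).

(** For locally integrable [h] this is the integral form of local absolute continuity with
    derivative [h] almost everywhere; [ac_primitive], [primitive_ae] and [primitive_rac] pass
    between the two. *)
Definition primitive f h := forall x y, x <= y -> f y - f x = \int[mu]_(t in `[x, y]) h t.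

Lemma locally_integrable_itv h x y : locally_integrable setT h ->
  mu.-integrable `[x, y] (EFin \o h).
Proof.
move=> [mh _ hK]; apply/integrableP; split.
  by apply/measurable_EFinP; exact: measurable_funTS mh.
apply: hK => //; exact: segment_compact.
Qed.

Lemma integrable_ae_eq (D : set R) f h : measurable D -> measurable_fun D h ->
  mu.-integrable D (EFin \o f) -> {ae mu, forall x, D x -> f x = h x} ->
  mu.-integrable D (EFin \o h) /\ \int[mu]_(x in D) f x = \int[mu]_(x in D) h x.
Proof.
move=> mD mh /[dup] intf /integrableP[mf foo] fh.
have fhE : ae_eq mu D (EFin \o f) (EFin \o h).
  have ? := ae_filter_ringOfSetsType mu.
  by apply: filterS fh => x /[apply] /= ->.
have mh' : measurable_fun D (EFin \o h) by apply/measurable_EFinP.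
split; last by congr fine; exact: ae_eq_integral.
apply/integrableP; split=> //.
have -> : (\int[mu]_(x in D) `|(EFin \o h) x| = \int[mu]_(x in D) `|(EFin \o f) x|)%E.
  apply: ae_eq_integral => //; try exact: measurableT_comp.
  exact: ae_eq_abse (ae_eq_sym fhE).
by [].
Qed.

Lemma primitive_derive g a : mu.-integrable setT (EFin \o g) ->
  {ae mu, forall x, a < x ->
    derivable (fun y => \int[mu]_(t in `[a, y]) g t : R^o) x 1 /\
    derive1 (fun y => \int[mu]_(t in `[a, y]) g t) x = g x}.
Proof.
move=> intg; have ? := ae_filter_ringOfSetsType mu.
have := @FTC1 R g (BLeft a); move=> /(_ _ _)/=.
have h1 y : mu.-integrable [set` Interval (BLeft a) (BRight y)] (EFin \o g).
  exact: integrableS intg.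
have h2 : locally_integrable setT g by apply: open_integrable_locally => //; exact: openT.
move=> /(_ h1 h2); apply: filterS => x H ax; apply: H.
by rewrite lte_fin.
Qed.

Lemma near_derive f g (c x : R) : (\near x, f x = g x + c) ->
  derivable (g : R -> R^o) x 1 -> derivable (f : R -> R^o) x 1 /\ derive1 f x = derive1 g x.
Proof.
move=> fg dg.
have dc : derivable (cst c : R -> R^o) x 1 by exact: derivable_cst.
have fgc : {near x, (g + cst c : R -> R^o) =1 f} by apply: filterS fg => t ->.
split; first by apply: near_eq_derivable fgc _; exact: derivableD.
rewrite !derive1E -(@near_eq_derive _ _ _ (g + cst c : R -> R^o) f x 1 fgc) deriveD// (_ : 'D_1 (cst c) x = 0) ?addr0//.
exact: derive_cst.
Qed.

Lemma near_oo a b x : a < x -> x < b -> \forall z \near x, a < z < b.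
Proof.
move=> ax xb; have := @near_in_itvoo R a b x; rewrite in_itv /= ax xb => /(_ isT).
by apply: filterS => z; rewrite in_itv.
Qed.

(** By Lebesgue's differentiation theorem the density from [rac_density] is almost everywhere the
    derivative of [f], so it agrees with [h]. *)
Lemma ac_primitive f h : (forall a b, rac a b f) -> measurable_fun setT h ->
  {ae mu, forall x, derive1 f x = h x} -> forall x y, x <= y ->
  mu.-integrable `[x, y] (EFin \o h) /\
  f y - f x = \int[mu]_(t in `[x, y]) h t.
Proof.
move=> fac mh fh x y xy; have ? := ae_filter_ringOfSetsType mu.
(* The margins put [[x, y]] inside the open interval in which the density formula holds and its
   integral can be differentiated. *)
pose a := x - 1; pose b := y + 1.
have ax : a < x by rewrite /a; lra.
have yb : y < b by rewrite /b; lra.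
have ab : a < b by lra.
have [g [intg gE]] := rac_density ab (fac a b).
have gh : {ae mu, forall t, (`[x, y]%classic : set R) t -> g t = h t}.
  have := primitive_derive a intg.
  apply: filterS2 fh => t ft gt /=; rewrite in_itv /= => /andP[xt ty].
  have [dg <-] := gt (lt_le_trans ax xt).
  have [//|_ <-//] := @near_derive f _ (f a) t _ dg.
  have [at' tb] : a < t /\ t < b by split; lra.
  apply: filterS (near_oo at' tb) => z /andP[az zb].
  by rewrite -(gE z) ?(ltW az)// subrK.
have intxy : mu.-integrable `[x, y] (EFin \o g) by exact: integrableS intg.
have [inth hE] := integrable_ae_eq (measurable_itv _) (measurable_funS measurableT (@subsetT _ _) mh) intxy gh.
split=> //; rewrite -hE.
have -> : f y - f x = (f y - f a) - (f x - f a) by ring.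
rewrite (gE y) ?(gE x); try lra.
rewrite Rintegral_itvB//; last 2 first.
- exact: integrableS intg.
- by rewrite bnd_simp; lra.
rewrite Rintegral_itv_obnd_cbnd//.
exact: integrableS intg.
Qed.

Lemma primitive_ae f h : locally_integrable setT h -> primitive f h ->
  {ae mu, forall x, derivable (f : R -> R^o) x 1 /\ derive1 f x = h x}.
Proof.
move=> lh fh; have ? := ae_filter_ringOfSetsType mu.
have H n : {ae mu, forall x, (`]- n%:R, n%:R[%classic : set R) x ->
    derivable (f : R -> R^o) x 1 /\ derive1 f x = h x}.
  pose g := h \_ `[- n%:R, n%:R].
  have intg : mu.-integrable setT (EFin \o g).
    rewrite -restrict_EFin -integrable_mkcond//; exact: locally_integrable_itv.
  have := primitive_derive (- n%:R) intg.
  apply: filterS => x H; rewrite /= in_itv /= => /andP[nx xn].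
  have [dg gE] := H nx.
  have [|df ->] := @near_derive f _ (f (- n%:R)) x _ dg.
    apply: filterS (near_oo nx xn) => z /andP[/ltW nz /ltW zn].
    rewrite -[LHS](subrK (f (- n%:R))) (fh _ _ nz); congr (_ + _).
    apply: eq_Rintegral => t; rewrite inE /= in_itv /= => /andP[h1 h2].
    by rewrite /g patchE mem_set//= in_itv /= h1 (le_trans h2 zn).
  split => //; rewrite gE /g patchE mem_set//= in_itv /=.
  by rewrite !ltW.
have := ae_foralln H; apply: filterS => x Hx.
apply: (Hx (Num.truncn `|x|).+1) => /=.
by rewrite in_itv /= -ltr_norml truncnS_gt.
Qed.

(** The intervals are half-open because nonoverlapping closed ones may share end points. *)
Lemma integral_nonoverlap (k : R -> \bar R) a b s : measurable_fun setT k ->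
  (forall x, 0 <= k x)%E -> all (subitv a b) s -> pairwise (@nonoverlap R) s ->
  (\sum_(I <- s) \int[mu]_(t in `]I.1, I.2]) k t <= \int[mu]_(t in `[a, b]) k t)%E.
Proof.
move=> mk k0 s1 s2.
pose U (s : seq (R * R)) := [set t | has (fun I => (I.1 < t) && (t <= I.2)) s].
have UE (I : R * R) s' : U (I :: s') = `]I.1, I.2] `|` U s'.
  apply/seteqP; split=> t; rewrite /U /= in_itv /=.
    by move=> /orP[|]; [left|right].
  by move=> [->|->]; rewrite ?orbT.
have mU s' : measurable (U s').
  elim: s' => [|I s' IH]; last by rewrite UE; apply: measurableU.
  by rewrite (_ : U [::] = set0) //; apply/seteqP; split=> t.
have UI : U s `<=` `[a, b].
  move=> t /hasP[I /(allP s1)/andP[/andP[h1 h2] h3] /andP[h4 h5]].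
  by rewrite /= in_itv /=; apply/andP; split; lra.
apply: (@le_trans _ _ (\int[mu]_(t in U s) k t)%E); last first.
  apply: ge0_subset_integral => //; [exact: mU|exact: measurable_funTS].
elim: s s1 s2 {UI} => [|I s IH] /=; first by rewrite big_nil integral_ge0.
move=> /andP[I1 s1] /andP[I2 s2]; rewrite big_cons UE ge0_integral_setU//.
- by rewrite leeD2l// IH.
- exact: mU.
- exact: measurable_funTS.
apply/disj_setPS => t [] /=; rewrite in_itv /= => /andP[h1 h2] /hasP[J Js /andP[h3 h4]].
have := allP I2 J Js; rewrite /nonoverlap => /orP[]; lra.
Qed.

(** Absolute continuity of the integral: a simple function [S] with [|S| <= M] approximates [h] in
    the mean up to [e / 2], and the intervals contribute at most [M] times their total length
    besides. *)
Lemma primitive_rac f h a b : locally_integrable setT h -> primitive f h -> rac a b f.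
Proof.
move=> lh fh e e0; have [mh _ _] := lh.
have inth := locally_integrable_itv a b lh.
have [s_ [ints _ sl1]] :=
  @approximation_sfun_integrable _ _ R mu _ (measurable_itv `[a, b]) _ inth.
have [n nP] : exists n, (\int[mu]_(t in `[a, b]) `|(h t)%:E - (s_ n t)%:E| < (e / 2)%:E)%E.
  have /fine_cvgP[[m _ fin] /cvgrPdist_lt/(_ (e / 2))] := sl1.
  rewrite divr_gt0// => /(_ isT)[m' _ mP].
  exists (maxn m m'); have := mP (maxn m m') (leq_maxr _ _).
  have /= F := fin (maxn m m') (leq_maxl _ _).
  rewrite /= sub0r normrN => lt; rewrite -(fineK F) lte_fin.
  exact: le_lt_trans (ler_norm _) lt.
pose S := s_ n.
have [M M0 SM] : exists2 M : R, 0 < M & forall t, `|S t| <= M.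
  have [M [_ MP]] := @simple_bounded _ _ _ S.
  exists (`|M| + 1); first by rewrite ltr_wpDl.
  move=> t; have := MP (`|M| + 1); rewrite (le_lt_trans (ler_norm M)) ?ltrDl//.
  by move=> /(_ isT t Logic.I).
exists (e / (2 * M)); first by rewrite divr_gt0// mulr_gt0.
move=> s s1 s2 s3.
pose k t := `|(h t)%:E - (S t)%:E|%E.
have mk : measurable_fun setT k.
  apply: measurableT_comp => //; apply: emeasurable_funB; apply/measurable_EFinP => //.
  exact: (@measurable_funPT _ _ (measurableTypeR R) _ S).
have k0 t : (0 <= k t)%E by exact: abse_ge0.
have bound I : subitv a b I ->
    ((`|f I.2 - f I.1|)%:E <= \int[mu]_(t in `]I.1, I.2]) k t + (M * (I.2 - I.1))%:E)%E.
  move=> /andP[/andP[aI II] Ib].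
  have iI : mu.-integrable `]I.1, I.2] (EFin \o h).
    apply: integrableS (locally_integrable_itv I.1 I.2 lh) => //.
    exact: subset_itv_oc_cc.
  rewrite (fh _ _ (ltW II)) -Rintegral_itv_obnd_cbnd//.
  rewrite -[X in (X <= _)%E]/(`|(\int[mu]_(t in `]I.1, I.2]) h t)%:E|%E).
  rewrite fineK ?integrable_fin_num//.
  apply: le_trans (le_abse_integral _ _ _) _ => //; first by case/integrableP : iI.
  rewrite (_ : (M * (I.2 - I.1))%:E = \int[mu]_(t in `]I.1, I.2]) (cst M%:E) t)%E; last first.
    have E : mu (`]I.1, I.2]%classic : set R) = (I.2 - I.1)%:E.
      by rewrite lebesgue_measure_itv /= lte_fin II.
    by rewrite integral_cst ?EFinM -?E//; exact: measurable_itv.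
  have mk' : measurable_fun (`]I.1, I.2]%classic : set R) k by exact: measurable_funTS mk.
  have M0' t : (`]I.1, I.2]%classic : set R) t -> (0 <= cst M%:E t)%E.
    by move=> _; rewrite lee_fin ltW.
  rewrite -ge0_integralD//.
  apply: ge0_le_integral => //.
  - by apply: measurableT_comp => //; case/integrableP : iI.
  - exact: emeasurable_funD.
  - move=> t _ /=; rewrite /k -EFinB -EFinD !lee_fin.
    by have := SM t; have := ler_normD (h t - S t) (S t); rewrite subrK; lra.
rewrite -lte_fin -sumEFin.
apply: (@le_lt_trans _ _ (\sum_(I <- s) (\int[mu]_(t in `]I.1, I.2]) k t + (M * (I.2 - I.1))%:E))%E).
  by rewrite big_seq [leRHS]big_seq; apply: lee_sum => I /(allP s1); exact: bound.
rewrite big_split /= sumEFin -mulr_sumr.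
rewrite (_ : e = e / 2 + M * (e / (2 * M))); last by field; rewrite gt_eqF.
rewrite EFinD; apply: lteD; last by rewrite lte_fin ltr_pM2l.
exact: le_lt_trans (integral_nonoverlap mk k0 s1 s2) nP.
Qed.

End Density.

(** * The space L2 *)

Section L2Form.
Variables (R : realType) (r : R -> R).
Local Notation mu := (@lebesgue_measure R).
Hypotheses (mr : measurable_fun setT r) (r0 : {ae mu, forall x, r x != 0}).
Implicit Types F G : L2 r.
Local Notation Re := complex.Re.
Local Notation Im := complex.Im.

Let aeF : Filter (nbhs (almost_everywhere mu)).
Proof. exact: (ae_filter_ringOfSetsType mu). Qed.
Hint Extern 0 (Filter _) => exact: aeF : typeclass_instances.

Lemma normc2E (z : R[i]) : normc z ^+ 2 = Re z ^+ 2 + Im z ^+ 2.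
Proof. by case: z => a b /=; rewrite sqr_sqrtr// addr_ge0// sqr_ge0. Qed.

Lemma L2_pi (f : L2_fun r) : {ae mu, forall x, L2_repr (\pi_(L2 r) f)%qT x = f x}.
Proof.
have /eqP := reprK (\pi_(L2 r) f)%qT.
rewrite -Quotient.idealrBE => /asboolP; apply: filterS => x /=.
by rewrite !fctE => /eqP; rewrite subr_eq0 => /eqP.
Qed.

Lemma L2_mk (f : R -> R[i]) : L2_fun_prop r f ->
  exists F : L2 r, {ae mu, forall x, F x = f x}.
Proof.
move=> Lf; have f_in : f \in L2_fun_pred r by apply/asboolP.
by exists (\pi_(L2 r) (MkL2Fun f_in))%qT; exact: L2_pi.
Qed.

Lemma L2_prop F : L2_fun_prop r F.
Proof. exact/asboolP/L2_fun_valP. Qed.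

Lemma L2_add F G : {ae mu, forall x, (F + G : L2 r) x = F x + G x}.
Proof.
have := L2_pi (generic_quotient.repr F + generic_quotient.repr G).
by rewrite pi_L2_add !reprK; apply: filterS.
Qed.

Lemma L2_scaleE a F : {ae mu, forall x, (a *: F : L2 r) x = a * F x}.
Proof.
have := L2_pi (a *: generic_quotient.repr F).
by rewrite pi_L2_scale !reprK; apply: filterS.
Qed.

Lemma L2_zero : {ae mu, forall x, (0 : L2 r) x = 0}.
Proof.
have := L2_scaleE 0 (0 : L2 r); rewrite scaler0; apply: filterS => x.
by rewrite mul0r.
Qed.

Lemma L2_ext F G : {ae mu, forall x, F x = G x} -> F = G.
Proof. by move/L2_eqP. Qed.

Lemma mRe F : measurable_fun setT (fun x => Re (F x)).
Proof. by have [] := L2_prop F. Qed.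
Lemma mIm F : measurable_fun setT (fun x => Im (F x)).
Proof. by have [] := L2_prop F. Qed.
Let mnr : measurable_fun setT (fun x => `|r x|).
Proof. exact: measurableT_comp. Qed.

Definition dotRe F G x := (Re (F x) * Re (G x) + Im (F x) * Im (G x)) * `|r x|.
Definition dotIm F G x := (Im (F x) * Re (G x) - Re (F x) * Im (G x)) * `|r x|.

Lemma dotE F G : L2_dot r F G = (\int[mu]_x dotRe F G x)%R +i* (\int[mu]_x dotIm F G x)%R.
Proof.
rewrite /L2_dot /cintegral; congr (_ +i* _); congr (Rintegral _ _ _);
  apply/funext => x; rewrite /dotRe /dotIm; case: (F x) => a b;
  case: (G x) => c d /=; ring.
Qed.

Lemma mdotRe F G : measurable_fun setT (dotRe F G).
Proof.
apply: measurable_funM => //; apply: measurable_funD;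
  by apply: measurable_funM; (exact: mRe || exact: mIm).
Qed.
Lemma mdotIm F G : measurable_fun setT (dotIm F G).
Proof.
apply: measurable_funM => //; apply: measurable_funB;
  by apply: measurable_funM; (exact: mRe || exact: mIm).
Qed.

Lemma integrable_dom (f : R -> R) F G : measurable_fun setT f ->
  (forall x, `|f x| <= (normc (F x) ^+ 2 + normc (G x) ^+ 2) * `|r x|) ->
  mu.-integrable setT (EFin \o f).
Proof.
move=> mf le; have [_ _ iF] := L2_prop F; have [_ _ iG] := L2_prop G.
apply: (le_integrable measurableT _ _ (integrableD measurableT iF iG)).
  exact/measurable_EFinP.
move=> x _ /=; rewrite lee_fin -mulrDl (le_trans (le x))//.
exact: ler_norm.
Qed.

Lemma idotRe F G : mu.-integrable setT (EFin \o dotRe F G).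
Proof.
apply: (@integrable_dom _ F G); first exact: mdotRe.
move=> x; rewrite /dotRe normrM normr_id ler_wpM2r// !normc2E.
set a := Re _; set b := Im _; set c := Re _; set d := Im _.
rewrite ler_norml; apply/andP; split.
  have := sqr_ge0 (a + c); have := sqr_ge0 (b + d).
  have := sqr_ge0 a; have := sqr_ge0 b; have := sqr_ge0 c; have := sqr_ge0 d; nra.
have := sqr_ge0 (a - c); have := sqr_ge0 (b - d).
have := sqr_ge0 a; have := sqr_ge0 b; have := sqr_ge0 c; have := sqr_ge0 d; nra.
Qed.

Lemma idotIm F G : mu.-integrable setT (EFin \o dotIm F G).
Proof.
apply: (@integrable_dom _ F G); first exact: mdotIm.
move=> x; rewrite /dotIm normrM normr_id ler_wpM2r// !normc2E.
set b := Im _; set c := Re _; set a := Re _; set d := Im _.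
rewrite ler_norml; apply/andP; split.
  have := sqr_ge0 (b + c); have := sqr_ge0 (a - d).
  have := sqr_ge0 a; have := sqr_ge0 b; have := sqr_ge0 c; have := sqr_ge0 d; nra.
have := sqr_ge0 (b - c); have := sqr_ge0 (a + d).
have := sqr_ge0 a; have := sqr_ge0 b; have := sqr_ge0 c; have := sqr_ge0 d; nra.
Qed.

Lemma Rintegral_ae (f h : R -> R) : mu.-integrable setT (EFin \o f) ->
  measurable_fun setT h -> {ae mu, forall x, f x = h x} ->
  \int[mu]_x f x = \int[mu]_x h x.
Proof.
move=> intf mh fh; apply: (integrable_ae_eq measurableT mh intf _).2.
by apply: filterS fh.
Qed.

Lemma L2_dot_hform : hform (L2_dot r).
Proof.
split.
- move=> u v w; rewrite !dotE; apply: complexE => /=.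
    rewrite -RintegralD ?idotRe//; apply: Rintegral_ae; first exact: idotRe.
      by apply: measurable_funD; exact: mdotRe.
    apply: filterS (L2_add u v) => x E; rewrite /dotRe E ReD ImD; ring.
  rewrite -RintegralD ?idotIm//; apply: Rintegral_ae; first exact: idotIm.
    by apply: measurable_funD; exact: mdotIm.
  apply: filterS (L2_add u v) => x E; rewrite /dotIm E ReD ImD; ring.
- move=> a u w; rewrite !dotE; apply: complexE; rewrite ?ReM ?ImM /=.
    rewrite -!RintegralZl ?idotRe ?idotIm// -RintegralB//; last 2 first.
    + exact: (integrableZl measurableT (Re a) (idotRe u w)).
    + exact: (integrableZl measurableT (Im a) (idotIm u w)).
    apply: Rintegral_ae; first exact: idotRe.
      by apply: measurable_funB; apply: measurable_funM => //;
        [exact: mdotRe|exact: mdotIm].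
    apply: filterS (L2_scaleE a u) => x E; rewrite /dotRe /dotIm E ReM ImM; ring.
  rewrite -!RintegralZl ?idotRe ?idotIm// -RintegralD//; last 2 first.
  + exact: (integrableZl measurableT (Re a) (idotIm u w)).
  + exact: (integrableZl measurableT (Im a) (idotRe u w)).
  apply: Rintegral_ae; first exact: idotIm.
    by apply: measurable_funD; apply: measurable_funM => //;
      [exact: mdotIm|exact: mdotRe].
  apply: filterS (L2_scaleE a u) => x E; rewrite /dotRe /dotIm E ReM ImM; ring.
- move=> u v; rewrite !dotE; apply: complexE => /=.
    by congr (Rintegral _ _ _); apply/funext => x; rewrite /dotRe; ring.
  rewrite -mulN1r -RintegralZl ?idotIm//; congr (Rintegral _ _ _).
  by apply/funext => x; rewrite /dotIm; ring.
- move=> v; rewrite dotE /=; apply: Rintegral_ge0 => x _.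
  by rewrite /dotRe mulr_ge0// addr_ge0// -expr2 sqr_ge0.
Qed.

Lemma qf_L2 F : (qf (L2_dot r) F)%:E = (\int[mu]_x (normc (F x) ^+ 2 * `|r x|)%:E)%E.
Proof.
rewrite /qf dotE /= /Rintegral fineK; last first.
  exact: integrable_fin_num (idotRe F F).
by apply: eq_integral => x _; rewrite /dotRe normc2E !expr2.
Qed.

Lemma L2_dot_def F : qf (L2_dot r) F = 0 -> F = 0.
Proof.
move=> q0; have := qf_L2 F; rewrite q0 => /esym i0.
have [_ _ /integrableP[mF _]] := L2_prop F.
have : (\int[mu]_x `|(normc (F x) ^+ 2 * `|r x|)%:E| = 0)%E.
  rewrite -[RHS]i0; apply: eq_integral => x _.
  by rewrite gee0_abs// lee_fin mulr_ge0// sqr_ge0.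
move=> /(ae_eq_integral_abs _ measurableT mF).1 => Fae.
apply: L2_ext; apply: filterS3 r0 Fae L2_zero => x rx Fx ->.
have := Fx Logic.I => -[/eqP]; rewrite mulf_eq0 normr_eq0 (negbTE rx) orbF.
rewrite normc2E => h; apply/eqP; rewrite -nsq_eq0; exact: h.
Qed.

End L2Form.

(** * Completeness of the weighted space of square integrable functions *)

Section L2Complete.
Variables (R : realType) (r : R -> R).
Local Notation mu := (@lebesgue_measure R).
Hypotheses (mr : measurable_fun setT r) (r0 : {ae mu, forall x, r x != 0}).
Implicit Types F G : L2 r.
Local Notation Re := complex.Re.
Local Notation Im := complex.Im.
Local Notation nm := (hnorm (L2_dot r)).

Let aeF : Filter (nbhs (almost_everywhere mu)).
Proof. exact: (ae_filter_ringOfSetsType mu). Qed.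
Hint Extern 0 (Filter _) => exact: aeF : typeclass_instances.

(** The steps are at most [sqrt C * 2^(- k / 2)], so the telescoping series converges absolutely. *)
Lemma fast_cvg (u : nat -> R) (C : R) :
  (forall k, 2 ^+ k * (u k.+1 - u k) ^+ 2 <= C) -> cvgn u.
Proof.
move=> uC; have C0 : 0 <= C by apply: le_trans (uC 0%N); rewrite mulr_ge0// sqr_ge0.
pose s : R := Num.sqrt 2^-1.
have s2 : s ^+ 2 = 2^-1 by rewrite sqr_sqrtr.
have s0 : 0 <= s by exact: sqrtr_ge0.
have s1 : s < 1.
  rewrite -(ltr_pXn2r (n := 2))// ?nnegrE// s2 expr1n invf_lt1//; lra.
have d k : `|u k.+1 - u k| <= Num.sqrt C * s ^+ k.
  rewrite -(ler_pXn2r (n := 2)) ?nnegrE ?mulr_ge0 ?sqrtr_ge0 ?exprn_ge0//.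
  rewrite exprMn sqr_sqrtr// -exprM mulnC exprM s2 exprVn ler_pdivlMr ?exprn_gt0//.
  by rewrite -normrX ger0_norm ?sqr_ge0// mulrC.
have c : cvgn (series (telescope u)).
  apply: normed_cvg; apply: (@series_le_cvg _ _ (geometric (Num.sqrt C) s)).
  - by move=> k; exact: normr_ge0.
  - by move=> k; rewrite /geometric /= mulr_ge0 ?sqrtr_ge0 ?exprn_ge0.
  - by move=> k; exact: d.
  - by apply: is_cvg_geometric_series; rewrite ger0_norm.
have -> : u = (fun k => series (telescope u) k + u 0%N).
  by apply/funext => k; rewrite telescopeK subrK.
by apply: is_cvgD => //; exact: is_cvg_cst.
Qed.

Definition dist2 (f g : R -> R[i]) x : R := nsq (f x - g x) * `|r x|.

Lemma dist2_ge0 f g x : 0 <= dist2 f g x.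
Proof. by rewrite mulr_ge0// nsq_ge0. Qed.

Lemma mdist2 (f g : R -> R[i]) :
  measurable_fun setT (fun x => Re (f x)) -> measurable_fun setT (fun x => Im (f x)) ->
  measurable_fun setT (fun x => Re (g x)) -> measurable_fun setT (fun x => Im (g x)) ->
  measurable_fun setT (dist2 f g).
Proof.
move=> *; apply: measurable_funM; last exact: measurableT_comp.
rewrite /nsq; under eq_fun do rewrite ReB ImB.
by apply: measurable_funD; apply: measurable_funX; exact: measurable_funB.
Qed.

Lemma qf_dist2 F G : (qf (L2_dot r) (F - G))%:E = (\int[mu]_x (dist2 F G x)%:E)%E.
Proof.
rewrite qf_L2//; apply: ae_eq_integral => //.
- by have [_ _ /integrableP[]] := L2_prop (F - G).
- by apply/measurable_EFinP; apply: mdist2; (exact: mRe || exact: mIm).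
have := L2_add F (- G); have := L2_scaleE (-1) G; rewrite scaleN1r.
apply: filterS2 => x h1 h2 _; rewrite /dist2 h2 h1 mulN1r.
by rewrite normc2E.
Qed.

(** As in the Riesz-Fischer theorem. The squared steps have integrals at most [4^-k], so even with
    the weights [2^k] they sum to an integrable function [Phi]; where [Phi] is finite, [fast_cvg]
    gives pointwise convergence. *)
Lemma L2_fast_limit (v : nat -> L2 r) :
  (forall k, nm (v k.+1 - v k) <= 2^-1 ^+ k) ->
  exists F : L2 r, nm (v k - F) @[k --> \oo] --> 0.
Proof.
move=> vP.
have nH := L2_dot_hform mr.
have mv k := @mRe _ _ (v k); have mw k := @mIm _ _ (v k).
have q2 k : qf (L2_dot r) (v k.+1 - v k) <= 4^-1 ^+ k.
  rewrite -(sqr_hnorm nH) (_ : 4^-1 ^+ k = (2^-1 ^+ k) ^+ 2); last first.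
    by rewrite -exprM mulnC exprM; congr (_ ^+ _); field.
  by rewrite ler_pXn2r ?nnegrE ?(hnorm_ge0)// exprn_ge0.
pose phi k x := (2 ^+ k * dist2 (v k.+1) (v k) x)%:E.
have mphi k : measurable_fun setT (phi k).
  by apply/measurable_EFinP; apply: measurable_funM => //; exact: mdist2.
have phi0 k x : (0 <= phi k x)%E by rewrite lee_fin mulr_ge0// dist2_ge0.
pose Phi x := (\sum_(k <oo) phi k x)%E.
have iPhi : (\int[mu]_x Phi x < +oo)%E.
  rewrite integral_nneseries//.
  apply: (@le_lt_trans _ _ (\sum_(k <oo) (geometric 1 2^-1 k)%:E)%E).
    apply: lee_nneseries; first by move=> k _ _; exact: integral_ge0.
    move=> k _; rewrite /phi; under eq_integral do rewrite EFinM.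
    rewrite ge0_integralZl_EFin//; last first.
    - by apply/measurable_EFinP; exact: mdist2.
    - by move=> x _; rewrite lee_fin dist2_ge0.
    rewrite -qf_dist2 -EFinM lee_fin /geometric /= mul1r.
    apply: (@le_trans _ _ (2 ^+ k * 4^-1 ^+ k)); first by rewrite ler_pM2l.
    by rewrite -exprMn; apply: lerXn2r; rewrite ?nnegrE; lra.
  have := @cvg_geometric_series R 1 2^-1; rewrite ger0_norm; last lra.
  move=> /(_ ltac:(lra)) c.
  suff -> : (\sum_(k <oo) (geometric 1 (2^-1 : R) k)%:E = (1 / (1 - 2^-1))%:E)%E by rewrite ltry.
  apply/cvg_lim => //; apply: cvg_EFin.
    by near=> n; rewrite sumEFin.
  rewrite [X in X @ _ --> _](_ : _ = series (geometric 1 2^-1))//.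
  by apply/funext => n /=; rewrite sumEFin.
have mPhi : measurable_fun setT Phi by exact: ge0_emeasurable_sum.
have Phi0 x : (0 <= Phi x)%E by apply: nneseries_ge0.
have Phifin : {ae mu, forall x, Phi x \is a fin_num}.
  have : mu.-integrable setT Phi.
    apply/integrableP; split=> //.
    by under eq_integral do rewrite gee0_abs//.
  by move=> /(integrable_ae measurableT); apply: filterS => x; apply.
(* The upper limit is measurable and defined everywhere, and it is the limit wherever the sequence
   converges. *)
pose fR x := fine (limn_esup (fun k => (Re (v k x))%:E)).
pose fI x := fine (limn_esup (fun k => (Im (v k x))%:E)).
pose f x := (fR x +i* fI x).
have mfR : measurable_fun setT fR.
  apply: measurableT_comp => //; apply: measurable_fun_limn_esup => k.
  by apply/measurable_EFinP.
have mfI : measurable_fun setT fI.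
  apply: measurableT_comp => //; apply: measurable_fun_limn_esup => k.
  by apply/measurable_EFinP.
have cvgf : {ae mu, forall x, Re (v k x) @[k --> \oo] --> fR x /\ Im (v k x) @[k --> \oo] --> fI x}.
  apply: filterS2 r0 Phifin => x rx fx.
  have rp : 0 < `|r x| by rewrite normr_gt0.
  have bound k : 2 ^+ k * nsq (v k.+1 x - v k x) <= fine (Phi x) / `|r x|.
    rewrite ler_pdivlMr// -mulrA -lee_fin fineK//.
    apply: le_trans (nneseries_lim_ge k.+1 _); last by move=> *; exact: phi0.
    rewrite big_nat_recr//= leeDr// sume_ge0//.
  have cE (u : nat -> R) : cvgn u -> u k @[k --> \oo] --> fine (limn_esup (fun k => (u k)%:E)).
    move=> cu; have cu' : (u k)%:E @[k --> \oo] --> (limn u)%:E by apply: cvg_EFin => //; exact: nearW.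
    rewrite is_cvg_limn_esupE; last by apply/cvg_ex; exists (limn u)%:E.
    by rewrite (cvg_lim _ cu').
  split; apply: cE; apply: (@fast_cvg _ (fine (Phi x) / `|r x|)) => k;
    apply: le_trans (bound k); rewrite ler_pM2l ?exprn_gt0// /nsq ReB ImB.
    by rewrite lerDl sqr_ge0.
  by rewrite lerDr sqr_ge0.
have tail k m : qf (L2_dot r) (v (k + m)%N - v k) <= 4 * 4^-1 ^+ k.
  have t : nm (v (k + m)%N - v k) <= 2 * (2^-1 ^+ k - 2^-1 ^+ (k + m)).
    elim: m => [|m IH]; first by rewrite addn0 !subrr mulr0 /hnorm -/(qf _ _) qf0// sqrtr0.
    rewrite addnS (le_trans (hnormD3 nH _ (v (k + m)%N) _))//.
    apply: le_trans (lerD (vP _) IH) _; rewrite exprS; lra.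
  rewrite -(sqr_hnorm nH) (_ : 4 * 4^-1 ^+ k = (2 * 2^-1 ^+ k) ^+ 2); last first.
    by rewrite exprMn -exprM mulnC exprM (_ : 2^-1 ^+ 2 = 4^-1); field.
  rewrite ler_pXn2r ?nnegrE ?hnorm_ge0 ?mulr_ge0 ?exprn_ge0// (le_trans t)//.
  by rewrite ler_pM2l// lerBlDr lerDl exprn_ge0.
(* Fatou's lemma along [m] hands the bound [tail] on to the limit function. *)
have fatou_v k : (\int[mu]_x (dist2 f (v k) x)%:E <= (4 * 4^-1 ^+ k)%:E)%E.
  pose psi m x := (dist2 (v (k + m)%N) (v k) x)%:E.
  have mpsi m : measurable_fun setT (psi m) by apply/measurable_EFinP; exact: mdist2.
  have psi0 m x : (0 <= psi m x)%E by rewrite lee_fin dist2_ge0.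
  have -> : (\int[mu]_x (dist2 f (v k) x)%:E = \int[mu]_x limn_einf (psi ^~ x))%E.
    apply: ae_eq_integral => //.
    - by apply/measurable_EFinP; exact: mdist2.
    - rewrite /limn_einf; apply: measurableT_comp => //.
      apply: (@measurable_fun_limn_esup _ _ R setT (fun m x => - psi m x)%E) => m.
      exact: measurableT_comp (mpsi m).
    apply: filterS cvgf => x [cR cI] _.
    have c : psi m x @[m --> \oo] --> (dist2 f (v k) x)%:E.
      have sh (u : nat -> R) l : u m @[m --> \oo] --> l -> u (k + m)%N @[m --> \oo] --> l.
        move=> ul; have -> : (fun m => u (k + m)%N) = (fun m => u (m + k)%N).
          by apply/funext => m; rewrite addnC.
        by rewrite cvg_shiftn.
      pose d (a b : R) := (a - b) * (a - b).
      have -> : psi ^~ x = EFin \o (fun m => (d (Re (v (k + m)%N x)) (Re (v k x)) +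
          d (Im (v (k + m)%N x)) (Im (v k x))) * `|r x|).
        by apply/funext => m; rewrite /psi /dist2 /nsq ReB ImB !expr2.
      have -> : dist2 f (v k) x = (d (fR x) (Re (v k x)) + d (fI x) (Im (v k x))) * `|r x|.
        by rewrite /dist2 /nsq ReB ImB !expr2.
      apply: cvg_EFin; first exact: nearW.
      apply: cvgM; last exact: cvg_cst.
      have dc (u : nat -> R) l (b : R) : u m @[m --> \oo] --> l ->
          d (u (k + m)%N) b @[m --> \oo] --> d l b.
        by move=> /sh ul; apply: cvgM; apply: cvgB => //; exact: cvg_cst.
      apply: cvgD; first exact: (dc (fun m => Re (v m x)) _ _ cR).
      exact: (dc (fun m => Im (v m x)) _ _ cI).
    by rewrite is_cvg_limn_einfE ?(cvg_lim _ c)//; apply/cvg_ex; exists (dist2 f (v k) x)%:E.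
  apply: le_trans (fatou mu measurableT mpsi (fun m x _ => psi0 m x)) _.
  rewrite limn_einf_lim; apply: lime_le; first exact: is_cvg_einfs.
  near=> m; apply: (@le_trans _ _ (\int[mu]_x psi m x)%E).
    by apply: ereal_inf_lbound; exists m => /=.
  by rewrite -qf_dist2 lee_fin.
have Lf : L2_fun_prop r f.
  have Ld : L2_fun_prop r (f - (v 0%N : R -> R[i])).
    split.
    - by rewrite (_ : (fun x => _) = (fR \- (fun x => Re (v 0%N x)))); [exact: measurable_funB|apply/funext => x; rewrite !fctE ReB].
    - by rewrite (_ : (fun x => _) = (fI \- (fun x => Im (v 0%N x)))); [exact: measurable_funB|apply/funext => x; rewrite !fctE ImB].
    - rewrite (_ : (fun x => _) = (EFin \o dist2 f (v 0%N))); last first.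
        by apply/funext => x; rewrite /= !fctE normc2E.
      apply/integrableP; split; first by apply/measurable_EFinP; exact: mdist2.
      rewrite (_ : (fun x => _) = (fun x => (dist2 f (v 0%N) x)%:E)); last first.
        by apply/funext => x /=; rewrite ger0_norm// dist2_ge0.
      exact: le_lt_trans (fatou_v 0%N) (ltry _).
  rewrite -[f](subrK (v 0%N : R -> R[i])).
  by apply: L2_fun_propD => //; exact: L2_prop.
have [F FE] := L2_mk Lf; exists F.
have qk k : nm (v k - F) <= 2 * 2^-1 ^+ k.
  rewrite hnormB// -(ler_pXn2r (n := 2)) ?nnegrE ?hnorm_ge0 ?mulr_ge0 ?exprn_ge0//.
  rewrite (sqr_hnorm nH) (_ : (2 * 2^-1 ^+ k) ^+ 2 = 4 * 4^-1 ^+ k); last first.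
    by rewrite exprMn -exprM mulnC exprM (_ : 2^-1 ^+ 2 = 4^-1); field.
  rewrite -lee_fin qf_dist2 (le_trans _ (fatou_v k))//.
  rewrite le_eqVlt; apply/orP; left; apply/eqP; apply: ae_eq_integral => //.
  - by apply/measurable_EFinP; apply: mdist2; (exact: mRe || exact: mIm).
  - by apply/measurable_EFinP; exact: mdist2.
  by apply: filterS FE => x E _; rewrite /dist2 E.
apply: (@squeeze_cvgr _ _ _ _ (fun=> 0) (fun k => geometric 2 2^-1 k)).
- by apply: nearW => k; rewrite hnorm_ge0 /geometric /= qk.
- exact: cvg_cst.
- by apply: cvg_geometric; rewrite ger0_norm; lra.
Unshelve. all: by end_near. Qed.

Lemma L2_fast_complete : fast_complete (L2_dot r).
Proof. exact: L2_fast_limit. Qed.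

End L2Complete.

(** * Sturm-Liouville systems *)

Section Primitives.
Variable R : realType.
Local Notation mu := (@lebesgue_measure R).
Implicit Types (f g h k u w : R -> R) (a b x y z : R).

Let aeF : Filter (nbhs (almost_everywhere mu)).
Proof. exact: (ae_filter_ringOfSetsType mu). Qed.
Hint Extern 0 (Filter _) => exact: aeF : typeclass_instances.

Lemma rac_continuous f : (forall a b, rac a b f) -> continuous f.
Proof.
move=> fac x; apply/cvgrPdist_lt => e e0.
have [d d0 dP] := fac (x - 1) (x + 1) e e0.
have sm s t : x - 1 <= s -> s < t -> t <= x + 1 -> t - s < d -> `|f t - f s| < e.
  move=> h1 h2 h3 h4; have := dP [:: (s, t)]; rewrite !big_seq1 /=; apply => //.
  by rewrite /subitv /= h1 h2 h3.
have d1 : 0 < Num.min 1 d by rewrite lt_min ltr01.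
apply: filterS (near_oo (_ : x - Num.min 1 d < x) (_ : x < x + Num.min 1 d)); last 2 first.
- by rewrite ltrBlDr ltrDl.
- by rewrite ltrDl.
move=> y /andP[h1 h2]; have m1 : Num.min 1 d <= 1 by rewrite ge_min lexx.
have m2 : Num.min 1 d <= d by rewrite ge_min lexx orbT.
have [xy|yx|->] := ltgtP x y; last by rewrite subrr normr0.
  by rewrite distrC; apply: sm; lra.
by apply: sm; lra.
Qed.

Lemma continuous_measurable f : continuous f -> measurable_fun setT f.
Proof. exact: continuous_measurable_fun. Qed.

Lemma Rint_add k x y z : locally_integrable setT k -> x <= y -> y <= z ->
  \int[mu]_(t in `[x, z]) k t = \int[mu]_(t in `[x, y]) k t + \int[mu]_(t in `[y, z]) k t.
Proof.
move=> lk xy yz; have ik a b := locally_integrable_itv a b lk.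
have i1 : mu.-integrable `]y, z] (EFin \o k).
  by apply: integrableS (ik y z) => //; exact: subset_itv_oc_cc.
rewrite -(Rintegral_itv_obnd_cbnd i1) -(@Rintegral_itvB _ k (BLeft x) (BRight z) y)//.
by rewrite addrC subrK.
Qed.

Lemma Rint_point k x : \int[mu]_(t in `[x, x]) k t = 0.
Proof. by rewrite set_itv1 Rintegral_set1. Qed.

Lemma Rint_empty k x y : y < x -> \int[mu]_(t in `[x, y]) k t = 0.
Proof.
by move=> yx; rewrite set_itv_ge ?Rintegral_set0// bnd_simp -ltNge.
Qed.

(** The signed integral from 0 to [x]; of the two terms at least one extends over an empty interval
    or a point and vanishes. *)
Definition prim k x := \int[mu]_(t in `[0, x]) k t - \int[mu]_(t in `[x, 0]) k t.

Lemma prim_pos k x : 0 <= x -> prim k x = \int[mu]_(t in `[0, x]) k t.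
Proof.
rewrite le_eqVlt => /predU1P[<-|x0]; first by rewrite /prim Rint_point subr0.
by rewrite /prim (Rint_empty _ x0) subr0.
Qed.

Lemma prim_neg k x : x <= 0 -> prim k x = - \int[mu]_(t in `[x, 0]) k t.
Proof.
rewrite le_eqVlt => /predU1P[->|x0]; first by rewrite /prim Rint_point sub0r.
by rewrite /prim (Rint_empty _ x0) sub0r.
Qed.

Lemma prim_primitive k : locally_integrable setT k -> primitive (prim k) k.
Proof.
move=> lk x y xy; have [x0|x0] := leP 0 x.
  by rewrite !prim_pos ?(le_trans x0)// (Rint_add lk x0 xy) addrC addKr.
have [y0|y0] := leP 0 y.
  by rewrite (prim_pos _ y0) (prim_neg _ (ltW x0)) opprK (Rint_add lk (ltW x0) y0) addrC.
rewrite !prim_neg ?(ltW x0) ?(ltW y0)// (Rint_add lk xy (ltW y0)); ring.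
Qed.

Lemma primitive_continuous f k : locally_integrable setT k -> primitive f k -> continuous f.
Proof. by move=> lk fk; apply: rac_continuous => a b; exact: primitive_rac fk. Qed.

Lemma primitiveE f k : locally_integrable setT k -> primitive f k <->
  forall x, f x = f 0 + prim k x.
Proof.
move=> lk; split=> [fk x|fE x y xy].
  have [x0|/ltW x0] := leP 0 x.
    by rewrite prim_pos// -fk// addrC subrK.
  by rewrite prim_neg// -fk//; ring.
by rewrite -prim_primitive// (fE x) (fE y); ring.
Qed.

Lemma locally_integrable_le k h : locally_integrable setT k -> measurable_fun setT h ->
  (forall x, `|h x| <= `|k x|) -> locally_integrable setT h.
Proof.
move=> [mk oT kK] mh hk; split=> // K KT cK; apply: le_lt_trans (kK K KT cK).
have mK : measurable K by exact: compact_measurable.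
apply: ge0_le_integral => //.
- by apply/measurable_EFinP; apply: measurableT_comp => //; exact: measurable_funTS.
- by apply/measurable_EFinP; apply: measurableT_comp => //; exact: measurable_funTS.
- by move=> x _; rewrite lee_fin.
Qed.

Lemma locally_integrableM u k : continuous u -> locally_integrable setT k ->
  locally_integrable setT (fun x => u x * k x).
Proof.
move=> cu [mk oT kK]; have mu' := continuous_measurable cu.
have muk : measurable_fun setT (fun x => u x * k x) by exact: measurable_funM.
split=> // K KT cK.
have mK : measurable K by exact: compact_measurable.
have [M0 [_ /(_ (`|M0| + 1))uM]] : bounded_set (u @` K).
  apply: compact_bounded; apply: continuous_compact => //.
  exact: continuous_subspaceT.
pose M := `|M0| + 1.
have M_ge0 : 0 <= M by rewrite addr_ge0.
apply: (@le_lt_trans _ _ (\int[mu]_(x in K) (M%:E * `|(k x)%:E|))%E).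
  apply: ge0_le_integral => //.
  - by apply/measurable_EFinP; apply: measurableT_comp => //; exact: measurable_funTS.
  - apply: measurable_funeM; apply: measurableT_comp => //; apply/measurable_EFinP.
    exact: measurable_funTS.
  - move=> x Kx; rewrite /= -EFinM lee_fin normrM ler_wpM2r//.
    apply: uM; last by exists x.
    by rewrite (le_lt_trans (ler_norm M0))// ltrDl.
rewrite ge0_integralZl_EFin//; last first.
  apply: measurableT_comp => //; apply/measurable_EFinP; exact: measurable_funTS.
by rewrite lte_mul_pinfty ?lee_fin// kK.
Qed.

Lemma small_integral k a b e : locally_integrable setT k -> 0 < e ->
  exists2 d, 0 < d & forall x y, a <= x -> x <= y -> y <= b -> y - x < d ->
    \int[mu]_(t in `[x, y]) k t < e.
Proof.
move=> lk e0; have [d d0 dP] := primitive_rac a b lk (prim_primitive lk) e0.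
exists d => // x y ax; rewrite le_eqVlt => /predU1P[<-|xy] yb yx.
  by rewrite Rint_point.
have := dP [:: (x, y)]; rewrite !big_seq1 /= (prim_primitive lk (ltW xy)).
rewrite /subitv /= ax xy yb => /(_ isT isT yx); apply: le_lt_trans.
exact: ler_norm.
Qed.

(* On an interval where the integral of [|k1| + |k2|] is below 1/2, the maximum
   of [|f| + |u|] is at most half of itself. *)
Lemma gronwall0 f u k1 k2 : locally_integrable setT k1 -> locally_integrable setT k2 ->
  continuous f -> continuous u ->
  primitive f (fun x => u x * k1 x) -> primitive u (fun x => f x * k2 x) ->
  f 0 = 0 -> u 0 = 0 -> forall x, 0 <= x -> f x = 0.
Proof.
move=> l1 l2 cf cu pf pu f0 u0 b b0.
pose k x := `|k1 x| + `|k2 x|.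
have n g : locally_integrable setT g -> locally_integrable setT (fun x => `|g x|).
  move=> lg; apply: (locally_integrable_le lg).
    by apply: measurableT_comp => //; case: lg.
  by move=> x; rewrite normr_id.
have lk : locally_integrable setT k by apply: locally_integrableD; exact: n.
have e0 : 0 < 2^-1 :> R by rewrite invr_gt0.
have [d d0 dP] := small_integral 0 b lk e0.
have step x y : 0 <= x -> x <= y -> y <= b -> y - x < d -> f x = 0 -> u x = 0 ->
    forall t, x <= t -> t <= y -> f t = 0 /\ u t = 0.
  move=> x0 xy yb yx fx ux.
  pose m t := `|f t| + `|u t|.
  have cm : continuous m.
    by move=> t; apply: cvgD; apply: cvg_norm; [exact: cf|exact: cu].
  have [c cxy mc] := EVT_max xy (continuous_subspaceT cm).
  move: cxy; rewrite in_itv /= => /andP[xc cy].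
  have mle t : x <= t -> t <= c -> m t <= m c.
    by move=> xt tc; apply: mc; rewrite in_itv /= xt (le_trans tc).
  have m_ge0 : 0 <= m c by rewrite addr_ge0.
  have bnd g w kk : (forall t, x <= t -> t <= c -> `|w t| <= m c) ->
      locally_integrable setT kk -> continuous w ->
      primitive g (fun t => w t * kk t) -> g x = 0 ->
      `|g c| <= m c * \int[mu]_(t in `[x, c]) `|kk t|.
    move=> wm lkk cw pg gx; have := pg _ _ xc; rewrite gx subr0 => ->.
    have iw := locally_integrable_itv x c (locally_integrableM cw lkk).
    have ik := locally_integrable_itv x c lkk.
    have ink : mu.-integrable `[x, c] (EFin \o (fun t => `|kk t|)) by exact: integrable_norm.
    rewrite (le_trans (le_normr_Rintegral _ _))// -RintegralZl//.
    apply: le_Rintegral => //.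
    - exact: integrable_norm.
    - apply: locally_integrable_itv.
      by apply: (@locally_integrableM (cst (m c))); [exact: cst_continuous|exact: n].
    - move=> t; rewrite /= in_itv /= => /andP[xt tc].
      by rewrite normrM ler_wpM2r// wm.
  have h1 : m c <= m c * \int[mu]_(t in `[x, c]) k t.
    have ik g : locally_integrable setT g -> mu.-integrable `[x, c] (EFin \o (fun t => `|g t|)).
      by move=> lg; apply: integrable_norm => //; exact: locally_integrable_itv.
    rewrite [X in _ * X](_ : _ = \int[mu]_(t in `[x, c]) `|k1 t| + \int[mu]_(t in `[x, c]) `|k2 t|); last first.
      by rewrite -RintegralD//; exact: ik.
    rewrite mulrDr; apply: lerD.
      apply: (bnd f u) => // t xt tc; rewrite (le_trans _ (mle t xt tc))//.
      by rewrite lerDr.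
    apply: (bnd u f) => // t xt tc; rewrite (le_trans _ (mle t xt tc))//.
    by rewrite lerDl.
  have h2 : \int[mu]_(t in `[x, c]) k t < 2^-1.
    by apply: dP => //; lra.
  have mc0 : m c <= 0.
    rewrite leNgt; apply/negP => mp; move: h1; rewrite leNgt => /negP; apply.
    rewrite -[ltRHS]mulr1 ltr_pM2l//; lra.
  move=> t xt ty; have : m t <= 0.
    by apply: le_trans mc0; apply: mc; rewrite in_itv /= xt ty.
  rewrite /m => mt; have := normr_ge0 (f t); have := normr_ge0 (u t) => hu hf.
  by split; apply/eqP; rewrite -normr_le0; lra.
have zero (j : nat) : forall t, 0 <= t -> t <= b -> t <= j%:R * (d / 2) -> f t = 0 /\ u t = 0.
  elim: j => [|j IH] t t0 tb tj.
    have -> : t = 0 by move: tj; rewrite mul0r; lra.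
    by [].
  have [tl|tg] := leP t (j%:R * (d / 2)); first exact: IH.
  have jd : 0 <= j%:R * (d / 2) by rewrite mulr_ge0//; lra.
  have [fj uj] := IH _ jd (le_trans (ltW tg) tb) (lexx _).
  apply: (step (j%:R * (d / 2)) t) => //; try exact: ltW.
  by move: tj; rewrite -natr1 mulrDl mul1r; lra.
have [] := zero (Num.truncn (b / (d / 2))).+1 b b0 (lexx _) _ => //.
by rewrite -ler_pdivrMr ?divr_gt0// ltW// truncnS_gt.
Qed.

(** By uniqueness of Lebesgue measure it suffices to compare the two measures on half-open
    intervals. *)
Lemma mu_opp (A : set R) : measurable A -> mu (-%R @^-1` A) = mu A.
Proof.
have mo : measurable_fun setT (-%R : measurableTypeR R -> measurableTypeR R).
  exact: oppr_measurable.
pose nu := measure_function_pushforward__canonical__measure_function_Measure mu mo.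
move=> mA; apply/esym/(@lebesgue_measure_unique R nu) => // X /ocitvP[->|].
  by rewrite !measure0.
move=> [[a b] /= ab ->]; rewrite /nu /pushforward.
have -> : -%R @^-1` `]a, b] = `[- b, - a[%classic.
  apply/seteqP; split=> x /=; rewrite !in_itv /= => /andP[h1 h2]; apply/andP; split; lra.
by rewrite !lebesgue_measure_itv /= !lte_fin ltrN2 ab -!EFinB opprK addrC.
Qed.

Lemma ae_opp (P : R -> Prop) : {ae mu, forall x, P x} -> {ae mu, forall x, P (- x)}.
Proof.
have mo : measurable_fun setT (-%R : measurableTypeR R -> measurableTypeR R).
  exact: oppr_measurable.
move=> [A [mA A0 PA]]; exists (-%R @^-1` A); split.
- by rewrite -[X in measurable X]setTI; exact: mo.
- by rewrite mu_opp.
- by move=> x /= nP; apply: PA.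
Qed.

Lemma ge0_integral_opp (D : set R) (f : R -> \bar R) : measurable D ->
  measurable_fun D f -> (forall x, D x -> (0 <= f x)%E) ->
  (\int[mu]_(x in -%R @^-1` D) f (- x)%R = \int[mu]_(x in D) f x)%E.
Proof.
have mo : measurable_fun setT (-%R : measurableTypeR R -> measurableTypeR R).
  exact: oppr_measurable.
move=> mD mf f0.
rewrite -(@ge0_integral_pushforward _ _ _ _ _ _ mo mu D f)//; last first.
  by move=> x /set_mem; exact: f0.
apply: eq_measure_integral => A mA _. exact: mu_opp.
Qed.

Lemma Rint_opp_set (D : set R) k : measurable D -> measurable_fun setT k ->
  \int[mu]_(t in -%R @^-1` D) k (- t) = \int[mu]_(t in D) k t.
Proof.
move=> mD mk; rewrite /Rintegral; congr fine.
have mf : measurable_fun D (fun t => (k t)%:E).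
  by apply/measurable_EFinP; exact: measurable_funTS.
rewrite [LHS]integralE [RHS]integralE; congr (_ - _)%E.
  have p0 z : D z -> (0 <= (fun t => (k t)%:E)^\+%E z)%E by [].
  rewrite -(ge0_integral_opp mD (measurable_funepos mf) p0).
  by apply: eq_integral => z _; rewrite !funeposE.
have n0 z : D z -> (0 <= (fun t => (k t)%:E)^\-%E z)%E by [].
rewrite -(ge0_integral_opp mD (measurable_funeneg mf) n0).
by apply: eq_integral => z _; rewrite !funenegE.
Qed.

Lemma Rint_opp k x y : measurable_fun setT k ->
  \int[mu]_(t in `[x, y]) k (- t) = \int[mu]_(t in `[- y, - x]) k t.
Proof.
move=> mk; have := @Rint_opp_set `[- y, - x]%classic k (measurable_itv _) mk.
rewrite (_ : -%R @^-1` _ = `[x, y]%classic)//.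
apply/seteqP; split=> t /=; rewrite !in_itv /= => /andP[h1 h2]; apply/andP; split; lra.
Qed.

Lemma Rint_oppT k : measurable_fun setT k ->
  \int[mu]_t k (- t) = \int[mu]_t k t.
Proof. by move=> mk; rewrite -[RHS]Rint_opp_set. Qed.

Lemma Rint_N k x y : locally_integrable setT k ->
  \int[mu]_(t in `[x, y]) - k t = - \int[mu]_(t in `[x, y]) k t.
Proof.
move=> lk; have ik := locally_integrable_itv x y lk.
under eq_Rintegral do rewrite -mulN1r.
by rewrite RintegralZl// mulN1r.
Qed.

Lemma locally_integrable_opp k : locally_integrable setT k ->
  locally_integrable setT (fun x => k (- x)).
Proof.
have mo : measurable_fun setT (-%R : measurableTypeR R -> measurableTypeR R).
  exact: oppr_measurable.
move=> [mk _ kK]; split; [exact: measurableT_comp|exact: openT|].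
move=> K _ cK.
have cK' : compact (-%R @^-1` K).
  have -> : -%R @^-1` K = -%R @` K.
    by apply/seteqP; split=> x /=; [exists (- x)|case=> z Kz <-]; rewrite ?opprK.
  by apply: continuous_compact => //; apply: continuous_subspaceT; exact: opp_continuous.
have mK : measurable K by exact: compact_measurable.
have mK' : measurable (-%R @^-1` K) by exact: compact_measurable.
have := kK _ (@subsetT _ _) cK'; congr (_ < _)%E.
rewrite -(@ge0_integral_opp (-%R @^-1` K) (fun x => `|k x|%:E))//.
  by rewrite (_ : -%R @^-1` (-%R @^-1` K) = K)//; apply/seteqP; split=> x /=; rewrite opprK.
by apply/measurable_EFinP; apply: measurableT_comp => //; exact: measurable_funTS.
Qed.

Lemma primitive_opp f k : locally_integrable setT k -> primitive f k ->
  primitive (fun x => f (- x)) (fun x => - k (- x)).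
Proof.
move=> lk fk x y xy; have := fk (- y) (- x); rewrite lerN2 => /(_ xy).
have [mk _ _] := lk.
rewrite -Rint_opp// Rint_N; first by move=> <-; rewrite opprB.
exact: locally_integrable_opp.
Qed.

Lemma primitive_ae_eq f k h : locally_integrable setT k -> measurable_fun setT h ->
  {ae mu, forall x, k x = h x} -> primitive f k -> primitive f h.
Proof.
move=> lk mh kh fk x y xy; rewrite (fk _ _ xy).
apply: (integrable_ae_eq (measurable_itv _) _ (locally_integrable_itv x y lk) _).2.
  exact: measurable_funTS.
by apply: filterS kh.
Qed.

Lemma locally_integrable_ae_eq k h : locally_integrable setT k -> measurable_fun setT h ->
  {ae mu, forall x, k x = h x} -> locally_integrable setT h.
Proof.
move=> lk mh kh; split=> //; first exact: openT.
move=> K KT cK; case: (lk) => mk _ /(_ K KT cK).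
have mK : measurable K by exact: compact_measurable.
suff -> : (\int[mu]_(x in K) `|k x|%:E = \int[mu]_(x in K) `|h x|%:E)%E by [].
apply: ae_eq_integral => //.
- by apply/measurable_EFinP; apply: measurableT_comp => //; exact: measurable_funTS.
- by apply/measurable_EFinP; apply: measurableT_comp => //; exact: measurable_funTS.
by apply: filterS kh => x -> _.
Qed.

Lemma continuous_ae_eq f g : continuous f -> continuous g ->
  {ae mu, forall x, f x = g x} -> f = g.
Proof.
move=> cf cg [N [mN N0 fgN]]; apply/funext => x; apply: contrapT => fg.
have : \forall y \near x, f y - g y != 0.
  have c : (fun y => f y - g y) y @[y --> x] --> f x - g x.
    by apply: cvgB; [exact: cf|exact: cg].
  have d0 : 0 < `|f x - g x| by rewrite normr_gt0 subr_eq0; apply/eqP.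
  move/cvgrPdist_lt : c => /(_ _ d0); apply: filterS => y /=.
  by apply: contraPneq => ->; rewrite subr0 ltxx.
move=> /nbhs_ballP[e /= e0 eP].
have bN : ball x e `<=` N.
  move=> y /eP; rewrite subr_eq0 => /eqP h; exact: fgN.
have : (mu (ball x e) <= mu N)%E.
  by apply: le_measure; rewrite ?inE//; exact: measurable_ball.
rewrite N0 (@lebesgue_measure_ball R x e (ltW e0)) lee_fin leNgt.
by rewrite mulrn_wgt0.
Qed.

End Primitives.

(** * The Sturm-Liouville equation as a first order system for [f] and [p f'] *)

Section SL.
Variables (R : realType) (r p q : R -> R).
Local Notation mu := (@lebesgue_measure R).
Hypotheses (r_loc : locally_integrable setT r)
  (p_loc : locally_integrable setT (fun x => (p x)^-1))
  (q_loc : locally_integrable setT q)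
  (p_gt0 : {ae mu, forall x, 0 < p x}) (r0 : {ae mu, forall x, r x != 0})
  (p_even : {ae mu, forall x, p x = p (- x)})
  (q_even : {ae mu, forall x, q x = q (- x)})
  (r_odd : {ae mu, forall x, r x = - r (- x)}).
Local Notation Re := complex.Re.
Local Notation Im := complex.Im.
Implicit Types (f u h k : R -> R).

Let aeF : Filter (nbhs (almost_everywhere mu)).
Proof. exact: (ae_filter_ringOfSetsType mu). Qed.
Hint Extern 0 (Filter _) => exact: aeF : typeclass_instances.

Let nr_loc : locally_integrable setT (fun x => `|r x|).
Proof.
apply: (locally_integrable_le r_loc) => [|x]; last by rewrite normr_id.
by apply: measurableT_comp => //; case: r_loc.
Qed.

(* [u] is [p f'] and [h] is [l f]. *)
Definition sl_system f u h :=
  [/\ continuous f, continuous u, primitive f (fun x => u x * (p x)^-1) &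
      primitive u (fun x => f x * q x - `|r x| * h x)].

Local Notation lrh h := (locally_integrable setT (fun x => `|r x| * h x)).

Lemma sl_loc f h : continuous f -> lrh h ->
  locally_integrable setT (fun x => f x * q x - `|r x| * h x).
Proof. by move=> cf lh; apply: locally_integrableB => //; exact: locally_integrableM. Qed.

Lemma primitive_N f k : locally_integrable setT k -> primitive f k ->
  primitive (fun x => - f x) (fun x => - k x).
Proof. by move=> lk fk x y xy; rewrite Rint_N// -fk// opprB opprK addrC. Qed.

Lemma lrh_opp h : lrh h -> measurable_fun setT h -> lrh (fun x => h (- x)).
Proof.
move=> lh mh; apply: (locally_integrable_ae_eq (locally_integrable_opp lh)).
  apply: measurable_funM; first by case: nr_loc.
  by apply: measurableT_comp => //; exact: oppr_measurable.
by apply: filterS r_odd => x /= ->; rewrite normrN.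
Qed.

(** The coefficients [p], [q] and [|r|] are even, and [p f'] changes its sign under reflection. *)
Lemma sl_opp f u h : lrh h -> measurable_fun setT h -> sl_system f u h ->
  sl_system (fun x => f (- x)) (fun x => - u (- x)) (fun x => h (- x)).
Proof.
move=> lh mh [cf cu pf pu].
have co g : continuous g -> continuous (fun x : R => g (- x)).
  move=> cg x; have h1 : - y @[y --> x] --> - x by exact: opp_continuous.
  exact: (cvg_comp _ _ h1 (cg (- x))).
have cu' : continuous (fun x => - u (- x)).
  by move=> x; apply: cvgN; exact: co.
split=> //; first exact: co.
  have lk := locally_integrableM cu p_loc.
  apply: (primitive_ae_eq _ _ _ (primitive_opp lk pf)).
  - exact: locally_integrableN (locally_integrable_opp lk).
  - by have [] := locally_integrableM cu' p_loc.
  - by apply: filterS p_even => x ->; rewrite mulNr.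
have lk := sl_loc cf lh.
have := primitive_N (locally_integrableN (locally_integrable_opp lk)) (primitive_opp lk pu).
apply: primitive_ae_eq.
- apply: locally_integrableN; exact: locally_integrableN (locally_integrable_opp lk).
- by have [] := sl_loc (co _ _ cf) (lrh_opp lh mh).
by apply: filterS2 q_even r_odd => x -> ->; rewrite opprK normrN.
Qed.

Lemma measurable_sgr : measurable_fun setT (@Num.sg R).
Proof.
have -> : @Num.sg R = (fun x => if 0 < x then 1 else if x < 0 then -1 else 0).
  by apply/funext => x; case: sgrP.
apply: measurable_fun_ifT => //; first exact: measurable_fun_ltr.
apply: measurable_fun_ifT => //; exact: measurable_fun_ltr.
Qed.

Lemma sg_loc k : locally_integrable setT k ->
  locally_integrable setT (fun x => Num.sg x * k x).
Proof.
move=> lk; apply: (locally_integrable_le lk).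
  apply: measurable_funM; last by case: lk.
  exact: measurable_sgr.
by move=> x; rewrite normrM normr_sg; case: eqP => _; rewrite ?mul0r ?mul1r.
Qed.

(** The sign is constant between 0 and [x]; passing to half-open intervals removes the point 0,
    where it is neither 1 nor -1. *)
Lemma prim_sg k x : locally_integrable setT k ->
  prim (fun t => Num.sg t * k t) x = Num.sg x * prim k x.
Proof.
move=> lk; have [x0|x0|<-] := ltgtP 0 x.
- rewrite !prim_pos ?ltW// gtr0_sg// mul1r.
  have i1 h : locally_integrable setT h -> mu.-integrable `]0, x] (EFin \o h).
    move=> lh; apply: integrableS (locally_integrable_itv 0 x lh) => //.
    exact: subset_itv_oc_cc.
  rewrite -!Rintegral_itv_obnd_cbnd; [|exact: i1|exact/i1/sg_loc].
  apply: eq_Rintegral => t; rewrite inE /= in_itv /= => /andP[t0 _].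
  by rewrite gtr0_sg// mul1r.
- rewrite !prim_neg ?ltW// ltr0_sg// mulN1r opprK.
  have i1 h : locally_integrable setT h -> mu.-integrable `[x, 0[ (EFin \o h).
    move=> lh; apply: integrableS (locally_integrable_itv x 0 lh) => //.
    exact: subset_itv_co_cc.
  rewrite -!Rintegral_itv_bndo_bndc; [|exact: i1|exact/i1/sg_loc].
  rewrite -mulN1r -RintegralZl//; last exact/i1/sg_loc.
  apply: eq_Rintegral => t; rewrite inE /= in_itv /= => /andP[_ t0].
  by rewrite ltr0_sg// !mulN1r opprK.
- by rewrite /prim !Rint_point subrr sgr0 mul0r.
Qed.

(** The sign jumps only at 0, where [f] and [u] vanish, so the products remain absolutely
    continuous: a primitive that vanishes at 0 is [prim] of its derivative, and [prim_sg]
    applies. *)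
Lemma sl_sgn f u h : lrh h -> sl_system f u h -> f 0 = 0 -> u 0 = 0 ->
  sl_system (fun x => Num.sg x * f x) (fun x => Num.sg x * u x)
    (fun x => Num.sg x * h x).
Proof.
move=> lh [cf cu pf pu] f0 u0.
have lk1 := locally_integrableM cu p_loc.
have lk2 := sl_loc cf lh.
have sgp g k : locally_integrable setT k -> primitive g k -> g 0 = 0 ->
    primitive (fun x => Num.sg x * g x) (fun x => Num.sg x * k x).
  move=> lk pg g0; apply/(primitiveE _ (sg_loc lk)) => x.
  by rewrite g0 mulr0 add0r prim_sg// ((primitiveE g lk).1 pg x) g0 add0r.
have p1 := sgp _ _ lk1 pf f0; have p2 := sgp _ _ lk2 pu u0.
split.
- exact: primitive_continuous (sg_loc lk1) p1.
- exact: primitive_continuous (sg_loc lk2) p2.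
- by move: p1; congr (primitive _ _); apply/funext => x; rewrite mulrA.
- by move: p2; congr (primitive _ _); apply/funext => x; ring.
Qed.

(** For [h = l f] the system is homogeneous, with the coefficients [1 / p] and [q - l |r|], so
    [gronwall0] settles the right half-line; reflection gives the left one. *)
Lemma sl_uniq f u h (l : R) : lrh h -> measurable_fun setT h -> sl_system f u h ->
  {ae mu, forall x, h x = l * f x} -> f 0 = 0 -> u 0 = 0 -> f = fun=> 0.
Proof.
have pos f' u' h' : lrh h' -> sl_system f' u' h' ->
    {ae mu, forall x, h' x = l * f' x} -> f' 0 = 0 -> u' 0 = 0 ->
    forall x, 0 <= x -> f' x = 0.
  move=> lh [cf cu pf pu] hf f0 u0.
  have lk : locally_integrable setT (fun x => q x - l * `|r x|).
    apply: locally_integrableB => //.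
    by apply: (@locally_integrableM _ (cst l)) => //; exact: cst_continuous.
  have pu' : primitive u' (fun x => f' x * (q x - l * `|r x|)).
    apply: primitive_ae_eq pu; first exact: sl_loc.
      by have [] := locally_integrableM cf lk.
    by apply: filterS hf => x ->; ring.
  exact: (gronwall0 p_loc lk cf cu pf pu' f0 u0).
move=> lh mh sl hf f0 u0; apply/funext => x.
have [x0|/ltW x0] := leP 0 x; first exact: (pos f u h).
rewrite -[x]opprK; apply: (pos _ _ _ (lrh_opp lh mh) (sl_opp lh mh sl)).
- exact: ae_opp hf.
- by rewrite oppr0.
- by rewrite oppr0 u0 oppr0.
- by rewrite oppr_ge0.
Qed.

(** [|r| |G| <= |r| + |r| |G|^2], and both terms on the right are locally integrable. *)
Lemma lrh_L2 (G : L2 r) : lrh (fun x => Re (G x)) /\ lrh (fun x => Im (G x)).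
Proof.
have [mR mI /integrableP[mG Goo]] := L2_prop G.
have [mnr _ _] := nr_loc.
have lG : locally_integrable setT (fun x => normc (G x) ^+ 2 * `|r x|).
  by apply: open_integrable_locally; [exact: openT|apply/integrableP].
have lk := locally_integrableD nr_loc lG.
have dom (a b : R) (c : R) : 0 <= c -> a ^+ 2 <= b -> `|c * a| <= `|c + b * c|.
  move=> c0 ab; have b0 := le_trans (sqr_ge0 a) ab.
  rewrite normrM (ger0_norm c0) [leRHS]ger0_norm ?addr_ge0 ?mulr_ge0//.
  rewrite (_ : c + b * c = c * (1 + b)); last by ring.
  rewrite ler_wpM2l// (le_trans _ (lerD (lexx 1) ab))//.
  have := sqr_ge0 (`|a| - 1); rewrite sqrrB real_normK ?num_real// expr1n mulr1.
  have := normr_ge0 a; have := sqr_ge0 a; lra.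
split; apply: (locally_integrable_le lk) => [|x]; try exact: measurable_funM;
  by apply: dom => //; rewrite normc2E ?lerDl ?lerDr sqr_ge0.
Qed.

Lemma abs_continuous_rac (f : R -> R[i]) : loc_abs_continuous f ->
  (forall a b, rac a b (fun x => Re (f x))) /\ (forall a b, rac a b (fun x => Im (f x))).
Proof.
have nR (z : R[i]) : `|Re z| <= normc z.
  rewrite -(ler_pXn2r (n := 2)) ?nnegrE//; last by case: z => a b; exact: sqrtr_ge0.
  by rewrite normc2E -normrX ger0_norm ?sqr_ge0// lerDl sqr_ge0.
have nI (z : R[i]) : `|Im z| <= normc z.
  rewrite -(ler_pXn2r (n := 2)) ?nnegrE//; last by case: z => a b; exact: sqrtr_ge0.
  by rewrite normc2E -normrX ger0_norm ?sqr_ge0// lerDr sqr_ge0.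
move=> fac; split=> a b e e0; have [d d0 dP] := fac a b e e0; exists d => // s s1 s2 s3;
  apply: le_lt_trans (dP s s1 s2 s3); apply: ler_sum => I _;
  by rewrite -?ReB -?ImB.
Qed.

Lemma rac_abs_continuous (f1 f2 : R -> R) : (forall a b, rac a b f1) ->
  (forall a b, rac a b f2) -> loc_abs_continuous (fun x => f1 x +i* f2 x).
Proof.
move=> fac1 fac2 a b e e0; have e2 : 0 < e / 2 by rewrite divr_gt0.
have [d1 d10 dP1] := fac1 a b _ e2; have [d2 d20 dP2] := fac2 a b _ e2.
exists (Num.min d1 d2); first by rewrite lt_min d10.
move=> s s1 s2; rewrite lt_min => /andP[s3 s4].
have := dP1 s s1 s2 s3; have := dP2 s s1 s2 s4 => h2 h1.
apply: (@le_lt_trans _ _ (\sum_(I <- s) (`|f1 I.2 - f1 I.1| + `|f2 I.2 - f2 I.1|))).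
  have nab (c d : R) : normc (c +i* d) <= `|c| + `|d|.
    rewrite -(ler_pXn2r (n := 2)) ?nnegrE ?addr_ge0//; last exact: sqrtr_ge0.
    rewrite normc2E /= sqrrD !real_normK ?num_real//.
    by rewrite lerD2r lerDl mulrn_wge0// mulr_ge0.
  by apply: ler_sum => I _; exact: nab.
rewrite big_split /=; lra.
Qed.

(** The coefficients are real, so the definition splits into one system for the real parts and one
    for the imaginary parts. Equations that hold almost everywhere become integral equations by
    [ac_primitive], and conversely by [primitive_ae] and [primitive_rac]. *)
Lemma maximal_opP (F1 F2 : L2 r) : maximal_op r p q (F1, F2) <->
  exists f1 u1 f2 u2 : R -> R,
    [/\ sl_system f1 u1 (fun x => Re (F2 x)), sl_system f2 u2 (fun x => Im (F2 x)) &
        {ae mu, forall x, F1 x = f1 x +i* f2 x}].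
Proof.
have [lh1 lh2] := lrh_L2 F2.
split.
  move=> [f [u [fac uac /= F1f up F2u]]].
  have [fR fI] := abs_continuous_rac fac; have [uR uI] := abs_continuous_rac uac.
  exists (fun x => Re (f x)), (fun x => Re (u x)), (fun x => Im (f x)), (fun x => Im (u x)).
  have cfR := rac_continuous fR; have cfI := rac_continuous fI.
  have cuR := rac_continuous uR; have cuI := rac_continuous uI.
  split; last by apply: filterS F1f => x ->; case: (f x).
  - split=> // x y xy.
      have [m1 _ _] := locally_integrableM cuR p_loc.
      apply: (ac_primitive fR m1 _ xy).2.
      apply: filterS2 up p_gt0 => t ->; rewrite ReZ /= => pt.
      by rewrite mulrAC mulfV ?mul1r// gt_eqF.
    have [m1 _ _] := sl_loc cfR lh1.
    apply: (ac_primitive uR m1 _ xy).2.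
    apply: filterS2 F2u r0 => t -> rt; rewrite ReZ /= ReD ReN ReZ mulrA.
    by rewrite mulfV ?normr_eq0// mul1r mulrC opprD opprK addrC subrK.
  - split=> // x y xy.
      have [m1 _ _] := locally_integrableM cuI p_loc.
      apply: (ac_primitive fI m1 _ xy).2.
      apply: filterS2 up p_gt0 => t ->; rewrite ImZ /= => pt.
      by rewrite mulrAC mulfV ?mul1r// gt_eqF.
    have [m1 _ _] := sl_loc cfI lh2.
    apply: (ac_primitive uI m1 _ xy).2.
    apply: filterS2 F2u r0 => t -> rt; rewrite ImZ /= ImD ImN ImZ mulrA.
    by rewrite mulfV ?normr_eq0// mul1r mulrC opprD opprK addrC subrK.
move=> [f1 [u1 [f2 [u2 [[cf1 cu1 pf1 pu1] [cf2 cu2 pf2 pu2] F1f]]]]].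
exists (fun x => f1 x +i* f2 x), (fun x => u1 x +i* u2 x).
have l1 := locally_integrableM cu1 p_loc; have l2 := locally_integrableM cu2 p_loc.
have k1 := sl_loc cf1 lh1; have k2 := sl_loc cf2 lh2.
split=> //.
- by apply: rac_abs_continuous => a b; [exact: primitive_rac pf1|exact: primitive_rac pf2].
- by apply: rac_abs_continuous => a b; [exact: primitive_rac pu1|exact: primitive_rac pu2].
- apply: filterS3 p_gt0 (primitive_ae l1 pf1) (primitive_ae l2 pf2).
  move=> x px [_ d1] [_ d2].
  have p0 : p x != 0 by rewrite gt_eqF.
  by apply: complexE; rewrite ?ReZ ?ImZ /= ?d1 ?d2 mulrC mulfVK.
- apply: filterS3 r0 (primitive_ae k1 pu1) (primitive_ae k2 pu2).
  move=> x rx [_ d1] [_ d2].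
  have n0 : `|r x| != 0 by rewrite normr_eq0.
  by apply: complexE; rewrite ?ReZ ?ImZ ?ReD ?ImD ?ReN ?ImN ?ReZ ?ImZ /= ?d1 ?d2; field.
Qed.

End SL.

(** * Inverses of self-adjoint operators *)

Section SelfAdjoint.
Variables (R : realType) (H : lmodType R[i]) (n : H -> H -> R[i]).
Hypotheses (nH : hform n) (ndef : forall v, qf n v = 0 -> v = 0).
Hypothesis cmpl : fast_complete n.
Implicit Types (u v w f g : H) (S E J : H -> H) (k : R).

(* The solvability half of the Fredholm alternative for [S - k]. *)
Definition solvable S k := forall w,
  (forall u, S u = k%:C *: u -> n u w = 0) -> exists v, S v - k%:C *: v = w.

Lemma hform_eq0 u : (forall v, n u v = 0) -> u = 0.
Proof. by move=> u0; apply: ndef; rewrite /qf u0. Qed.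

(** [S E - k] acts as [S - k] on the range of the projection [E] and as [- k] on its kernel. An
    eigenvector [u] of [S] satisfies [E u = 0], as otherwise [E u] would be one of [S E]; hence
    [E w] is orthogonal to all such [u] and [solvable] applies to it. *)
Lemma alt_proj S E k : linear S -> gsym n S -> linear E -> gsym n E ->
  (forall v, E (E v) = E v) -> (forall v, S (E v) = E (S v)) -> k != 0 ->
  solvable S k -> ~ ev (S \o E) k -> binv (qf n) (shift (S \o E) k).
Proof.
move=> lS nS lE nE EE SE k0 solv nev.
have kC : k%:C != 0 :> R[i] by rewrite realc_eq0.
have inj v : S (E v) = k%:C *: v -> v = 0.
  by move=> Sv; apply: contrapT => /eqP v0; apply: nev; exists v.
apply: (sym_bij_binv nH ndef cmpl).
- by apply: linear_shift; exact: linear_comp.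
- by apply: gsym_shift => // u v /=; rewrite nS nE SE.
- by move=> v /eqP; rewrite subr_eq0 => /eqP; exact: inj.
move=> w; have [|v Sv] := solv (E w).
  move=> u Su; rewrite -nE (inj (E u)) ?hform0l//.
  by rewrite EE SE Su (linZ lE).
exists (E v - k^-1%:C *: (w - E w)).
rewrite /shift /= (linB lE) EE (linZ lE) (linB lE) EE subrr scaler0 subr0.
rewrite scalerBr opprB scalerA -realcM mulfV// scale1r SE.
by rewrite addrCA -(linZ lE) -(linB lE) Sv EE subrK.
Qed.

Lemma solvable_conj S J k : linear J -> gsym n J -> (forall v, J (J v) = v) ->
  solvable S k -> solvable (J \o S \o J) k.
Proof.
move=> lJ nJ JJ solv w wP; have [|v Sv] := solv (J w).
  move=> u Su; rewrite -nJ; apply: wP.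
  by rewrite /= JJ Su (linZ lJ).
by exists (J v); rewrite /= JJ -(linZ lJ) -(linB lJ) Sv JJ.
Qed.

(* If [c < 0] below, then [-N, -e] is a spectral gap, and [qf_gap] at its midpoint
   is violated by [v]. *)
Lemma psd_of_binv S : linear S -> gsym n S ->
  (forall k, k < 0 -> binv (qf n) (shift S k)) ->
  forall v, 0 <= complex.Re (n (S v) v).
Proof.
move=> lS nS inv v; rewrite leNgt; apply/negP; set c := complex.Re _ => c0.
have qv : 0 < qf n v.
  rewrite lt_neqAle (hform_ge0 nH) andbT; apply/eqP => /esym /ndef v0.
  by move: c0; rewrite /c v0 (lin0 lS) hform0l// ltxx.
have qS : 0 <= qf n (S v) by exact: (hform_ge0 nH).
(* Expanding the gap inequality with this [e] leaves [0 < qf n (S v) + N c / 2 + e c]. The choice of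
   [N] turns the right-hand side into [(e + 1) c / 2 + e c], which is negative. *)
pose e := - c / (2 * qf n v).
have e0 : 0 < e by rewrite divr_gt0 ?mulr_gt0// oppr_gt0.
have eE : e * qf n v = - c / 2 by rewrite /e; field; rewrite gt_eqF.
pose N := 2 * qf n (S v) / (- c) + e + 1.
have NE : (N - e - 1) * (- c) = 2 * qf n (S v).
  by rewrite /N; field; rewrite lt_eqF.
have N0 : e < N.
  rewrite /N -addrA ltr_wpDl//; last lra.
  by rewrite divr_ge0 ?mulr_ge0// oppr_ge0 ltW.
have nB w : qf n w <= 1 * qf n w by rewrite mul1r.
have h1 : 0 <= (N - e) / 2 by rewrite divr_ge0//; lra.
have := @qf_gap _ _ n (qf n) 1 nH nB (hform_ge0 nH) (shift S (- (N + e) / 2)) _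
  (linear_shift _ lS) (gsym_shift _ nH nS)
  (bdd_shift _ nH (hellinger_toeplitz nH ndef cmpl lS nS)) h1 _ v qv.
have sE m t : shift (shift S m) t = shift S (m + t).
  by apply/funext => u; rewrite /shift realcD scalerDl opprD addrA.
move=> gap; have {gap} : ((N - e) / 2) ^+ 2 * qf n v < qf n (shift S (- (N + e) / 2) v).
  by apply: gap => t /andP[t1 t2]; rewrite sE; apply: inv; lra.
rewrite /shift qfB// qfZr// hformZr// conjcR ReZ -/c.
have -> : ((N - e) / 2) ^+ 2 = (- (N + e) / 2) ^+ 2 - N * e by field.
rewrite mulrBl (_ : N * e * qf n v = N * (- c / 2)); last by rewrite -mulrA eE.
have ec : e * c < 0 by rewrite pmulr_rlt0.
move: NE; set m := _ ^+ 2 * _; lra.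
Qed.

Variable T : set (H * H).
Hypothesis Tsa : selfadjoint n T.

Lemma sa_sym f (f' : H) g (g' : H) : T (f, f') -> T (g, g') -> n f' g = n f g'.
Proof. by move=> Tf; rewrite {1}Tsa.2 => /(_ _ _ Tf). Qed.

(** Operators are mere sets of pairs; linearity comes from [T = adjoint T], since an adjoint is
    closed under linear combinations. *)
Lemma sa_lin a f (f' : H) g (g' : H) : T (f, f') -> T (g, g') ->
  T (a *: f + g, a *: f' + g').
Proof.
move=> Tf Tg; rewrite Tsa.2 => u w Tu /=.
by rewrite !hformDr// !hformZr// (sa_sym Tu Tf) (sa_sym Tu Tg).
Qed.

Lemma resolvent_eigen l : resolvent_set n T l -> ~ Defs.eigenvalue T l.
Proof.
move=> [bij _] [f [f0 Tf]]; have [g [_ uniq]] := bij 0.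
have z : T (0, 0) by have := sa_lin (-1) Tf Tf; rewrite !scaleN1r !addNr.
move/eqP: f0; apply; rewrite -(uniq f); last by exists (l *: f); rewrite /= subrr.
by apply: uniq; exists 0; rewrite /= scaler0 subr0.
Qed.

Hypothesis T0 : resolvent_set n T 0.

Lemma sa_inv_ex h : exists f, T (f, h).
Proof.
have [/(_ h)[f [[g /= [Tf E]] _]] _] := T0; exists f.
by rewrite E scale0r subr0.
Qed.

Definition sa_inv h := sval (cid (sa_inv_ex h)).

Lemma sa_invP h : T (sa_inv h, h).
Proof. exact: (svalP (cid (sa_inv_ex h))). Qed.

Lemma sa_inv_uniq f h : T (f, h) -> f = sa_inv h.
Proof.
have sh f' : T (f', h) -> op_shift T 0 (f', h).
  by move=> Tf; exists h; rewrite /= scale0r subr0.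
move=> Tf; have [/(_ h)[f0 [_ uniq]] _] := T0.
by rewrite -(uniq _ (sh _ Tf)) -(uniq _ (sh _ (sa_invP h))).
Qed.

Lemma sa_inv_linear : linear sa_inv.
Proof.
by move=> a u v; apply/esym/sa_inv_uniq/sa_lin; exact: sa_invP.
Qed.

Lemma sa_inv_sym : gsym n sa_inv.
Proof. by move=> u v; rewrite -(sa_sym (sa_invP u) (sa_invP v)). Qed.

Local Notation K := sa_inv.
Let lK := sa_inv_linear.

Lemma sa_eigen (l : R) f : T (f, l%:C *: f) <-> f = l%:C *: K f.
Proof.
split=> [/sa_inv_uniq|{1}->]; first by rewrite (linZ lK).
by rewrite -(linZ lK); exact: sa_invP.
Qed.

(** If [(f, g)] is in [T] and [g - l f = w], then [K g = f] and [(K - 1 / l) (- l g) = w].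
    Boundedness is then a matter of symmetry, by [sym_bij_binv]. *)
Lemma sa_resolvent_binv (l : R) : l != 0 -> resolvent_set n T l%:C ->
  binv (qf n) (shift K l^-1).
Proof.
move=> l0 [bij _]; have kC : l^-1 != 0 by rewrite invr_eq0.
apply: (sym_bij_binv nH ndef cmpl).
- exact: linear_shift.
- apply: gsym_shift => //; exact: sa_inv_sym.
- move=> v /eqP; rewrite subr_eq0 => /eqP Kv.
  have Tv : T (v, l%:C *: v).
    by apply/sa_eigen; rewrite Kv scalerA -realcM mulfV// scale1r.
  have [f [_ uniq]] := bij 0.
  rewrite -(uniq v); last by exists (l%:C *: v); rewrite /= subrr.
  apply: uniq; exists 0; split; last by rewrite /= scaler0 subr0.
  by have := sa_invP 0; rewrite (lin0 lK).
move=> w; have [f [[g /= [Tf wE]] _]] := bij w.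
exists (- (l%:C *: g)).
rewrite /shift -scaleNr (linZ lK) -(sa_inv_uniq Tf) wE /= scalerA mulrN.
by rewrite scaleNr -realcM mulVf// !scaleNr scale1r opprK addrC.
Qed.

(** The range of [T - l] consists of the vectors [g - l K g]. It is closed, so by [closed_perp] it
    contains every vector orthogonal to the eigenvectors of [K] for [1 / l]. *)
Lemma sa_fredholm_solvable (l : R) : l != 0 -> fredholm n (op_shift T l%:C) ->
  solvable K l^-1.
Proof.
move=> l0 [_ clV _] w wP; have kC : l^-1 != 0 by rewrite invr_eq0.
pose V := op_ran (op_shift T l%:C).
have VE u : V u <-> exists g, u = g - l%:C *: K g.
  split=> [[f [g /= [Tf ->]]]|[g ->]]; first by exists g; rewrite -(sa_inv_uniq Tf).
  by exists (K g), g; split => //; exact: sa_invP.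
have : V w.
  apply: (closed_perp nH ndef cmpl clV).
  - by apply/VE; exists 0; rewrite (lin0 lK) scaler0 subr0.
  - move=> a u v /VE[g ->] /VE[g' ->]; apply/VE; exists (a *: g + g').
    rewrite lK scalerBr scalerDr opprD addrACA !scalerA [a * _]mulrC.
    by [].
  - move=> u uP; apply: wP; have u0 : u - l%:C *: K u = 0.
      apply: hform_eq0 => v; have := uP (v - l%:C *: K v).
      rewrite hformDr// hformNr// hformZr// conjcR => <-; last by apply/VE; exists v.
      by rewrite (hformD nH) hformN// (hformZ nH) sa_inv_sym.
    move/eqP: u0; rewrite subr_eq0 => /eqP uE.
    by rewrite [in RHS]uE scalerA -realcM mulVf// scale1r.
move=> /VE[g ->]; exists (- (l%:C *: g)).
rewrite -scaleNr (linZ lK) scalerA mulrN.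
by rewrite -realcM mulVf// !scaleNr scale1r opprK addrC.
Qed.

End SelfAdjoint.

(** * Parity *)

Section Operators.
Variables (R : realType) (r : R -> R).
Local Notation mu := (@lebesgue_measure R).
Hypotheses (r_loc : locally_integrable setT r)
  (r_gt0 : {ae mu, forall x, 0 < x -> 0 < r x})
  (r_lt0 : {ae mu, forall x, x < 0 -> r x < 0})
  (r_odd : {ae mu, forall x, r x = - r (- x)}).
Local Notation Re := complex.Re.
Local Notation Im := complex.Im.
Implicit Types (F G : L2 r).

Let aeF : Filter (nbhs (almost_everywhere mu)).
Proof. exact: (ae_filter_ringOfSetsType mu). Qed.
Hint Extern 0 (Filter _) => exact: aeF : typeclass_instances.

Let mr : measurable_fun setT r. Proof. by case: r_loc. Qed.
Let mnr : measurable_fun setT (fun x => `|r x|).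
Proof. exact: measurableT_comp. Qed.
Let mo : measurable_fun setT (-%R : R -> R).
Proof. exact: oppr_measurable. Qed.

Lemma ae_neq0 : {ae mu, forall x : R, x != 0}.
Proof.
exists [set 0]; split; [exact: measurable_set1|exact: lebesgue_measure_set1|].
by move=> x /= /negP; rewrite negbK => /eqP.
Qed.

Lemma sgr_ae : {ae mu, forall x, Num.sg (r x) = Num.sg x}.
Proof.
apply: filterS3 r_gt0 r_lt0 ae_neq0 => x rp rn x0.
have [xn|xp] := ltP x 0; first by rewrite !ltr0_sg// rn.
have {}xp : 0 < x by rewrite lt_neqAle eq_sym x0.
by rewrite !gtr0_sg// rp.
Qed.

Lemma r_neq0 : {ae mu, forall x, r x != 0}.
Proof.
apply: filterS2 sgr_ae ae_neq0 => x E x0.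
by rewrite -sgr_eq0 E sgr_eq0.
Qed.

Lemma L2_refl F : L2_fun_prop r (fun x => F (- x)).
Proof.
have [mR mI /integrableP[mF Foo]] := L2_prop F.
have mR' : measurable_fun setT (fun x : R => Re (F (- x))) by exact: measurableT_comp mR mo.
have mI' : measurable_fun setT (fun x : R => Im (F (- x))) by exact: measurableT_comp mI mo.
split=> //; apply/integrableP; split.
  by apply/measurable_EFinP; apply: measurable_funM => //; exact: measurable_normc2.
apply: le_lt_trans Foo.
rewrite -(@ge0_integral_opp R setT (fun x => `|(normc (F x) ^+ 2 * `|r x|)%:E|)%E)//; last exact: measurableT_comp.
rewrite preimage_setT le_eqVlt; apply/orP; left; apply/eqP; apply: ae_eq_integral => //.
- apply: measurableT_comp => //; apply/measurable_EFinP; apply: measurable_funM => //.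
  exact: measurable_normc2.
- exact: (measurableT_comp (measurableT_comp (@abse_measurable _ _) mF) mo).
by apply: filterS r_odd => x /= -> _; rewrite normrN.
Qed.

Definition refl F : L2 r := sval (cid (L2_mk (L2_refl F))).
Lemma reflE F : {ae mu, forall x, refl F x = F (- x)}.
Proof. exact: (svalP (cid (L2_mk (L2_refl F)))). Qed.

Lemma L2_sgn F : L2_fun_prop r (fun x => (Num.sg x)%:C * F x).
Proof.
have [mR mI iF] := L2_prop F; have ms := @measurable_sgr R.
have mR' : measurable_fun setT (fun x : R => Re ((Num.sg x)%:C * F x)).
  by under eq_fun do rewrite ReZ; exact: measurable_funM.
have mI' : measurable_fun setT (fun x : R => Im ((Num.sg x)%:C * F x)).
  by under eq_fun do rewrite ImZ; exact: measurable_funM.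
split=> //; apply: (le_integrable measurableT _ _ iF).
  by apply/measurable_EFinP; apply: measurable_funM => //; exact: measurable_normc2.
move=> x _; rewrite /= lee_fin normrM normr_id [leRHS]normrM normr_id ler_wpM2r//.
rewrite !ger0_norm ?sqr_ge0// !normc2E ReZ ImZ !exprMn -mulrDr sqr_sg.
by case: (x == 0); rewrite ?mul0r ?mul1r// addr_ge0// sqr_ge0.
Qed.

(** The factor is the sign of [x] instead of that of [r x]; by [sgr_ae] the two agree almost
    everywhere, so this is the fundamental symmetry. *)
Definition sgnop F : L2 r := sval (cid (L2_mk (L2_sgn F))).
Lemma sgnopE F : {ae mu, forall x, sgnop F x = (Num.sg x)%:C * F x}.
Proof. exact: (svalP (cid (L2_mk (L2_sgn F)))). Qed.

Lemma ae3 (P Q S : R -> Prop) : {ae mu, forall x, P x} -> {ae mu, forall x, Q x} ->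
  {ae mu, forall x, S x} -> {ae mu, forall x, [/\ P x, Q x & S x]}.
Proof. by move=> p q s; apply: filterS3 p q s. Qed.

Lemma refl_linear : linear refl.
Proof.
move=> a F G; apply: L2_ext.
have hl := ae3 (reflE (a *: F + G)) (ae_opp (L2_add (a *: F) G)) (ae_opp (L2_scaleE a F)).
have hr := ae3 (L2_add (a *: refl F) (refl G)) (L2_scaleE a (refl F)) (reflE F).
apply: filterS3 hl hr (reflE G) => x [-> -> ->] [-> -> ->] ->.
by [].
Qed.

Lemma reflK F : refl (refl F) = F.
Proof.
apply: L2_ext; apply: filterS2 (reflE (refl F)) (ae_opp (reflE F)) => x -> ->.
by rewrite opprK.
Qed.

Lemma refl_sym : gsym (L2_dot r) refl.
Proof.
move=> F G; rewrite !dotE; congr (_ +i* _).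
- rewrite -(Rint_oppT (mdotRe mr F (refl G))).
  apply: Rintegral_ae; first exact: idotRe.
    exact: (measurableT_comp (mdotRe mr F (refl G)) mo).
  apply: filterS3 (reflE F) (ae_opp (reflE G)) r_odd => x; rewrite /dotRe => -> -> ->.
  by rewrite opprK normrN.
- rewrite -(Rint_oppT (mdotIm mr F (refl G))).
  apply: Rintegral_ae; first exact: idotIm.
    exact: (measurableT_comp (mdotIm mr F (refl G)) mo).
  apply: filterS3 (reflE F) (ae_opp (reflE G)) r_odd => x; rewrite /dotIm => -> -> ->.
  by rewrite opprK normrN.
Qed.

Lemma sgnop_linear : linear sgnop.
Proof.
move=> a F G; apply: L2_ext.
have hl := ae3 (sgnopE (a *: F + G)) (L2_add (a *: F) G) (L2_scaleE a F).
have hr := ae3 (L2_add (a *: sgnop F) (sgnop G)) (L2_scaleE a (sgnop F)) (sgnopE F).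
apply: filterS3 hl hr (sgnopE G) => x [-> -> ->] [-> -> ->] ->.
by rewrite mulrDr mulrCA.
Qed.

Lemma sgnopK F : sgnop (sgnop F) = F.
Proof.
apply: L2_ext; apply: filterS3 (sgnopE (sgnop F)) (sgnopE F) ae_neq0 => x -> -> x0.
by rewrite mulrA -realcM -expr2 sqr_sg x0 mul1r.
Qed.

Lemma sgnop_sym : gsym (L2_dot r) sgnop.
Proof.
move=> F G; rewrite !dotE; congr (_ +i* _).
- apply: Rintegral_ae; [exact: idotRe|exact: mdotRe|].
  apply: filterS2 (sgnopE F) (sgnopE G) => x; rewrite /dotRe => -> ->.
  by rewrite !ReZ !ImZ; ring.
- apply: Rintegral_ae; [exact: idotIm|exact: mdotIm|].
  apply: filterS2 (sgnopE F) (sgnopE G) => x; rewrite /dotIm => -> ->.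
  by rewrite !ReZ !ImZ; ring.
Qed.

Lemma refl_sgnop F : refl (sgnop F) = - sgnop (refl F).
Proof.
rewrite -scaleN1r; apply: L2_ext.
have hl := ae3 (reflE (sgnop F)) (ae_opp (sgnopE F)) (L2_scaleE (-1) (sgnop (refl F))).
apply: filterS3 hl (sgnopE (refl F)) (reflE F) => x [-> -> ->] -> ->.
by rewrite sgrN realcN mulNr mulN1r.
Qed.

Definition evenop F : L2 r := 2^-1%:C *: (F + refl F).

Lemma evenp_linear : linear evenop.
Proof.
move=> a F G; rewrite /evenop refl_linear scalerA [a * _]mulrC -scalerA -scalerDr.
by rewrite addrACA -(scalerDr a).
Qed.

Lemma refl_evenp F : refl (evenop F) = evenop F.
Proof.
by rewrite /evenop (linZ refl_linear) (linD refl_linear) reflK addrC.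
Qed.

Lemma evenp_fix F : refl F = F -> evenop F = F.
Proof.
move=> FE; rewrite /evenop FE scalerDr -scalerDl -realcD.
by rewrite (_ : 2^-1 + 2^-1 = 1 :> R) ?scale1r//; field.
Qed.

Lemma evenpK F : evenop (evenop F) = evenop F.
Proof. by rewrite evenp_fix// refl_evenp. Qed.

Lemma evenp_sym : gsym (L2_dot r) evenop.
Proof.
have nH := L2_dot_hform mr.
by move=> F G; rewrite (hformZ nH) (hformZr nH) (hformD nH) (hformDr nH) refl_sym conjcR.
Qed.

End Operators.

Section RankOne.
Variables (R : realType) (H : lmodType R[i]) (n : H -> H -> R[i]).
Local Notation Re := complex.Re.
Hypotheses (nH : hform n) (ndef : forall v, qf n v = 0 -> v = 0).

(** With [psi g != 0] and [h = D g] one has [D v = t v *: h] for [t = psi / psi g]. Symmetry at [v]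
    and [h] gives [t v (h, h) = conjc (t h) (v, h)]; for [v = h] this shows that [t h] is real, and
    [c = t h / (h, h)]. *)
Lemma rank1_sym (D : H -> H) (psi : H -> R[i]) : linear D -> gsym n D ->
  (forall a u v, psi (a *: u + v) = a * psi u + psi v) ->
  (forall v, psi v = 0 -> D v = 0) ->
  exists c h, forall v, D v = (c%:C * n v h) *: h.
Proof.
move=> lD nD lpsi psi0.
have [[g pg]|npsi] := pselect (exists g, psi g != 0); last first.
  exists 0, 0 => v; rewrite mul0r scale0r; apply: psi0.
  by apply/eqP; apply: contrapT => /negP pv; apply: npsi; exists v.
pose t v := psi v / psi g; pose h := D g.
have DE v : D v = t v *: h.
  apply/eqP; rewrite -subr_eq0 -scaleNr addrC /h -lD; apply/eqP/psi0.
  by rewrite lpsi /t mulNr divfK// addNr.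
have [h0|hn0] := eqVneq h 0.
  by exists 0, 0 => v; rewrite DE h0 !scaler0.
have q0 : qf n h != 0 by apply: contraNneq hn0 => /ndef ->.
have tE v : t v * (qf n h)%:C = conjc (t h) * n v h.
  by have := nD v h; rewrite !DE (hformZ nH) (hformZr nH) (qfE nH) => ->.
have th : t h = conjc (t h).
  by apply: (mulIf (x := (qf n h)%:C)); rewrite ?realc_eq0// tE (qfE nH).
have thR : conjc (t h) = (Re (t h))%:C.
  apply: complexE; rewrite ?ReJ ?ImJ //=.
  have := congr1 (@complex.Im R) th; rewrite ImJ; lra.
exists (Re (t h) / qf n h), h => v; rewrite DE; congr (_ *: _).
apply: (mulIf (x := (qf n h)%:C)); rewrite ?realc_eq0// tE thR mulrAC.
by rewrite -realcM divfK.
Qed.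
End RankOne.

(** * The even and odd parts of the inverse of the maximal operator *)

Section Problem.
Variables (R : realType) (r p q : R -> R).
Local Notation mu := (@lebesgue_measure R).
Hypotheses (r_loc : locally_integrable setT r)
  (p_loc : locally_integrable setT (fun x => (p x)^-1))
  (q_loc : locally_integrable setT q)
  (p_gt0 : {ae mu, forall x, 0 < p x})
  (r_gt0 : {ae mu, forall x, 0 < x -> 0 < r x})
  (r_lt0 : {ae mu, forall x, x < 0 -> r x < 0})
  (p_even : {ae mu, forall x, p x = p (- x)})
  (q_even : {ae mu, forall x, q x = q (- x)})
  (r_odd : {ae mu, forall x, r x = - r (- x)}).
Local Notation Re := complex.Re.
Local Notation Im := complex.Im.
Implicit Types (F G : L2 r).
Let aeF : Filter (nbhs (almost_everywhere mu)).
Proof. exact: (ae_filter_ringOfSetsType mu). Qed.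
Hint Extern 0 (Filter _) => exact: aeF : typeclass_instances.

Let mr : measurable_fun setT r. Proof. by case: r_loc. Qed.
Let r0 := r_neq0 r_gt0 r_lt0.
Local Notation refl := (refl r_loc r_odd).
Local Notation sgnop := (sgnop r_loc).
Local Notation evenp := (evenop r_loc r_odd).
Local Notation dot := (L2_dot r).
Local Notation sl := (sl_system r p q).
Local Notation lrh h := (locally_integrable setT (fun x => `|r x| * h x)).
Local Notation T := (maximal_op r p q).
Let nH : hform dot := L2_dot_hform mr.
Let ndef := L2_dot_def mr r0.
Let cmpl := L2_fast_complete mr r0.
Let TP := maximal_opP r_loc p_loc q_loc p_gt0 r0.
Let lR G : lrh (fun x => Re (G x)) := (lrh_L2 r_loc G).1.
Let lI G : lrh (fun x => Im (G x)) := (lrh_L2 r_loc G).2.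
Let ae_and := @ae3 R.

Let cae (f g : R -> R) x : continuous f -> continuous g ->
  {ae mu, forall y, f y = g y} -> f x = g x.
Proof. by move=> cf cg fg; rewrite (continuous_ae_eq cf cg fg). Qed.

Lemma sl_ae f u h k : lrh h -> lrh k ->
  {ae mu, forall x, h x = k x} -> sl f u h -> sl f u k.
Proof.
move=> lh lk hk [cf cu pf pu]; split=> //; apply: primitive_ae_eq pu.
- exact: sl_loc.
- by have [] := sl_loc q_loc cf lk.
- by apply: filterS hk => x ->.
Qed.

Lemma maximal_refl F G : T (F, G) -> T (refl F, refl G).
Proof.
have E := reflE r_loc r_odd.
move=> /TP[f1 [u1 [f2 [u2 [s1 s2 Ff]]]]]; apply/TP.
exists (fun x => f1 (- x)), (fun x => - u1 (- x)),
  (fun x => f2 (- x)), (fun x => - u2 (- x)); split.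
- have l1 := lrh_opp r_loc r_odd (lR G) (mRe G).
  apply: (sl_ae l1 (lR (refl G)) _).
    by apply: filterS (E G) => x ->.
  exact: sl_opp (lR G) (mRe G) s1.
- have l2 := lrh_opp r_loc r_odd (lI G) (mIm G).
  apply: (sl_ae l2 (lI (refl G)) _).
    by apply: filterS (E G) => x ->.
  exact: sl_opp (lI G) (mIm G) s2.
by apply: filterS2 (E F) (ae_opp Ff) => x -> ->.
Qed.

(** The derivative of an even function is odd, so [u = p f'] is odd almost everywhere and, being
    continuous, everywhere. *)
Lemma sl_even f u h : sl f u h -> (forall x, f (- x) = f x) -> u 0 = 0.
Proof.
move=> [cf cu pf pu] fE; have lk := locally_integrableM cu p_loc.
have lk' := locally_integrableN (locally_integrable_opp lk).
have pf' : primitive f (fun x => - (u (- x) * (p (- x))^-1)).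
  by have := primitive_opp lk pf; congr (primitive _ _); apply/funext => x; exact: fE.
have E : {ae mu, forall x, u x = - u (- x)}.
  apply: filterS3 (primitive_ae lk pf) (primitive_ae lk' pf')
    (filterI p_gt0 p_even) => x [_ ->] [_ E] [px pE].
  move: E => /=; rewrite -pE -mulNr => /mulIf; apply.
  by rewrite invr_eq0 gt_eqF.
have co : continuous (fun x => - u (- x)).
  move=> x; apply: cvgN; have h1 : - y @[y --> x] --> - x by exact: opp_continuous.
  exact: (cvg_comp _ _ h1 (cu (- x))).
have := congr1 (@^~ 0) (continuous_ae_eq cu co E) => /=; rewrite oppr0; lra.
Qed.

Hypothesis Tsa : selfadjoint dot T.
Hypothesis T0 : resolvent_set dot T 0.
Definition sl_inv : L2 r -> L2 r := sa_inv T0.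
Local Notation K := sl_inv.
Let KP G : T (K G, G) := sa_invP T0 G.
Let K_uniq F G : T (F, G) -> F = K G. Proof. exact: sa_inv_uniq. Qed.
Let lK : linear K := sa_inv_linear nH Tsa T0.
Let nK : gsym dot K := sa_inv_sym Tsa T0.
Let lJ : linear sgnop := @sgnop_linear _ _ r_loc.
Let lE : linear evenp := @evenp_linear _ _ r_loc r_odd.
Let JJ v : sgnop (sgnop v) = v := @sgnopK _ _ r_loc v.
Let PJ v : refl (sgnop v) = - sgnop (refl v) := @refl_sgnop _ _ r_loc r_odd v.

Lemma inv_refl G : K (refl G) = refl (K G).
Proof. by apply/esym/K_uniq/maximal_refl. Qed.

Lemma inv_evenp G : K (evenp G) = evenp (K G).
Proof. by rewrite /evenop (linZ lK) (linD lK) inv_refl. Qed.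

(** [f1 + i f2] is the continuous representative of [K G], and [u1 + i u2] is that of [p (K G)']. *)
Definition rep G f1 u1 f2 u2 :=
  [/\ sl f1 u1 (fun x => Re (G x)), sl f2 u2 (fun x => Im (G x)) &
      {ae mu, forall x, K G x = f1 x +i* f2 x}].

Lemma rep_ex G : exists f1 u1 f2 u2, rep G f1 u1 f2 u2.
Proof. exact/TP/KP. Qed.

Lemma rep_even G f1 u1 f2 u2 : rep G f1 u1 f2 u2 -> refl G = G ->
  [/\ forall x, f1 (- x) = f1 x, forall x, f2 (- x) = f2 x, u1 0 = 0 & u2 0 = 0].
Proof.
have E := reflE r_loc r_odd.
move=> [s1 s2 KG] GE.
have co (f : R -> R) : continuous f -> continuous (fun x => f (- x)).
  move=> cf x; have h1 : - y @[y --> x] --> - x by exact: opp_continuous.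
  exact: (cvg_comp _ _ h1 (cf (- x))).
have KE : {ae mu, forall x, f1 (- x) +i* f2 (- x) = f1 x +i* f2 x}.
  apply: filterS3 (ae_opp KG) (E (K G)) KG => x <- ; rewrite -inv_refl GE => <-.
  by [].
have e1 x : f1 (- x) = f1 x.
  case: s1 => cf _ _ _; apply: (cae x (co _ cf) cf).
  by apply: filterS KE => y [].
have e2 x : f2 (- x) = f2 x.
  case: s2 => cf _ _ _; apply: (cae x (co _ cf) cf).
  by apply: filterS KE => y [].
by split=> //; [exact: sl_even s1 e1|exact: sl_even s2 e2].
Qed.

(* The value at 0 of the continuous representative of [K G]. *)
Definition trace G : R[i] :=
  let: exist f1 H1 := cid (rep_ex G) in
  let: exist u1 H2 := cid H1 in let: exist f2 _ := cid H2 in f1 0 +i* f2 0.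

Lemma traceP G f1 u1 f2 u2 : rep G f1 u1 f2 u2 -> trace G = f1 0 +i* f2 0.
Proof.
rewrite /trace; case: (cid _) => g1 H1; case: (cid _) => v1 H2; case: (cid _) => g2 [v2].
move=> [[cg1 _ _ _] [cg2 _ _ _] Kg] [[cf1 _ _ _] [cf2 _ _ _] Kf].
by congr (_ +i* _); [apply: (cae 0 cg1 cf1)|apply: (cae 0 cg2 cf2)];
  apply: filterS2 Kg Kf => x -> [].
Qed.

Lemma trace_linear a F G : trace (a *: F + G) = a * trace F + trace G.
Proof.
have [f1 [u1 [f2 [u2 rf]]]] := rep_ex F; have [g1 [v1 [g2 [v2 rg]]]] := rep_ex G.
have [h1 [w1 [h2 [w2 rh]]]] := rep_ex (a *: F + G).
rewrite (traceP rf) (traceP rg) (traceP rh).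
case: rf rg rh => [[cf1 _ _ _] [cf2 _ _ _] Kf] [[cg1 _ _ _] [cg2 _ _ _] Kg].
move=> [[ch1 _ _ _] [ch2 _ _ _] Kh].
have E : {ae mu, forall x, h1 x +i* h2 x = a * (f1 x +i* f2 x) + (g1 x +i* g2 x)}.
  have hl := ae_and Kh (L2_add (a *: K F) (K G)) (L2_scaleE a (K F)).
  by apply: filterS3 hl Kf Kg => x [<-]; rewrite lK => -> -> -> ->.
have c0 (b c : R) (f g k : R -> R) : continuous f -> continuous g -> continuous k ->
    continuous (fun x => b * f x + c * g x + k x).
  move=> cf cg ck x; apply: cvgD; last exact: ck.
  by apply: cvgD; apply: cvgM => //; (exact: cvg_cst || exact: cf || exact: cg).
apply: complexE.
- rewrite /= (cae 0 ch1 (c0 (Re a) (- Im a) _ _ _ cf1 cf2 cg1)).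
    by rewrite ReD ReM /=; ring.
  by apply: filterS E => x /(congr1 (@complex.Re R)) /= ->; rewrite ReD ReM /=; ring.
- rewrite /= (cae 0 ch2 (c0 (Re a) (Im a) _ _ _ cf2 cf1 cg2)).
    by rewrite ImD ImM /=; ring.
  by apply: filterS E => x /(congr1 (@complex.Im R)) /= ->; rewrite ImD ImM /=; ring.
Qed.

Lemma inv_sgnop G : refl G = G -> trace G = 0 -> sgnop (K (sgnop G)) = K G.
Proof.
have E := sgnopE r_loc.
have [f1 [u1 [f2 [u2 rf]]]] := rep_ex G; rewrite (traceP rf) => GE [f10 f20].
have [_ _ u10 u20] := rep_even rf GE; case: rf => s1 s2 Kf.
suff : T (sgnop (K G), sgnop G) by move=> /K_uniq <-.
apply/TP; exists (fun x => Num.sg x * f1 x), (fun x => Num.sg x * u1 x),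
  (fun x => Num.sg x * f2 x), (fun x => Num.sg x * u2 x).
split.
- apply: sl_ae (sl_sgn p_loc q_loc (lR G) s1 f10 u10) => //.
    have := sg_loc (lR G); congr (locally_integrable _ _).
    by apply/funext => x; rewrite mulrCA.
  by apply: filterS (E G) => x ->; rewrite ReZ.
- apply: sl_ae (sl_sgn p_loc q_loc (lI G) s2 f20 u20) => //.
    have := sg_loc (lI G); congr (locally_integrable _ _).
    by apply/funext => x; rewrite mulrCA.
  by apply: filterS (E G) => x ->; rewrite ImZ.
apply: filterS2 (E (K G)) Kf => x -> ->.
by apply: complexE; rewrite ?ReZ ?ImZ.
Qed.

(** The operators [evenK] and [evenD] are the [K] and [D] of the overview, extended by 0 to the odd
    functions so that both act on the whole space. *)
Definition evenK := K \o evenp.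
Definition sgnK := sgnop \o K \o sgnop.
Definition evenD := sgnK \o evenp.

Lemma sgnK_linear : linear sgnK.
Proof. by move=> a u v; rewrite /sgnK /= lJ lK lJ. Qed.

Lemma sgnK_sym : gsym dot sgnK.
Proof. by move=> u v; rewrite /sgnK /= !(sgnop_sym, nK). Qed.

Lemma linN (S : L2 r -> L2 r) v : linear S -> S (- v) = - S v.
Proof. by move=> lS; rewrite -scaleN1r (linZ lS) scaleN1r. Qed.

Lemma sgnK_evenp v : sgnK (evenp v) = evenp (sgnK v).
Proof.
have E u : sgnK (refl u) = refl (sgnK u).
  by rewrite /sgnK /= PJ -inv_refl PJ !linN// opprK.
by rewrite /evenop (linZ sgnK_linear) (linD sgnK_linear) E.
Qed.

Lemma evenK_linear : linear evenK.
Proof. exact: linear_comp. Qed.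

Lemma evenD_linear : linear evenD.
Proof. by apply: linear_comp => //; exact: sgnK_linear. Qed.

Lemma evenK_sym : gsym dot evenK.
Proof. by move=> u v; rewrite /evenK /= nK evenp_sym inv_evenp. Qed.

Lemma evenD_sym : gsym dot evenD.
Proof. by move=> u v; rewrite /evenD /= sgnK_sym evenp_sym sgnK_evenp. Qed.

(** By [inv_sgnop] the difference vanishes wherever the linear functional [trace \o evenp] does, and
    it is symmetric; [rank1_sym] gives its form. *)
Lemma evenKD_rank1 : exists c h, forall v, evenK v = evenD v + (c%:C * dot v h) *: h.
Proof.
have [c [h ch]] : exists c h, forall v, evenK v - evenD v = (c%:C * dot v h) *: h.
  apply: (rank1_sym nH ndef (psi := trace \o evenp)).
  - move=> a u v; rewrite evenK_linear evenD_linear scalerBr.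
    by rewrite opprD addrACA.
  - move=> u v; rewrite (hformD nH) (hformDr nH) (hformN nH) (hformNr nH).
    by rewrite evenK_sym evenD_sym.
  - by move=> a u v; rewrite /= lE trace_linear.
  - by move=> v /= /inv_sgnop tv; rewrite /evenK /evenD /sgnK /= tv ?subrr// refl_evenp.
by exists c, h => v; rewrite -ch addrC subrK.
Qed.

(** [g] is continuous and almost everywhere odd, so [g 0 = 0]; and [|f| = |g|] almost everywhere,
    hence also at 0. *)
Lemma sgn_trace0 (f g : R -> R) : continuous f -> continuous g ->
  (forall x, f (- x) = f x) -> {ae mu, forall x, g x = Num.sg x * f x} -> f 0 = 0.
Proof.
move=> cf cg fE gf.
have co (k : R -> R) : continuous k -> continuous (fun x => - k (- x)).
  move=> ck x; apply: cvgN; have h1 : - y @[y --> x] --> - x by exact: opp_continuous.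
  exact: (cvg_comp _ _ h1 (ck (- x))).
have g0 : g 0 = - g (- 0).
  apply: (cae 0 cg (co _ cg)); apply: filterS2 gf (ae_opp gf) => x -> ->.
  by rewrite fE sgrN mulNr opprK.
have {g0} g0 : g 0 = 0 by move: g0; rewrite oppr0; lra.
have cn (k : R -> R) : continuous k -> continuous (fun x => `|k x|).
  by move=> ck x; apply: cvg_norm; exact: ck.
have : `|f 0| = `|g 0|.
  apply: (cae 0 (cn _ cf) (cn _ cg)); apply: filterS2 gf (ae_neq0 R) => x -> x0.
  by rewrite normrM normr_sg x0 mul1r.
by rewrite g0 normr0 => /eqP; rewrite normr_eq0 => /eqP.
Qed.

(* A common eigenvector [e] is even and [sgn * e] is an eigenfunction of [A] as
   well; being odd, it vanishes at 0, so [e] has zero Cauchy data there. *)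
Lemma common_eigen0 (k : R) e : k != 0 ->
  evenK e = k%:C *: e -> evenD e = k%:C *: e -> e = 0.
Proof.
have sE := sgnopE r_loc.
move=> k0 Ke De; have kC : k%:C != 0 :> R[i] by rewrite realc_eq0.
have Ee : evenp e = e.
  apply: (scalerI kC); rewrite -(linZ lE) -Ke /evenK /=.
  by rewrite -inv_evenp evenpK.
have Pe : refl e = e by rewrite -Ee refl_evenp.
have {}Ke : K e = k%:C *: e by rewrite -Ke /evenK /= Ee.
have {De} KJe : K (sgnop e) = k%:C *: sgnop e.
  by rewrite -(linZ lJ) -De /evenD /sgnK /= Ee JJ.
have [f1 [u1 [f2 [u2 rf]]]] := rep_ex e.
have [f1E f2E u10 u20] := rep_even rf Pe.
have [g1 [v1 [g2 [v2 rg]]]] := rep_ex (sgnop e).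
case: rf => s1 s2 Kf; case: rg => [[cg1 _ _ _] [cg2 _ _ _] Kg].
have fe : {ae mu, forall x, f1 x +i* f2 x = k%:C * e x}.
  apply: filterS2 Kf (L2_scaleE k%:C e) => x <-.
  by rewrite Ke => ->.
have gf : {ae mu, forall x, g1 x +i* g2 x = (Num.sg x)%:C * (f1 x +i* f2 x)}.
  have hl := ae_and Kg (L2_scaleE k%:C (sgnop e)) (sE e).
  by apply: filterS2 hl fe => x [<- E1 E2] ->; rewrite KJe E1 E2 mulrCA.
have f10 : f1 0 = 0.
  case: s1 => cf1 _ _ _; apply: (sgn_trace0 cf1 cg1 f1E).
  by apply: filterS gf => x /(congr1 (@complex.Re R)) /= ->; rewrite mul0r subr0.
have f20 : f2 0 = 0.
  case: s2 => cf2 _ _ _; apply: (sgn_trace0 cf2 cg2 f2E).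
  by apply: filterS gf => x /(congr1 (@complex.Im R)) /= ->; rewrite mul0r addr0.
have z1 : f1 = fun=> 0.
  apply: (sl_uniq r_loc p_loc q_loc p_even q_even r_odd (lR e) (mRe e) s1 (l := k^-1)) => //.
  apply: filterS fe => x /(congr1 (@complex.Re R)); rewrite ReZ /= => ->.
  by rewrite mulKf.
have z2 : f2 = fun=> 0.
  apply: (sl_uniq r_loc p_loc q_loc p_even q_even r_odd (lI e) (mIm e) s2 (l := k^-1)) => //.
  apply: filterS fe => x /(congr1 (@complex.Im R)); rewrite ImZ /= => ->.
  by rewrite mulKf.
apply: L2_ext; apply: filterS2 fe (L2_zero r) => x; rewrite z1 z2 => E ->.
by apply/eqP; move/esym/eqP: E; rewrite mulf_eq0 (negbTE kC).
Qed.

Lemma even_of_ev (S : L2 r -> L2 r) k v : (forall u, S (evenp u) = evenp (S u)) ->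
  k != 0 -> S (evenp v) = k%:C *: v -> evenp v = v.
Proof.
move=> SE k0 Sv; have kC : k%:C != 0 :> R[i] by rewrite realc_eq0.
by apply: (scalerI kC); rewrite -(linZ lE) -Sv -SE evenpK.
Qed.

Lemma inv_eigen (l : R) f : l != 0 ->
  T (f, l%:C *: f) <-> K f = l^-1%:C *: f.
Proof.
move=> l0; rewrite (sa_eigen nH Tsa T0 l f) -/(K f); split=> [{2}->|->].
  by rewrite scalerA -realcM mulVf// scale1r.
by rewrite scalerA -realcM mulfV// scale1r.
Qed.

(** If the even part of an eigenvector is not 0, it is an eigenvector of [evenK]. Otherwise the
    eigenvector is odd, and [sgnop] turns it into an even eigenvector of [evenD]. *)
Lemma maximal_eigenP (l : R) : l != 0 ->
  real_eigenvalue T l <-> ev evenK l^-1 \/ ev evenD l^-1.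
Proof.
move=> l0; have k0 : l^-1 != 0 by rewrite invr_eq0.
split=> [[f [f0 /(inv_eigen f l0) Kf]]|].
  have [Ef0|Ef0] := eqVneq (evenp f) 0; [right|left]; last first.
    by exists (evenp f) => //; rewrite /evenK /= evenpK inv_evenp Kf (linZ lE).
  have Pf : refl f = - f.
    have := congr1 (fun v => 2%:C *: v) Ef0; rewrite /evenop scalerA scaler0 -realcM.
    by rewrite divff// scale1r => /eqP; rewrite addrC addr_eq0 => /eqP.
  have EJf : evenp (sgnop f) = sgnop f by rewrite evenp_fix// PJ Pf linN// opprK.
  exists (sgnop f); last by rewrite /evenD /sgnK /= EJf JJ Kf (linZ lJ).
  by apply: contraNneq f0 => Jf0; rewrite -[f]JJ Jf0 (lin0 lJ).
move=> [[v v0 Kv]|[v v0 Dv]].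
  exists v; split=> //; apply/inv_eigen => //; rewrite -Kv /evenK /=.
  by rewrite (even_of_ev inv_evenp k0 Kv).
exists (sgnop v); split.
  by apply: contraNneq v0 => Jf0; rewrite -[v]JJ Jf0 (lin0 lJ).
apply/inv_eigen => //; rewrite -(linZ lJ) -Dv /evenD /sgnK /= JJ.
by rewrite (even_of_ev sgnK_evenp k0 Dv).
Qed.

Lemma fund_symmetryE F G : fund_symmetry r (F, G) <-> G = sgnop F.
Proof.
have sE := sgnopE r_loc; have rE := sgr_ae r_gt0 r_lt0.
split=> [FG|->].
  by apply: L2_ext; apply: filterS3 FG (sE F) rE => x /= -> -> ->.
by apply: filterS2 (sE F) rE => x /= -> ->.
Qed.

Lemma inv_sgn_eigen (l : R) f : l != 0 ->
  indefinite_op r p q (f, l%:C *: f) <-> K (sgnop f) = l^-1%:C *: f.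
Proof.
move=> l0; have lC : l%:C != 0 :> R[i] by rewrite realc_eq0.
split=> [[g /= [Tg /fund_symmetryE lf]]|KJ].
  apply: (scalerI lC); rewrite scalerA -realcM mulfV// scale1r.
  by rewrite -(linZ lK) -(linZ lJ) lf JJ -(K_uniq Tg).
exists (l%:C *: sgnop f); split=> /=; last first.
  by apply/fund_symmetryE; rewrite (linZ lJ) JJ.
have := KP (l%:C *: sgnop f); rewrite (linZ lK) KJ scalerA -realcM mulfV//.
by rewrite scale1r.
Qed.

(* [J] exchanges even and odd functions: the even part of an eigenvector of
   [JA] is an eigenvector of [evenK \o evenD], and conversely. *)
Lemma indefinite_eigenP (l : R) : l != 0 ->
  real_eigenvalue (indefinite_op r p q) l <-> evs evenK evenD l^-1.
Proof.
move=> l0; set k := l^-1; have k0 : k != 0 by rewrite invr_eq0.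
have kC : k%:C != 0 :> R[i] by rewrite realc_eq0.
have EJ v : evenp (sgnop v) = sgnop (v - evenp v).
  rewrite (linB lJ) /evenop PJ (linZ lJ) (linD lJ) scalerBr scalerDr opprD addrA.
  congr (_ - _); rewrite -[X in X - _]scale1r -scalerBl.
  by congr (_ *: _); apply: complexE => /=; field.
split=> [[f [f0 /(inv_sgn_eigen f l0) KJf]]|[v v0 KDv]].
  have KJe : K (sgnop (evenp f)) = k%:C *: (f - evenp f).
    rewrite scalerBr -(linZ lE) -KJf -inv_evenp EJ -(linB lK) -(linB lJ).
    by rewrite opprB addrC subrK.
  have KJo : K (sgnop (f - evenp f)) = k%:C *: evenp f.
    by rewrite -(linZ lE) -KJf -inv_evenp EJ.
  exists (evenp f).
    apply: contraNneq f0 => Ef0; move: KJe; rewrite Ef0 (lin0 lJ) (lin0 lK) subr0.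
    by move=> /esym/eqP; rewrite scaler_eq0 (negbTE kC).
  rewrite /evenK /evenD /sgnK /= evenpK KJe (linZ lJ) (linZ lE) EJ.
  rewrite (linB lE) evenpK subrr subr0 (linZ lK) KJo scalerA -realcM -expr2.
  by [].
have k20 : k ^+ 2 != 0 by rewrite expf_eq0.
have KE u : evenK (evenD (evenp u)) = evenp (evenK (evenD u)).
  by rewrite /evenK /evenD /= -inv_evenp !evenpK.
have Ev : evenp v = v.
  apply: (even_of_ev (S := evenK \o evenD) KE k20).
  by rewrite -KDv /evenD /= evenpK.
have KJJ : K (sgnK v) = (k ^+ 2)%:C *: v.
  by rewrite -KDv /evenD /evenK /= -sgnK_evenp evenpK Ev.
(* The even part is chosen as [k v]. The odd part is then forced: [k] times it has to be
   [K (sgnop (k v))]. *)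
exists (k%:C *: v + K (sgnop v)); split; last first.
  apply/inv_sgn_eigen => //; rewrite (linD lJ) (linD lK) (linZ lJ) (linZ lK) -/k.
  rewrite -[X in _ + X]/(K (sgnK v)) KJJ expr2 realcM -scalerA -scalerDr.
  by rewrite addrC.
apply: contraNneq v0 => /(congr1 evenp).
rewrite (linD lE) (linZ lE) -inv_evenp EJ Ev subrr (lin0 lJ) (lin0 lK) addr0 (lin0 lE).
by move=> /eqP; rewrite scaler_eq0 (negbTE kC).
Qed.

Hypothesis neg_resolvent : forall l : R, l < 0 -> resolvent_set dot T l%:C.

Lemma inv_neg_binv k : k < 0 -> binv (qf dot) (shift K k).
Proof.
move=> k0; rewrite -[k]invrK; apply: (sa_resolvent_binv nH ndef cmpl Tsa).
  by rewrite invr_eq0 lt_eqF.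
by apply: neg_resolvent; rewrite invr_lt0.
Qed.

Lemma inv_psd v : 0 <= Re (dot (K v) v).
Proof. exact: (psd_of_binv nH ndef cmpl lK nK inv_neg_binv). Qed.

Lemma evenK_psd v : 0 <= Re (dot (evenK v) v).
Proof.
have -> : evenK v = evenp (K (evenp v)) by rewrite -inv_evenp evenpK.
by rewrite evenp_sym; exact: inv_psd.
Qed.

Lemma evenD_psd v : 0 <= Re (dot (evenD v) v).
Proof.
have -> : evenD v = evenp (sgnop (K (sgnop (evenp v)))).
  by rewrite -[RHS]sgnK_evenp evenpK.
by rewrite evenp_sym sgnop_sym; exact: inv_psd.
Qed.

Lemma inv_neg_solvable k : k < 0 -> solvable dot K k.
Proof. by move=> /inv_neg_binv[W [_ KW _]] w _; exists (W w); exact: KW. Qed.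

Lemma psd_noev (S : L2 r -> L2 r) k : (forall v, 0 <= Re (dot (S v) v)) ->
  k < 0 -> ~ ev S k.
Proof.
move=> S0 k0 [v v0 Sv]; have := S0 v; rewrite Sv (hformZ nH) ReZ.
rewrite nmulr_rge0// => q0; move/eqP: v0; apply; apply: ndef.
by apply/eqP; rewrite eq_le q0 (hform_ge0 nH).
Qed.

Lemma solvable_evenK k : k != 0 -> solvable dot K k -> ~ ev evenK k ->
  binv (qf dot) (shift evenK k).
Proof.
by move=> k0 sk nev; apply: (alt_proj nH ndef cmpl) => //;
  [exact: evenp_sym|exact: evenpK|exact: inv_evenp].
Qed.

Lemma solvable_evenD k : k != 0 -> solvable dot K k -> ~ ev evenD k ->
  binv (qf dot) (shift evenD k).
Proof.
move=> k0 sk nev; apply: (alt_proj nH ndef cmpl) => //.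
- exact: sgnK_linear.
- exact: sgnK_sym.
- exact: evenp_sym.
- exact: evenpK.
- exact: sgnK_evenp.
- by apply: solvable_conj => //; exact: sgnop_sym.
Qed.

Variable k0 : R.
Hypothesis k0_ge0 : 0 <= k0.
Hypothesis fred : forall k : R, k0 < k -> fredholm dot (op_shift T (k^-1)%:C).

(** Fredholmness of [A - 1 / k] for [k > k0] provides the alternatives for positive [k]. That [A]
    has no negative spectrum provides positivity, and with it invertibility at [- k]. *)
Lemma evenKD_pair : exists c h, rank1_pair dot evenK evenD h c k0.
Proof.
have [c [h chE]] := evenKD_rank1; exists c, h.
have sol k : k0 < k -> solvable dot K k.
  move=> kk; rewrite -[k]invrK; apply: (sa_fredholm_solvable nH ndef cmpl Tsa).
    by rewrite invr_eq0 gt_eqF// (le_lt_trans k0_ge0).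
  exact: fred.
have kn k : k0 < k -> k != 0 by move=> kk; rewrite gt_eqF// (le_lt_trans k0_ge0).
split=> //.
- exact: evenK_linear.
- exact: evenD_linear.
- exact: evenK_sym.
- exact: evenD_sym.
- apply: (hellinger_toeplitz nH ndef cmpl); [exact: evenK_linear|exact: evenK_sym].
- apply: (hellinger_toeplitz nH ndef cmpl); [exact: evenD_linear|exact: evenD_sym].
- exact: evenK_psd.
- exact: evenD_psd.
- by move=> k kk; apply: solvable_evenK; [exact: kn|exact: sol].
- by move=> k kk; apply: solvable_evenD; [exact: kn|exact: sol].
- move=> k kk; apply: solvable_evenK; first by rewrite oppr_eq0 gt_eqF.
    by apply: inv_neg_solvable; rewrite oppr_lt0.
  by apply: psd_noev; [exact: evenK_psd|rewrite oppr_lt0].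
- move=> k kk; apply: solvable_evenD; first by rewrite oppr_eq0 gt_eqF.
    by apply: inv_neg_solvable; rewrite oppr_lt0.
  by apply: psd_noev; [exact: evenD_psd|rewrite oppr_lt0].
- by move=> k e kk; apply: common_eigen0; exact: kn.
Qed.

End Problem.

(** * Counting interlaced eigenvalues *)

Section Counting.
Variable R : realType.
Implicit Types (X Y Z : set R) (s t : seq R).

(** Lists of distinct elements allow finite and infinite sets to be compared in the same way. *)
Definition has_card_ge X n := exists s, [/\ uniq s, size s = n & forall x, x \in s -> X x].

Lemma counting_fin X : counting X = +oo%E :> \bar R \/
  exists k, counting X = k%:R%:E :> \bar R /\ forall n, has_card_ge X n <-> (n <= k)%N.
Proof.
rewrite /counting; case: asboolP => fX; last by left.
right; exists #|` fset_set X|; split=> // n; split.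
  move=> [s [us <- sX]]; apply: uniq_leq_size => // x /sX Xx.
  by rewrite in_fset_set//; exact: mem_set.
move=> nk; exists (take n (fset_set X)); split.
- by rewrite take_uniq// fset_uniq.
- by rewrite size_take_min (minn_idPl nk).
- by move=> x /mem_take; rewrite in_fset_set// => /set_mem.
Qed.

Lemma counting_oo X : counting X = +oo%E :> \bar R <-> forall n, has_card_ge X n.
Proof.
split=> [|nX].
  rewrite /counting; case: asboolP => // fX _ n.
  have [B BX nB] := infinite_set_fset n fX.
  exists (take n B); split.
  - by rewrite take_uniq// fset_uniq.
  - by rewrite size_take_min (minn_idPl nB).
  - by move=> x /mem_take xB; exact: BX.
have [//|[k [_ kP]]] := counting_fin X.
by have := (kP k.+1).1 (nX _); rewrite ltnn.
Qed.

Lemma counting_eq X Y : (forall n, has_card_ge X n <-> has_card_ge Y n) ->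
  counting X = counting Y :> \bar R.
Proof.
move=> XY; have [Xoo|[k [Xk kP]]] := counting_fin X.
  by rewrite Xoo; apply/esym/counting_oo => n; apply/XY; exact: (counting_oo X).1.
have [/counting_oo Yoo|[l [Yl lP]]] := counting_fin Y.
  by have := (kP k.+1).1 ((XY _).2 (Yoo _)); rewrite ltnn.
rewrite Xk Yl; congr (_%:R%:E); apply/eqP; rewrite eqn_leq.
apply/andP; split; first exact/lP/XY/kP.
exact/kP/XY/lP.
Qed.

Lemma counting_opp X : counting (-%R @^-1` X) = counting X :> \bar R.
Proof.
apply: counting_eq => n.
have H W : has_card_ge W n -> has_card_ge (-%R @^-1` W) n.
  move=> [s [us sn sW]]; exists (map -%R s); split.
  - by rewrite map_inj_uniq//; exact: oppr_inj.
  - by rewrite size_map.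
  - by move=> _ /mapP[x /sW Wx ->]; rewrite /= opprK.
split=> [/H|/H //].
by rewrite (_ : -%R @^-1` (-%R @^-1` X) = X)//; apply/seteqP; split=> x /=; rewrite opprK.
Qed.

Lemma counting_disjU X Y (k l : nat) : (forall x, X x -> ~ Y x) ->
  counting X = k%:R%:E :> \bar R -> counting Y = l%:R%:E :> \bar R ->
  counting (X `|` Y) = (k + l)%:R%:E :> \bar R.
Proof.
move=> XY; rewrite /counting; case: asboolP => // fX [kE]; case: asboolP => // fY [lE].
case: asboolP => [fXY|[]]; last by rewrite finite_setU.
congr EFin; rewrite fset_setU// natrD -kE -lE -natrD; congr _%:R.
rewrite -cardfsUI (_ : (_ `&` _)%fset = fset0) ?cardfs0 ?addn0//.
by apply/fsetP => x; rewrite in_fsetI !in_fset_set// in_fset0; apply/negP => /andP[/set_mem/XY nY /set_mem].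
Qed.

Definition separates Z X := forall a b, a < b -> X a -> X b -> exists2 z, a < z < b & Z z.

Lemma separates_sorted Z X x s : separates Z X -> X x -> path <%R x s ->
  (forall y, y \in s -> X y) ->
  exists t, [/\ path <%R x t, size t = size s & forall y, y \in t -> Z y].
Proof.
move=> ZX; elim: s x => [|y s IH] x Xx /=; first by exists [::].
move=> /andP[xy ys] sX; have Xy : X y by apply: sX; rewrite mem_head.
have [z /andP[xz zy] Zz] := ZX _ _ xy Xx Xy.
have [|t [yt ts tZ]] := IH _ Xy ys; first by move=> u us; apply: sX; rewrite inE us orbT.
exists (z :: t); split => /=.
- by rewrite xz; case: t yt {ts tZ} => //= u t /andP[yu ->]; rewrite (lt_trans zy yu).
- by rewrite ts.
- by move=> u; rewrite inE => /predU1P[->//|/tZ].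
Qed.

Lemma has_card_sorted X n : has_card_ge X n ->
  exists s, [/\ sorted <%R s, size s = n & forall x, x \in s -> X x].
Proof.
move=> [s [us sn sX]]; exists (sort <=%R s); split.
- by rewrite sort_lt_sorted.
- by rewrite size_sort.
- by move=> x; rewrite mem_sort; exact: sX.
Qed.

Lemma separates_card Z X n : separates Z X -> has_card_ge X n.+1 -> has_card_ge Z n.
Proof.
move=> ZX /has_card_sorted[[|x s] [//= xs [sn] sX]].
have [||t [xt ts tZ]] := separates_sorted ZX _ xs.
- by apply: sX; rewrite mem_head.
- by move=> y ys; apply: sX; rewrite inE ys orbT.
exists t; split=> //; last by rewrite ts.
exact: lt_sorted_uniq (path_sorted xt).
Qed.

(** The point below the least element makes up for the one that is lost in passing from points to
    gaps. *)
Lemma separates_below_card Z X n : separates Z X ->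
  (forall a, X a -> exists2 z, z < a & Z z) -> has_card_ge X n -> has_card_ge Z n.
Proof.
case: n => [|n] ZX bel; first by exists [::].
move=> /has_card_sorted[[|x s] [//= xs [sn] sX]].
have Xx : X x by apply: sX; rewrite mem_head.
have [|t [xt ts tZ]] := separates_sorted ZX Xx xs.
  by move=> y ys; apply: sX; rewrite inE ys orbT.
have [z zx Zz] := bel _ Xx; exists (z :: t); split.
- apply: lt_sorted_uniq => /=; case: t xt {ts tZ} => //= u t /andP[xu ->].
  by rewrite (lt_trans zx xu).
- by rewrite /= ts sn.
- by move=> u; rewrite inE => /predU1P[->//|/tZ].
Qed.

(** If [Y] is infinite, so are [X] and [Z]. In the finite case an even sum [x + y] forces
    [x = z = y], and an odd one [y = x + 1], where [z] may be either of the two. *)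
Lemma interlaced_counting X Y Z : (forall x, X x -> ~ Y x) ->
  separates Z X -> (forall a, X a -> exists2 z, z < a & Z z) ->
  separates Y Z -> (forall a, Z a -> exists2 y, y < a & Y y) ->
  separates X Y ->
  let N : \bar R := counting (X `|` Y) in let M : \bar R := counting Z in
  [/\ forall n : nat, N = n%:R%:E -> ~~ odd n -> M = (n%:R / 2)%:E,
      forall n : nat, N = n%:R%:E -> odd n ->
        M = ((n%:R + 1) / 2)%:E \/ M = ((n%:R - 1) / 2)%:E &
      N = +oo%E <-> M = +oo%E].
Proof.
move=> disj ZX ZbX YZ YbZ XY N M.
have xz n : has_card_ge X n -> has_card_ge Z n by exact: separates_below_card.
have zy n : has_card_ge Z n -> has_card_ge Y n by exact: separates_below_card.
have yx n : has_card_ge Y n.+1 -> has_card_ge X n by exact: separates_card.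
have [/counting_oo Yoo|[y [Yy yP]]] := counting_fin Y.
  have Zoo : M = +oo%E by apply/counting_oo => n; exact/xz/yx.
  have Noo : N = +oo%E.
    apply/counting_oo => n; have [s [us sn sY]] := Yoo n; exists s; split=> // x /sY.
    by right.
  by rewrite Zoo Noo; split.
have fin W : (forall n, has_card_ge W n -> has_card_ge Y n) ->
    exists k, counting W = k%:R%:E :> \bar R /\ forall n, has_card_ge W n <-> (n <= k)%N.
  move=> WY; have [/counting_oo Woo|//] := counting_fin W.
  by have := (yP y.+1).1 (WY _ (Woo _)); rewrite ltnn.
have [z [Zz zP]] := fin Z zy; have [x [Xx xP]] := fin X (fun n h => zy n (xz n h)).
have xlz : (x <= z)%N by apply/zP/xz/xP.
have zly : (z <= y)%N by apply/yP/zy/zP.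
have ylx : (y <= x.+1)%N.
  by case: y yP {fin zly Yy} => // y yP; rewrite ltnS; apply/xP/yx/yP.
have NE : N = (x + y)%:R%:E by exact: counting_disjU.
rewrite NE /M Zz; split=> //.
- move=> n [/eqP]; rewrite eqr_nat => /eqP <- ev; congr EFin.
  have -> : (x + y = z + z)%N by lia.
  by rewrite natrD; field.
- move=> n [/eqP]; rewrite eqr_nat => /eqP nE od.
  have [zx|zx] : z = x \/ z = x.+1 by lia.
    right; congr EFin; rewrite -nE (_ : (x + y = z + z + 1)%N); last by lia.
    by rewrite !natrD; field.
  left; congr EFin; rewrite -nE (_ : (x + y)%:R + 1 = (z + z)%:R); last first.
    by rewrite natr1; congr _%:R; lia.
  by rewrite !natrD; field.
Qed.

Lemma clusters_opp X (m : \bar R) : clusters_at X m -> clusters_at (-%R @^-1` X) (- m)%E.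
Proof.
move=> Xm U Um.
have [y [ym [x Xx xy] Uy]] : exists y, [/\ y != m, (EFin @` X) y & U (- y)%E].
  by apply: Xm; exact: (@oppe_continuous R m _ Um).
exists (- y)%E; split=> //; first by apply: contraNneq ym => /oppe_inj ->.
by exists (- x); rewrite /= ?opprK// -xy.
Qed.

Lemma clusters_atP X (m : \bar R) : m != -oo%E -> (forall x, X x -> (x%:E < m)%E) ->
  clusters_at X m <-> forall t : R, (t%:E < m)%E -> exists2 x, X x & t < x.
Proof.
move=> moo Xm; split=> [cl t tm|H U].
  have [|_ [_ [x Xx <-] tx]] := cl [set x | (t%:E < x)%E]; last first.
    by exists x => //; rewrite -lte_fin.
  exact: open_ereal_gt'.
have fin x : X x -> U x%:E -> exists y, [/\ y != m, (EFin @` X) y & U y].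
  by move=> Xx Ux; exists x%:E; split=> //; rewrite lt_eqF// Xm.
case: m moo Xm H fin => [m| |//] _ Xm H fin.
  move=> [e /= e0 eU].
  have [|x Xx tx] := H (m - e); first by rewrite lte_fin; lra.
  apply: (fin x Xx); apply: eU; have := Xm _ Xx; rewrite lte_fin => xm /=.
  by rewrite gtr0_norm; lra.
move=> [M [_ MU]]; have [|x Xx tx] := H M; first by rewrite ltry.
by apply: (fin x Xx); apply: MU; rewrite lte_fin.
Qed.

End Counting.

(** * From the eigenvalues of the inverses back to reciprocals *)

Section Interlacing.
Variables (R : realType) (H : lmodType R[i]).
Implicit Types (S K D : H -> H) (n : H -> H -> R[i]) (a b c : R).

Definition inv_ev S a b : set R := [set l | a < l < b /\ ev S l^-1].
Definition inv_evs K D a b : set R := [set l | a < l < b /\ evs K D l^-1].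

Lemma inv_between (P Q : R -> Prop) a b : 0 <= a -> 0 < b ->
  (forall k l, b^-1 < k -> k < l -> P k -> P l -> exists2 z, k < z < l & Q z) ->
  separates [set l | a < l < b /\ Q l^-1] [set l | a < l < b /\ P l^-1].
Proof.
move=> a0 b0 PQ x y xy [/andP[ax xb] Px] [/andP[ay yb] Py].
have x0 := le_lt_trans a0 ax; have y0 := le_lt_trans a0 ay.
have [||z /andP[yz zx] Qz] := PQ _ _ _ _ Py Px; rewrite ?ltf_pV2//.
have z0 : 0 < z by apply: lt_trans yz; rewrite invr_gt0.
have xz : x < z^-1 by rewrite -ltf_pV2 ?invrK// ?posrE ?invr_gt0.
have zy : z^-1 < y by rewrite -ltf_pV2 ?invrK// ?posrE ?invr_gt0.
exists z^-1; first by rewrite xz.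
by split; rewrite ?invrK// (lt_trans ax xz) (lt_trans zy yb).
Qed.

(** Inversion reverses the order, so an eigenvalue above another one becomes one below it. *)
Lemma inv_below (P Q : R -> Prop) b : 0 < b ->
  (forall k, b^-1 < k -> P k -> exists2 z, k < z & Q z) ->
  forall l, 0 < l < b -> P l^-1 -> exists2 z, 0 < z < l & Q z^-1.
Proof.
move=> b0 PQ l /andP[l0 lb] Pl; have [|z lz Qz] := PQ l^-1 _ Pl.
  by rewrite ltf_pV2.
have z0 : 0 < z by apply: lt_trans lz; rewrite invr_gt0.
exists z^-1; last by rewrite invrK.
by rewrite invr_gt0 z0 -ltf_pV2 ?invrK// ?posrE ?invr_gt0.
Qed.

Lemma evs_sym n K D h c b l : rank1_pair n K D h c b^-1 -> 0 < l < b ->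
  evs D K l^-1 <-> evs K D l^-1.
Proof.
move=> p /andP[l0 lb]; have kl : b^-1 < l^-1 by rewrite ltf_pV2// posrE (lt_trans l0).
by split; [apply: (evsC (rank1_pairC p))|apply: (evsC p)].
Qed.

(** By [rank1_pairC] the constant [c] may be taken nonnegative; this exchanges the roles of [K] and
    [D], but neither their union nor, by [evs_sym], the set [inv_evs] is affected. *)
Lemma pair_counting n K D h c a b : 0 <= a -> 0 < b -> rank1_pair n K D h c b^-1 ->
  (forall l, 0 < l < b -> ev K l^-1 -> a < l) ->
  (forall l, 0 < l < b -> ev D l^-1 -> a < l) ->
  let N : \bar R := counting (inv_ev D a b `|` inv_ev K a b) in
  let M : \bar R := counting (inv_evs K D a b) in
  [/\ forall m : nat, N = m%:R%:E -> ~~ odd m -> M = (m%:R / 2)%:E,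
      forall m : nat, N = m%:R%:E -> odd m ->
        M = ((m%:R + 1) / 2)%:E \/ M = ((m%:R - 1) / 2)%:E &
      N = +oo%E <-> M = +oo%E].
Proof.
move=> a0 b0 p lowK lowD.
have main K' D' c' : rank1_pair n K' D' h c' b^-1 -> 0 <= c' ->
    (forall l, 0 < l < b -> ev K' l^-1 -> a < l) ->
    let N : \bar R := counting (inv_ev D' a b `|` inv_ev K' a b) in
    let M : \bar R := counting (inv_evs K' D' a b) in
    [/\ forall m : nat, N = m%:R%:E -> ~~ odd m -> M = (m%:R / 2)%:E,
        forall m : nat, N = m%:R%:E -> odd m ->
          M = ((m%:R + 1) / 2)%:E \/ M = ((m%:R - 1) / 2)%:E &
        N = +oo%E <-> M = +oo%E].
  move=> p' c0 low.
  have belowZ := inv_below b0 (fun k => ev_above_evs p' c0).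
  have belowX := inv_below b0 (fun k => evs_above p' c0).
  (* The eigenvalues found below a given one must not leave []a, b[]. Those of [K'] cannot by [low],
     and each one of [K' D'] still has one of [K'] below it. *)
  have lowZ l : 0 < l < b -> evs K' D' l^-1 -> a < l.
    move=> lb Zl; have [y /andP[y0 yl] Ky] := belowZ l lb Zl.
    apply: (lt_trans _ yl); apply: low => //; rewrite y0 (lt_trans yl)//.
    by case/andP: lb.
  have pos l : a < l < b -> 0 < l < b.
    by case/andP => al ->; rewrite (le_lt_trans a0 al).
  apply: interlaced_counting.
  - move=> l [/pos/andP[l0 lb] Dl] [_ Kl].
    by apply: (ev_disj p' _ Kl Dl); rewrite ltf_pV2// posrE.
  - by apply: (inv_between (P := ev D') (Q := evs K' D')) => // k l; exact: (evs_between p').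
  - move=> l [/pos l0b Dl]; have [z /andP[z0 zl] Zz] := belowX l l0b Dl.
    have zb : z < b by apply: lt_trans zl _; case/andP: l0b.
    by exists z => //; split=> //; rewrite zb andbT lowZ// z0.
  - by apply: (inv_between (P := evs K' D') (Q := ev K')) => // k l; exact: (ev_between_evs p').
  - move=> l [/pos l0b Zl]; have [z /andP[z0 zl] Kz] := belowZ l l0b Zl.
    have zb : z < b by apply: lt_trans zl _; case/andP: l0b.
    by exists z => //; split=> //; rewrite zb andbT low// z0.
  - by apply: (inv_between (P := ev K') (Q := ev D')) => // k l; exact: (ev_between p').
have [c0|/ltW c0] := leP 0 c; first exact: main p c0 lowK.
have := main _ _ _ (rank1_pairC p); rewrite oppr_ge0 => /(_ c0 lowD).
rewrite [X in counting X]setUC (_ : inv_evs D K a b = inv_evs K D a b)//.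
apply/seteqP; split=> l [/andP[al lb] Zl]; (split; first by rewrite al);
  by apply/(evs_sym p) => //; rewrite lb (le_lt_trans a0 al).
Qed.

End Interlacing.

(** * Eigenvalue counts and accumulation of eigenvalues for [A] and [JA] *)

Theorem theorem4p4 (R : realType) (r p q : R -> R)
    (r_loc : locally_integrable [set: R] r)
    (p_loc : locally_integrable [set: R] (fun x => (p x)^-1))
    (q_loc : locally_integrable [set: R] q)
    (p_gt0 : {ae @lebesgue_measure R, forall x, 0 < p x})
    (r_gt0 : {ae @lebesgue_measure R, forall x, 0 < x -> 0 < r x})
    (r_lt0 : {ae @lebesgue_measure R, forall x, x < 0 -> r x < 0})
    (p_even : {ae @lebesgue_measure R, forall x, p x = p (- x)})
    (q_even : {ae @lebesgue_measure R, forall x, q x = q (- x)})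
    (r_odd : {ae @lebesgue_measure R, forall x, r x = - r (- x)})
    (A_selfadjoint : selfadjoint (L2_dot r) (maximal_op r p q))
    (m mess : \bar R)
    (m_min : is_min (spectrum (L2_dot r) (maximal_op r p q)) m)
    (mess_min : is_min (ess_spectrum (L2_dot r) (maximal_op r p q)) mess)
    (m_gt0 : (0 < m)%E)
    (m_lt_mess : (m < mess)%E) :
  let A := maximal_op r p q in
  let JA := indefinite_op r p q in
  (forall alpha beta : R,
     0 <= alpha -> (alpha%:E < m)%E -> (m < beta%:E)%E -> (beta%:E <= mess)%E ->
     let nA := n_eig A alpha beta in
     let nJA := n_eig JA alpha beta in
     let nJA' := n_eig JA (- beta) (- alpha) in
     [/\ nJA = nJA',
         forall n : nat, nA = n%:R%:E -> ~~ odd n -> nJA = (n%:R / 2)%:E,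
         forall n : nat, nA = n%:R%:E -> odd n ->
           nJA = ((n%:R + 1) / 2)%:E \/ nJA = ((n%:R - 1) / 2)%:E &
         (nA = +oo%E \/ nJA = +oo%E \/ nJA' = +oo%E) <->
         [/\ nA = +oo%E, nJA = +oo%E & nJA' = +oo%E]])
  /\
  (clusters_at [set x | real_eigenvalue A x /\ (x%:E < mess)%E] mess <->
   let S := [set x | real_eigenvalue JA x /\ (- mess < x%:E < mess)%E] in
   clusters_at S (- mess)%E /\ clusters_at S mess).
Proof.
move=> A JA.
have nH : hform (L2_dot r) by apply: L2_dot_hform; case: r_loc.
have [m0 mE] : exists m0, m = m0%:E.
  case: m m_min m_gt0 m_lt_mess => [m0 _ _ _|_ _|[]]; first by exists m0.
  by rewrite ltNge leey.
move: m_min m_gt0 m_lt_mess; rewrite {}mE lte_fin => -[_ m_min] m0_gt0 m_lt.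
have res l : l < m0 -> resolvent_set (L2_dot r) A l%:C.
  move=> lm; apply: contrapT => /m_min; rewrite lecR leNgt lm//.
have T0 : resolvent_set (L2_dot r) A 0 by exact: (res 0).
have fredl l : (l%:E < mess)%E -> fredholm (L2_dot r) (op_shift A l%:C).
  move=> lm; apply: contrapT => nf.
  case: mess mess_min lm {m_lt} => [b [_ bmin]|E|//].
    by rewrite lte_fin ltNge -lecR bmin.
  by have : ess_spectrum (L2_dot r) A l%:C by []; rewrite E.
have low l : real_eigenvalue A l -> m0 <= l.
  by move=> Al; rewrite leNgt; apply/negP => /res /(resolvent_eigen nH A_selfadjoint); apply.
have neg l : l < 0 -> resolvent_set (L2_dot r) A l%:C.
  by move=> l0; apply: res; exact: lt_trans l0 m0_gt0.
pose K := evenK r_loc r_odd T0; pose D := evenD r_loc r_odd T0.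
have eigA l : l != 0 -> real_eigenvalue A l <-> ev K l^-1 \/ ev D l^-1.
  exact: maximal_eigenP.
have eigJA l : l != 0 -> real_eigenvalue JA l <-> evs K D l^-1.
  exact: indefinite_eigenP.
have eigJAN l : real_eigenvalue JA (- l) <-> real_eigenvalue JA l.
  have [->|l0] := eqVneq l 0; first by rewrite oppr0.
  by rewrite !eigJA ?oppr_eq0// /evs invrN sqrrN.
have pair b : 0 < b -> (b%:E <= mess)%E ->
    exists c h, rank1_pair (L2_dot r) K D h c b^-1.
  move=> b0 bm; apply: evenKD_pair => //; first by rewrite invr_ge0 ltW.
  move=> k bk; apply: fredl; apply: lt_le_trans bm; rewrite lte_fin.
  have k0 : 0 < k by apply: lt_trans bk; rewrite invr_gt0.
  by rewrite -ltf_pV2 ?invrK// posrE invr_gt0.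
split.
  move=> a b a0; rewrite !lte_fin => am mb bm nA nJA nJA'.
  have b0 := lt_trans m0_gt0 mb; have [c [h ph]] := pair b b0 bm.
  have nAE : nA = counting (inv_ev D a b `|` inv_ev K a b).
    congr counting; apply/seteqP; split=> [l [Al /andP[al lb]]|l].
      have l0 := le_lt_trans a0 al.
      by move/eigA: Al; rewrite gt_eqF// => /(_ isT)[Kl|Dl]; [right|left];
        split; rewrite ?al.
    have l0 : a < l < b -> l != 0 by move=> /andP[al _]; rewrite gt_eqF// (le_lt_trans a0).
    by move=> [] [lab Sl]; split=> //; apply/eigA; rewrite ?l0//; [right|left].
  have nJAE : nJA = counting (inv_evs K D a b).
    congr counting; apply/seteqP; split=> l /= [].
      move=> Al /andP[al lb]; split; first by rewrite al.
      by move: Al; rewrite eigJA// gt_eqF// (le_lt_trans a0 al).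
    move=> /andP[al lb] Zl; split; last by rewrite al.
    by rewrite eigJA// gt_eqF// (le_lt_trans a0 al).
  have nJAE' : nJA = nJA'.
    rewrite /nJA' /n_eig -counting_opp; congr counting; apply/seteqP.
    by split=> l /=; rewrite eigJAN !ltrN2 andbC.
  have [||ev od oo] := pair_counting a0 b0 ph.
  - by move=> l /andP[l0 _] Kl; apply: (lt_le_trans am); apply/low/eigA; [rewrite gt_eqF|left].
  - by move=> l /andP[l0 _] Dl; apply: (lt_le_trans am); apply/low/eigA; [rewrite gt_eqF|right].
  rewrite -nJAE' nAE nJAE; split=> //; split; last by case; left.
  by move=> [/[dup] /oo|[/[dup] /oo|/[dup] /oo]].
have messN : mess != -oo%E by rewrite gt_eqF// (le_lt_trans _ m_lt)// leNye.
have mess0 : (0 < mess)%E by apply: lt_trans m_lt; rewrite lte_fin.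
set SA := [set x | _]; set S := [set x | _].
have SN : -%R @^-1` S = S.
  by rewrite /S; apply/seteqP; split=> l /=; rewrite eigJAN EFinN lteN2 lteNl andbC.
have clN : clusters_at S (- mess)%E <-> clusters_at S mess.
  by split=> /clusters_opp; rewrite SN ?oppeK.
suff main : clusters_at SA mess <-> clusters_at S mess.
  by rewrite /= clN main; split=> [|[]].
(* The threshold [t] may be taken nonnegative, so that the eigenvalues found beyond it are positive
   and have reciprocals. *)
have posmax t : (t%:E < mess)%E -> ((Num.max t 0)%:E < mess)%E.
  by move=> tm; rewrite EFin_max gt_max tm.
rewrite !clusters_atP//; last 2 first.
- by move=> x [_ /andP[]].
- by move=> x [].
split=> H t /posmax tm.
  (* Of three eigenvalues [x < y < z] of [A] two belong to the same one of [K] and [D], and an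
     eigenvalue of [K D] lies between these two. The fourth, [w], serves as a real upper bound,
     since [mess] may be infinite. *)
  have [x [Ax xm]] := H _ tm; rewrite gt_max => /andP[tx x0].
  have [y [Ay ym] xy] := H _ xm; have [z [Az zm] yz] := H _ ym.
  have [w [_ wm] zw] := H _ zm.
  have y0 := lt_trans x0 xy; have z0 := lt_trans y0 yz; have w0 := lt_trans z0 zw.
  have [c [h ph]] := pair w w0 (ltW wm).
  have sepD : separates (inv_evs K D 0 w) (inv_ev D 0 w).
    by apply: (inv_between (P := ev D) (Q := evs K D)) => // k l; exact: (evs_between ph).
  have sepK : separates (inv_evs K D 0 w) (inv_ev K 0 w).
    apply: (inv_between (P := ev K) (Q := evs K D)) => // k l wk kl Kk Kl.
    have [i /andP[ki il] Zi] := evs_between (rank1_pairC ph) wk kl Kk Kl.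
    exists i; first by rewrite ki.
    exact: (evsC (rank1_pairC ph) (lt_trans wk ki) Zi).
  have yw := lt_trans yz zw; have xw := lt_trans xy yw.
  have inter u v : x <= u -> u < v -> v <= z -> (ev K u^-1 /\ ev K v^-1 \/ ev D u^-1 /\ ev D v^-1) ->
      exists2 s, S s & t < s.
    move=> xu uv vz Q.
    have u0 := lt_le_trans x0 xu; have v0 := lt_trans u0 uv.
    have vw := le_lt_trans vz zw; have uw := lt_trans uv vw.
    have [s /andP[us sv] [/andP[s0 sw] Zs]] :
        exists2 s, u < s < v & inv_evs K D 0 w s.
      by case: Q => -[]; [have := @sepK u v uv|have := @sepD u v uv];
        rewrite /inv_ev /= u0 v0 uw vw => sep Qu Qv; exact: sep.
    have sm : (s%:E < mess)%E by apply: lt_trans wm; rewrite lte_fin.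
    exists s; last by rewrite (lt_trans tx)// (le_lt_trans xu).
    split; first by apply/eigJA => //; rewrite gt_eqF.
    by rewrite sm andbT lteNl -EFinN (lt_trans _ mess0)// lte_fin oppr_lt0.
  move: Ax Ay Az; rewrite !eigA ?gt_eqF// => Ax Ay Az.
  have [xy2|yz2|xz2] : [\/ (ev K x^-1 /\ ev K y^-1 \/ ev D x^-1 /\ ev D y^-1),
      (ev K y^-1 /\ ev K z^-1 \/ ev D y^-1 /\ ev D z^-1) |
      (ev K x^-1 /\ ev K z^-1 \/ ev D x^-1 /\ ev D z^-1)].
  - by case: Ax Ay Az => ? [] ? [] ?; (constructor 1; tauto) || (constructor 2; tauto) ||
      (constructor 3; tauto).
  - exact: (inter _ _ (lexx x) xy (ltW yz) xy2).
  - exact: (inter _ _ (ltW xy) yz (lexx z) yz2).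
  - exact: (inter _ _ (lexx x) (lt_trans xy yz) (lexx z) xz2).
(* Two eigenvalues [x < y] of [JA] enclose one of [K], which is an eigenvalue of [A]; [w] is again
   the real upper bound. *)
have [x [Zx /andP[_ xm]]] := H _ tm; rewrite gt_max => /andP[tx x0].
have [y [Zy /andP[_ ym]] xy] := H _ xm; have [w [_ /andP[_ wm]] yw] := H _ ym.
have y0 := lt_trans x0 xy; have w0 := lt_trans y0 yw.
have [c [h ph]] := pair w w0 (ltW wm).
have sep : separates (inv_ev K 0 w) (inv_evs K D 0 w).
  by apply: (inv_between (P := evs K D) (Q := ev K)) => // k l; exact: (ev_between_evs ph).
have [||s /andP[xs sy] [/andP[s0 sw] Ks]] := sep _ _ xy.
- by split; [rewrite x0 (lt_trans xy)|apply/eigJA => //; rewrite gt_eqF].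
- by split; [rewrite y0|apply/eigJA => //; rewrite gt_eqF].
exists s; last exact: lt_trans xs.
split; first by apply/eigA; [rewrite gt_eqF|left].
by apply: lt_trans wm; rewrite lte_fin.
Qed.
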